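(* Let $m\geq 2$, and for $d\geq 2$ let $F_d$ be a free group of rank $d$. Then there exist infinitely many values of $d$ such that the finitely generated group $S_m(F_d)$ is simple.
   Context: For an abstract group $G$, the commensurator $\mathrm{Comm}(G)$ is the group of equivalence classes of isomorphisms $f:U\to V$ between finite index subgroups of $G$, where two such isomorphisms are equivalent if they coincide on some finite index subgroup of $G$, and the product is $[f_1][f_2]=[f_1\circ f_2]$ (the composition being restricted to the finite index subgroup where it makes sense). If $F$ is a non-abelian free group of finite rank and $H$ is a finite index subgroup of $F$, the canonical homomorphism $\mathrm{Aut}(H)\to\mathrm{Comm}(F)$, $\phi\mapsto[\phi]$, is injective, and $\mathrm{Aut}(H)$ is identified with its image. For a free group $H$ of finite rank $r\ge 2$, $\mathrm{SAut}(H)$ is the preimage of $\mathrm{SL}_r(\mathbb Z)$ under the canonical surjection $\mathrm{Aut}(H)\to\mathrm{Aut}(H/[H,H])\cong\mathrm{GL}_r(\mathbb Z)$. For a non-abelian free group $F$ of finite rank and $m\ge 2$, $S_m(F)$ is the subgroup of $\mathrm{Comm}(F)$ generated by the subgroups $\mathrm{SAut}(H)$, where $H$ ranges over all normal subgroups of $F$ such that $F/H$ is cyclic of order $m$. (It is finitely generated.) *)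

(* Defs.v *)
From HB Require Import structures.
From mathcomp Require Import all_boot all_order all_algebra generic_quotient.
From mathcomp Require Import monoid.
From mathcomp Require Import mathcomp_extra boolp classical_sets functions cardinality.

Set Implicit Arguments.
Unset Strict Implicit.
Unset Printing Implicit Defensive.

(* Groups are possibly infinite [groupType]s, and a subgroup of [G] is a
   [set G] satisfying [subgroup]. *)

Local Open Scope classical_set_scope.
Local Open Scope group_scope.
Local Open Scope quotient_scope.
Local Open Scope card_scope.

Section Groups.
Variable G : groupType.
Implicit Types (H S N A : set G) (x y t : G).

Definition subgroup H :=
  [/\ H 1, forall x y, H x -> H y -> H (x * y) & forall x, H x -> H x^-1].

Definition gen A : set G := smallest subgroup A.

Definition finitely_generated S := exists2 A, finite_set A & S = gen A.

Definition derived H : set G :=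
  gen [set z | exists x y, [/\ H x, H y & z = [~ x, y]]].

Definition normal_in N S :=
  [/\ subgroup N, N `<=` S & forall n s, N n -> S s -> N (n ^ s)].

Definition simple S :=
  [/\ subgroup S, S <> [set 1] &
      forall N, normal_in N S -> N = [set 1] \/ N = S].

Definition lcoset x H : set G := [set x * h | h in H].

Definition lcosets H : set (set G) := range (lcoset^~ H).

Definition finite_index H := finite_set (lcosets H).

Definition fi_subgroup H := subgroup H /\ finite_index H.

Definition expgz x (k : int) : G :=
  match k with Posz n => x ^+ n | Negz n => x ^- n.+1 end.

(* For [H] normal in [G]: the quotient [G / H] is cyclic of order [m]. *)
Definition cyclic_quotient H (m : nat) :=
  (exists t, forall x, exists k : int, lcoset x H = lcoset (expgz t k) H)
  /\ lcosets H #= `I_m.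

(* Homomorphisms defined on a subgroup are total functions whose values
   outside of the subgroup are irrelevant. *)
Definition hom_on (K : groupType) H (f : G -> K) :=
  forall x y, H x -> H y -> f (x * y) = f x * f y.

(* Universal property: [H] is free on the family [x]. *)
Definition is_basis H (r : nat) (x : 'I_r -> G) :=
  [/\ subgroup H, forall i, H (x i) &
      forall (K : groupType) (y : 'I_r -> K),
        (exists2 f : G -> K, hom_on H f & forall i, f (x i) = y i)
        /\ (forall f g : G -> K,
              hom_on H f -> (forall i, f (x i) = y i) ->
              hom_on H g -> (forall i, g (x i) = y i) ->
              forall h, H h -> f h = g h)].

(* [A] is the matrix, in the [Z]-basis of [H / [H, H]] given by the classes of
   the [x i], of the endomorphism induced by [phi]; row [i] holds the
   coordinates of the class of [phi (x i)]. *)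
Definition ab_matrix H (r : nat) (x : 'I_r -> G) (phi : G -> G)
    (A : 'M[int]_r) :=
  forall i, lcoset (phi (x i)) (derived H)
          = lcoset (\prod_(j < r) expgz (x j) (A i j)) (derived H).

(* The determinant does not depend on the basis, so asking for one basis is the
   same as asking for all of them. *)
Definition special H (phi : G -> G) :=
  exists (r : nat) (x : 'I_r -> G) (A : 'M[int]_r),
    [/\ is_basis H x, ab_matrix H x phi A & (\det A = 1)%R].

End Groups.

Definition free_of_rank (G : groupType) (r : nat) :=
  exists x : 'I_r -> G, is_basis [set: G] x.

(* Isomorphisms between finite index subgroups of [G]. *)
Record virtual_iso (G : groupType) := VirtualIso {
  vdom : set G;
  vcod : set G;
  vfun :> G -> G;
  vdomP : fi_subgroup vdom;
  vcodP : fi_subgroup vcod;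
  vfunM : hom_on vdom vfun;
  vfun_bij : set_bij vdom vcod vfun
}.

HB.instance Definition _ (G : groupType) := gen_eqMixin (virtual_iso G).
HB.instance Definition _ (G : groupType) := gen_choiceMixin (virtual_iso G).

Section FiniteIndex.
Variable G : groupType.
Implicit Types (H U V W : set G) (x y : G).

Lemma lcosetP H x y : subgroup H -> lcoset x H = lcoset y H <-> H (x^-1 * y).
Proof.
move=> [H1 HM HV]; split=> [e|h].
  have : lcoset y H y by exists 1; rewrite // mulg1.
  by rewrite -e => -[h Hh <-]; rewrite mulKg.
apply/seteqP; split=> z [k Hk <-].
  exists ((x^-1 * y)^-1 * k); first exact/HM/Hk/HV.
  by rewrite invgM invgK -!mulgA mulVKg.
by exists (x^-1 * y * k); [exact: HM|rewrite -!mulgA mulVKg].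
Qed.

Lemma finite_indexP H : subgroup H ->
  finite_index H <->
  exists (T : finType) (c : G -> T), forall x y, c x = c y -> H (x^-1 * y).
Proof.
move=> sH; split=> [/finite_seqP[s es]|[T [c cP]]].
  have lt x : index (lcoset x H) s < size s.
    rewrite index_mem.
    have : lcosets H (lcoset x H) by exists x.
    by rewrite es.
  exists 'I_(size s), (fun x => Ordinal (lt x)) => x y [e].
  apply/lcosetP => //.
  have := congr1 (nth set0 s) e.
  by rewrite !nth_index -?index_mem.
pose d (t : T) := lcoset (xget 1 [set x | c x = t]) H.
apply: (@sub_finite_set _ _ (d @` setT)); last exact/finite_image/finite_finset.
move=> _ [x _ <-]; exists (c x) => //; apply/lcosetP => //; apply: cP.
exact: (@xgetI _ 1 [set z | c z = c x] x erefl).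
Qed.

Lemma subgroupI U V : subgroup U -> subgroup V -> subgroup (U `&` V).
Proof.
move=> [U1 UM UV] [V1 VM VV]; split=> //.
- by move=> x y [? ?] [? ?]; split; [exact: UM|exact: VM].
- by move=> x [? ?]; split; [exact: UV|exact: VV].
Qed.

Lemma fi_subgroupT : fi_subgroup [set: G].
Proof.
by have sT : subgroup [set: G] by []; split=> //; apply/finite_indexP => //;
   exists unit, (fun=> tt).
Qed.

Lemma hom_on1 H (f : G -> G) : subgroup H -> hom_on H f -> f 1 = 1.
Proof.
move=> [H1 _ _] fM; apply: (@mulgI _ (f 1)).
by rewrite -fM // !mulg1.
Qed.

Lemma hom_onV H (f : G -> G) x :
  subgroup H -> hom_on H f -> H x -> f x^-1 = (f x)^-1.
Proof.
move=> sH fM Hx; have [H1 HM HV] := sH.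
apply: (@mulgI _ (f x)); rewrite -fM ?mulgV //; last exact: HV.
exact: hom_on1 fM.
Qed.

Lemma fi_preimage U W (f : G -> G) : fi_subgroup U -> hom_on U f ->
  fi_subgroup W -> fi_subgroup (U `&` f @^-1` W).
Proof.
move=> [sU fU] fM [sW fW].
have [U1 UM UV] := sU; have [W1 WM WV] := sW.
have sP : subgroup (U `&` f @^-1` W).
  split; first by split=> //=; rewrite (hom_on1 sU fM).
  - move=> x y [Ux Wx] [Uy Wy]; split; first exact: UM.
    by rewrite /= fM //; exact: WM.
  - move=> x [Ux Wx]; split; first exact: UV.
    by rewrite /= (hom_onV sU fM) //; exact: WV.
split=> //; apply/(finite_indexP sP).
have /(finite_indexP sU)[T [c cP]] := fU.
have /(finite_indexP sW)[T' [c' cP']] := fW.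
pose r (t : T) : G := xget 1 [set x | c x = t].
have rU x : U ((r (c x))^-1 * x).
  exact/cP/(@xgetI _ 1 [set z | c z = c x] x erefl).
exists (T * T')%type, (fun x => (c x, c' (f ((r (c x))^-1 * x)))).
move=> x y [ec]; have := rU y; have := rU x; rewrite -ec => Ux Uy /cP' Wxy.
have e : x^-1 * y = ((r (c x))^-1 * x)^-1 * ((r (c x))^-1 * y).
  by rewrite invgM invgK -!mulgA mulVKg.
split; first by rewrite e; apply: UM => //; exact: UV.
by rewrite /= e fM ?(hom_onV sU fM) //; exact: UV.
Qed.

Lemma fi_subgroupI U V :
  fi_subgroup U -> fi_subgroup V -> fi_subgroup (U `&` V).
Proof. by move=> fU fV; apply: (@fi_preimage U V id). Qed.

End FiniteIndex.

Section VirtualIso.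
Variable G : groupType.
Implicit Types f g h : virtual_iso G.

Lemma vcodf f x : vdom f x -> vcod f (f x).
Proof. by case: (vfun_bij f) => + _ _; apply. Qed.

Definition vinv_fun f (y : G) : G := xget 1 [set x | vdom f x /\ f x = y].

Lemma vinv_funP f y : vcod f y -> vdom f (vinv_fun f y) /\ f (vinv_fun f y) = y.
Proof.
case: (vfun_bij f) => _ _ /[apply] -[x dx e].
exact: (@xgetI _ 1 [set x | vdom f x /\ f x = y] x (conj dx e)).
Qed.

Lemma vfun_inj f x y : vdom f x -> vdom f y -> f x = f y -> x = y.
Proof.
by case: (vfun_bij f) => _ + _ dx dy; apply; apply/mem_set.
Qed.

Lemma vfunK f x : vdom f x -> vinv_fun f (f x) = x.
Proof. by move=> dx; have [? /vfun_inj->] := vinv_funP (vcodf dx). Qed.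

Lemma vinv_funM f : hom_on (vcod f) (vinv_fun f).
Proof.
move=> x y cx cy; have [_ UM _] := (vdomP f).1; have [_ VM _] := (vcodP f).1.
have [dx ex] := vinv_funP cx; have [dy ey] := vinv_funP cy.
have [dxy exy] := vinv_funP (VM _ _ cx cy).
by apply: (@vfun_inj f) => //; [exact: UM|rewrite vfunM // ex ey exy].
Qed.

Lemma vinv_bij f : set_bij (vcod f) (vdom f) (vinv_fun f).
Proof.
split.
- by move=> y /vinv_funP[].
- move=> x y /set_mem cx /set_mem cy e.
  by rewrite -(vinv_funP cx).2 e (vinv_funP cy).2.
- by move=> x dx; exists (f x); [exact: vcodf|exact: vfunK].
Qed.

Definition vid : virtual_iso G.
Proof.
by apply: (@VirtualIso G setT setT id); rewrite //; [exact: fi_subgroupT..|];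
   split=> // x _; exists x.
Defined.

Definition vinv f : virtual_iso G :=
  VirtualIso (vcodP f) (vdomP f) (@vinv_funM f) (vinv_bij f).

Definition vcomp_dom f g := vdom g `&` g @^-1` vdom f.
Definition vcomp_cod f g := vcod f `&` vinv_fun f @^-1` vcod g.

Lemma vcomp_domP f g : fi_subgroup (vcomp_dom f g).
Proof. exact: (fi_preimage (vdomP g) (@vfunM _ g) (vdomP f)). Qed.

Lemma vcomp_codP f g : fi_subgroup (vcomp_cod f g).
Proof. exact: (fi_preimage (vcodP f) (@vinv_funM f) (vcodP g)). Qed.

Lemma vcompM f g : hom_on (vcomp_dom f g) (f \o g).
Proof. by move=> x y [gx fx] [gy fy]; rewrite /= !vfunM. Qed.

Lemma vcomp_bij f g : set_bij (vcomp_dom f g) (vcomp_cod f g) (f \o g).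
Proof.
split.
- move=> x [gx fx]; split; first exact: vcodf.
  by rewrite /= vfunK //; exact: vcodf.
- move=> x y /set_mem[gx fx] /set_mem[gy fy] /= e.
  by apply: (vfun_inj gx gy); exact: (vfun_inj fx fy).
- move=> z [cz /= cz']; have [dz ez] := vinv_funP cz.
  have [dy ey] := vinv_funP cz'.
  exists (vinv_fun g (vinv_fun f z)); last by rewrite /= ey.
  by split=> //=; rewrite ey.
Qed.

Definition vcomp f g : virtual_iso G :=
  VirtualIso (vcomp_domP f g) (vcomp_codP f g) (@vcompM f g) (vcomp_bij f g).

Definition vequiv f g := exists W : set G,
  [/\ fi_subgroup W, W `<=` vdom f `&` vdom g & forall x, W x -> f x = g x].

Definition vequivb : rel (virtual_iso G) := fun f g => `[< vequiv f g >].

Lemma vequiv_refl : reflexive vequivb.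
Proof. by move=> f; apply/asboolP; exists (vdom f); split=> //; exact: vdomP. Qed.

Lemma vequiv_sym : symmetric vequivb.
Proof.
by move=> f g; apply/asbool_equiv_eq; split=> -[W [fW sW e]]; exists W;
   split=> // [|x /e //]; rewrite setIC.
Qed.

Lemma vequiv_trans : transitive vequivb.
Proof.
move=> g f h /asboolP[W [fW sW e]] /asboolP[W' [fW' sW' e']]; apply/asboolP.
exists (W `&` W'); split; first exact: fi_subgroupI.
  by move=> x [/sW[? _] /sW'[_ ?]].
by move=> x [/e-> /e'].
Qed.

Canonical vequiv_equiv :=
  EquivRel vequivb vequiv_refl vequiv_sym vequiv_trans.

End VirtualIso.

Definition Comm (G : groupType) := {eq_quot (@vequivb G)}.
HB.instance Definition _ (G : groupType) := Choice.on (Comm G).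
HB.instance Definition _ (G : groupType) := EqQuotient.on (Comm G).

Definition Comm_class (G : groupType) (f : virtual_iso G) : Comm G :=
  \pi_(Comm G) f.

Section CommGroup.
Variable G : groupType.
Implicit Types (f g : virtual_iso G) (a b c : Comm G).

Lemma Comm_classP f g : Comm_class f = Comm_class g <-> vequiv f g.
Proof.
split=> [/eqmodP/asboolP //|e].
exact/eqmodP/asboolP.
Qed.

Lemma Comm_classK a : Comm_class (repr a) = a.
Proof. exact: reprK. Qed.

Definition Comm_one : Comm G := Comm_class (vid G).
Definition Comm_mul a b : Comm G := Comm_class (vcomp (repr a) (repr b)).
Definition Comm_inv a : Comm G := Comm_class (vinv (repr a)).

Lemma Comm_mulE f g :
  Comm_mul (Comm_class f) (Comm_class g) = Comm_class (vcomp f g).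
Proof.
have /Comm_classP := Comm_classK (Comm_class f).
have /Comm_classP := Comm_classK (Comm_class g).
rewrite /Comm_mul; set f' := repr _; set g' := repr _.
move=> [V [fV sV eV]] [U [fU sU eU]].
apply/Comm_classP; exists ((vdom g `&` g @^-1` U) `&` V); split.
- apply: fi_subgroupI => //.
  exact: (fi_preimage (vdomP g) (@vfunM _ g) fU).
- move=> x [[gx /= Ux] Vx]; have [fx fx'] := sU _ Ux; have [gx' _] := sV _ Vx.
  by split; split=> //=; rewrite eV.
- by move=> x [[gx /= Ux] Vx] /=; rewrite eV // eU.
Qed.

Lemma Comm_invE f : Comm_inv (Comm_class f) = Comm_class (vinv f).
Proof.
have /Comm_classP := Comm_classK (Comm_class f).
rewrite /Comm_inv; set f' := repr _ => -[U [fU sU eU]].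
apply/Comm_classP.
exists (vcod f `&` vinv_fun f @^-1` U); split.
- exact: (fi_preimage (vcodP f) (@vinv_funM _ f) fU).
- move=> y [cy /= Uy]; split=> //; have [dy ey] := vinv_funP cy.
  by rewrite -ey -eU //; apply: vcodf; have [] := sU _ Uy.
- move=> y [cy /= Uy]; have [dy ey] := vinv_funP cy.
  by rewrite -{1}ey -eU // vfunK //; have [] := sU _ Uy.
Qed.

Lemma Comm_mulA : associative Comm_mul.
Proof.
move=> a b c; rewrite -(Comm_classK a) -(Comm_classK b) -(Comm_classK c).
rewrite !Comm_mulE; apply/Comm_classP.
set p := vcomp _ (vcomp _ _).
exists (vdom p); split=> //; first exact: vdomP.
by move=> x [[hx gx] fx].
Qed.

Lemma Comm_mul1 : left_id Comm_one Comm_mul.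
Proof.
move=> a; rewrite -(Comm_classK a) Comm_mulE; apply/Comm_classP.
by exists (vdom (repr a)); split=> //; exact: vdomP.
Qed.

Lemma Comm_mulg1 : right_id Comm_one Comm_mul.
Proof.
move=> a; rewrite -(Comm_classK a) Comm_mulE; apply/Comm_classP.
by exists (vdom (repr a)); split=> //; exact: vdomP.
Qed.

Lemma Comm_mulV : left_inverse Comm_one Comm_inv Comm_mul.
Proof.
move=> a; rewrite -(Comm_classK a) Comm_invE Comm_mulE; apply/Comm_classP.
exists (vdom (repr a)); split; first exact: vdomP.
  by move=> x dx; do 2!split=> //; exact: vcodf.
by move=> x dx /=; rewrite vfunK.
Qed.

Lemma Comm_mulgV : right_inverse Comm_one Comm_inv Comm_mul.
Proof.
move=> a; rewrite -(Comm_classK a) Comm_invE Comm_mulE; apply/Comm_classP.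
exists (vcod (repr a)); split; first exact: vcodP.
  by move=> x cx; have [? _] := vinv_funP cx.
by move=> x cx /=; have [] := vinv_funP cx.
Qed.

HB.instance Definition _ := isGroup.Build (Comm G)
  Comm_mulA Comm_mul1 Comm_mulg1 Comm_mulV Comm_mulgV.

End CommGroup.

(* The image of SAut(H) in Comm(F), for [H] of finite index in [F]. *)
Definition SAut (F : groupType) (H : set F) : set (Comm F) :=
  [set a | exists f : virtual_iso F,
    [/\ vdom f = H, vcod f = H, special H f & a = Comm_class f]].

Definition S_ (m : nat) (F : groupType) : set (Comm F) :=
  gen (\bigcup_(H in [set H : set F | normal_in H [set: F]
                                      /\ cyclic_quotient H m]) SAut H).

Arguments S_ : clear implicits.

(* Main.v *)
Require Import Defs.
From HB Require Import structures.
From mathcomp Require Import all_boot all_algebra perm monoid.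
From mathcomp Require Import boolp classical_sets functions cardinality zify.

(** All ranks [d >= 5] work. Conjugation embeds a free group [F] into [Comm F] as
    [g |-> ad g], and [Comm_class f * ad x * (Comm_class f)^-1 = ad (f x)]. Hence,
    for the image [G] of [F], an element of [Comm F] is determined by its action by
    conjugation on any subgroup of finite index of [G] ([ad_faith]), and two bases
    of such a subgroup are always conjugate in [Comm F] ([ad_real]). Apart from the
    identification of the generators of [S_m], the argument is carried out in an
    ambient group [Gam] with these two properties, where automorphisms are
    conjugations; [TV S y] says that the subgroup [S] contains the transvections
    [y i |-> y i * y j] and [y i |-> y j * y i] of the basis [y].

    Transvections. By Nielsen's theorem [TV S y] does not depend on the basis [y]
    ([TV_basis]), and the special automorphisms are products of transvections
    ([special_nie], [nie_S]). For a basis formed of [s] and of letters [z l], the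
    kernel of the homomorphism onto the integers modulo [n] mapping [s] to 1 and the
    [z l] to 0 has the Schreier basis formed of [s ^+ n] and of the conjugates
    [s ^+ j * z l * s ^- j] at the levels [j < n]. The subgroups [H] in the
    definition of [S_m] are exactly these kernels for [n = m]. All the transvections
    of Schreier bases are obtained from those between letters of level zero, when
    the basis [(s, z)] varies ([TV_schreier]).

    Iterated kernels. Let [p] be a prime divisor of [m]. A transvection of [G] acts
    on a kernel modulo [m] as a product of commuting transvections, so that [S_m]
    contains the transvections of [G], and similarly those of the kernels modulo [p]
    ([good_G]). This property is inherited from a subgroup [L] by its kernels modulo
    [p]: a transvection of the kernel of [t1] and a transvection of the kernel of
    [t2], where [t1] and [t2] are two letters of [L], move respectively a row and a
    column of a grid of letters, and their commutator is a single transvection of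
    the intersection of these kernels ([grid_commutator], [good_skernel]). So [S_m]
    contains the transvections of all the iterated kernels modulo [p].

    Simplicity. Let [N] be a non-trivial normal subgroup of [S_m]. It meets [G]
    non-trivially. A word of [N] in the letters of an iterated kernel is made
    shorter by passing to a further kernel, until it involves a single letter with an
    exponent prime to [p]; its commutator with another letter is then a letter of a
    kernel up to transvections ([descent]). Transvections carry this letter to all
    the others, and since the letters [z l] of a group belong to its kernel, climbing
    back shows that [N] contains [G]. The commutator of [s] with a transvection of
    level zero shifts that transvection to level one; another commutator isolates a
    transvection, so that [N] contains the transvections between letters of level
    zero ([normal_contains_TV]), hence all of them, hence all the [SAut H].

    Finite generation holds because there are finitely many kernels modulo [m]
    ([finite_family]), each having finitely many transvections. *)

Set Implicit Arguments.
Unset Strict Implicit.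
Unset Printing Implicit Defensive.

Local Open Scope classical_set_scope.
Local Open Scope group_scope.
Local Open Scope card_scope.

(** * Subgroups, generation and words *)

Section Subgroups.
Variable G : groupType.
Implicit Types (H S A B : set G) (x y c d : G).

Lemma sg1 H : subgroup H -> H 1. Proof. by case. Qed.

Lemma sgM H x y : subgroup H -> H x -> H y -> H (x * y).
Proof. by case=> _ + _; apply. Qed.

Lemma sgV H x : subgroup H -> H x -> H x^-1.
Proof. by case=> _ _; apply. Qed.

Lemma sgVE H x : subgroup H -> H x^-1 -> H x.
Proof. by move=> sH /(sgV sH); rewrite invgK. Qed.

Lemma sgJ H x y : subgroup H -> H x -> H y -> H (x ^ y).
Proof. by move=> sH Hx Hy; rewrite conjgE; apply: (sgM sH (sgV sH Hy)); exact: sgM. Qed.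

Lemma sgX H x n : subgroup H -> H x -> H (x ^+ n).
Proof.
by move=> sH Hx; elim: n => [|n IH]; [exact: sg1|rewrite expgS; exact: sgM].
Qed.

Lemma sgMl H x y : subgroup H -> H x -> H (x * y) -> H y.
Proof. by move=> sH Hx Hxy; rewrite -(mulKg x y); apply: (sgM sH) => //; exact: sgV. Qed.

Lemma sgMr H x y : subgroup H -> H y -> H (x * y) -> H x.
Proof. by move=> sH Hy Hxy; rewrite -(mulgK y x); apply: (sgM sH) => //; exact: sgV. Qed.

Lemma sgXV H x n : subgroup H -> H x -> H (x ^- n).
Proof. by move=> sH Hx; apply: (sgV sH); exact: sgX. Qed.

Lemma gen_subgroup A : subgroup (gen A).
Proof.
split; first by move=> B [/sg1].
- by move=> x y gx gy B [sB AB]; apply: sgM => //; [apply: gx|apply: gy].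
- by move=> x gx B [sB AB]; apply: sgV => //; apply: gx.
Qed.

Lemma in_gen A x : A x -> gen A x.
Proof. exact: sub_gen_smallest. Qed.

Lemma gen_min A B : subgroup B -> A `<=` B -> gen A `<=` B.
Proof. exact: smallest_sub. Qed.

Lemma gen_sub A B : A `<=` B -> gen A `<=` gen B.
Proof. by move=> AB; apply: (gen_min (gen_subgroup B)) => x /AB/in_gen. Qed.

Lemma subgroup_centralizer c : subgroup [set x | x ^ c = x].
Proof.
split=> /=; first by rewrite conj1g.
- by move=> x y ex ey; rewrite conjMg ex ey.
- by move=> x ex; rewrite conjVg ex.
Qed.

Lemma conj_gen_sub A S c : subgroup S -> (forall x, A x -> S (x ^ c)) ->
  forall x, gen A x -> S (x ^ c).
Proof.
move=> sS e; suff : gen A `<=` [set x | S (x ^ c)] by [].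
apply: gen_min => //; split=> /=; first by rewrite conj1g; exact: sg1.
- by move=> x y ex ey; rewrite conjMg; exact: sgM.
- by move=> x ex; rewrite conjVg; exact: sgV.
Qed.

Lemma hom1_on (K : groupType) H (f : G -> K) : subgroup H -> hom_on H f ->
  f 1 = 1.
Proof.
by move=> sH fM; apply: (@mulgI _ (f 1)); rewrite -fM ?mulg1 //; exact: sg1.
Qed.

Lemma homV_on (K : groupType) H (f : G -> K) x : subgroup H -> hom_on H f ->
  H x -> f x^-1 = (f x)^-1.
Proof.
move=> sH fM Hx; apply: (@mulgI _ (f x)).
by rewrite -fM ?mulgV ?(hom1_on sH fM) //; exact: sgV.
Qed.

Lemma hom_gen (K : groupType) A (f g : G -> K) :
  hom_on (gen A) f -> hom_on (gen A) g -> (forall x, A x -> f x = g x) ->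
  forall x, gen A x -> f x = g x.
Proof.
move=> fM gM e; have sA := gen_subgroup A.
suff : gen A `<=` [set x | gen A x /\ f x = g x] by move=> h x /h[].
apply: gen_min => [|x Ax]; last by split; [exact: in_gen|exact: e].
split=> [|x y [Ax ex] [Ay ey]|x [Ax ex]].
- by split; [exact: sg1|rewrite (hom1_on sA fM) (hom1_on sA gM)].
- by split; [exact: (sgM sA)|rewrite fM // gM // ex ey].
- by split; [exact: (sgV sA)|rewrite (homV_on sA fM) ?(homV_on sA gM) ?ex].
Qed.

End Subgroups.

Section Words.
Variables (I : Type) (G : groupType).
Implicit Types (y : I -> G) (a : I * bool) (u v : seq (I * bool)).

Definition sgn y a : G := if a.2 then y a.1 else (y a.1)^-1.

Definition eval y u : G := foldr (fun a g => sgn y a * g) 1 u.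

Definition inv_letter a := (a.1, ~~ a.2).

Definition inv_word u := rev (map inv_letter u).

Lemma inv_letterK : involutive inv_letter.
Proof. by case=> i b; rewrite /inv_letter /= negbK. Qed.

Lemma inv_wordK : involutive inv_word.
Proof.
move=> u; rewrite /inv_word map_rev revK -map_comp -[RHS]map_id.
by apply: eq_map => a; exact: inv_letterK.
Qed.

Lemma sgnV y a : sgn y (inv_letter a) = (sgn y a)^-1.
Proof. by case: a => i []; rewrite /sgn /= ?invgK. Qed.

Lemma eval_cat y u v : eval y (u ++ v) = eval y u * eval y v.
Proof. by elim: u => [|a u IH] /=; rewrite ?mul1g // IH mulgA. Qed.

Lemma eval_inv y u : eval y (inv_word u) = (eval y u)^-1.
Proof.
elim: u => [|a u IH]; first by rewrite /= invg1.
by rewrite /inv_word /= rev_cons -cats1 eval_cat -/(inv_word u) IH /= sgnV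
   mulg1 invgM.
Qed.

Lemma mem_sgn (H : set G) y a : subgroup H -> (forall i, H (y i)) ->
  H (sgn y a).
Proof. by move=> sH Hy; rewrite /sgn; case: a.2 => //; exact: sgV. Qed.

Lemma mem_eval (H : set G) y u : subgroup H -> (forall i, H (y i)) ->
  H (eval y u).
Proof.
move=> sH Hy; elim: u => [|a u IH] /=; first exact: sg1.
by apply: sgM => //; exact: mem_sgn.
Qed.

Lemma gen_wordP y x : gen (range y) x <-> exists u, x = eval y u.
Proof.
split; last first.
  by move=> [u ->]; apply: (mem_eval _ (gen_subgroup _)) => i; apply: in_gen.
suff : gen (range y) `<=` [set x | exists u, x = eval y u] by apply.
apply: gen_min => [|_ [i _ <-]]; last first.
  by exists [:: (i, true)]; rewrite /= mulg1.
split; first by exists [::].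
- by move=> _ _ [u ->] [v ->]; exists (u ++ v); rewrite eval_cat.
- by move=> _ [u ->]; exists (inv_word u); rewrite eval_inv.
Qed.

End Words.

(** * The group of bijections of a type *)

(** Homomorphisms out of a free group are obtained by letting the basis act by
    bijections; this one group replaces wreath products, induced actions and
    groups of reduced words. *)
Record self_bij (T : Type) := SelfBij {
  bij_fun :> T -> T;
  bij_inv : T -> T;
  bijK : cancel bij_fun bij_inv;
  bijVK : cancel bij_inv bij_fun
}.

HB.instance Definition _ (T : Type) := gen_eqMixin (self_bij T).
HB.instance Definition _ (T : Type) := gen_choiceMixin (self_bij T).

Section BijGroup.
Variable T : Type.
Implicit Types f g h : self_bij T.

Lemma bij_ext f g : f =1 g -> f = g.
Proof.
case: f g => [f f' fK fVK] [g g' gK gVK] /= e.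
have {}e : f = g by exact/funext.
subst g; have {}e : f' = g' by apply/funext => x; rewrite -{1}(gVK x) fK.
by subst g'; congr SelfBij; exact: Prop_irrelevance.
Qed.

Definition bij_one : self_bij T := @SelfBij T id id (frefl _) (frefl _).
Definition bij_mul f g : self_bij T :=
  SelfBij (can_comp (bijK f) (bijK g)) (can_comp (bijVK g) (bijVK f)).
Definition bij_Inv f : self_bij T := SelfBij (bijVK f) (bijK f).

Lemma bij_mulA : associative bij_mul.
Proof. by move=> f g h; exact: bij_ext. Qed.
Lemma bij_mul1 : left_id bij_one bij_mul.
Proof. by move=> f; exact: bij_ext. Qed.
Lemma bij_mulg1 : right_id bij_one bij_mul.
Proof. by move=> f; exact: bij_ext. Qed.
Lemma bij_mulV : left_inverse bij_one bij_Inv bij_mul.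
Proof. by move=> f; apply: bij_ext => x /=; rewrite bijK. Qed.
Lemma bij_mulgV : right_inverse bij_one bij_Inv bij_mul.
Proof. by move=> f; apply: bij_ext => x /=; rewrite bijVK. Qed.

HB.instance Definition _ := isGroup.Build (self_bij T)
  bij_mulA bij_mul1 bij_mulg1 bij_mulV bij_mulgV.

Lemma bijM f g x : (f * g) x = f (g x). Proof. by []. Qed.
Lemma bij1 x : (1 : self_bij T) x = x. Proof. by []. Qed.

End BijGroup.

(** * Bases indexed by a type *)

(** Generation is asked for in place of uniqueness of the homomorphisms. *)
Definition basis (G : groupType) (I : Type) (L : set G) (y : I -> G) :=
  L = gen (range y) /\
  forall (K : groupType) (a : I -> K),
    exists2 f : G -> K, hom_on L f & forall i, f (y i) = a i.

Section Basis.
Variable G : groupType.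
Implicit Types (L : set G).

Lemma basis_subgroup I L (y : I -> G) : basis L y -> subgroup L.
Proof. by case=> -> _; exact: gen_subgroup. Qed.

Lemma basis_letter I L (y : I -> G) : basis L y -> forall i, L (y i).
Proof. by case=> -> _ i; apply: in_gen; exists i. Qed.

Lemma basis_word I L (y : I -> G) x : basis L y -> L x ->
  exists u, x = eval y u.
Proof. by case=> -> _ /gen_wordP. Qed.

(** The two actions of [L] on two copies of [G], the second one being twisted by
    the exchange of the copies over [A], agree on [A] only. *)
Lemma hom_determined_sub L (A : set G) : subgroup L -> subgroup A ->
  A `<=` L ->
  (forall (K : groupType) (f g : G -> K), hom_on L f -> hom_on L g ->
     (forall a, A a -> f a = g a) -> forall x, L x -> f x = g x) ->
  L `<=` A.
Proof.
move=> sL sA AL huniq x Lx.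
pose swap (p : G * bool) := (p.1, p.2 (+) `[< A p.1 >]).
have swapK : involutive swap by case=> g b; rewrite /swap /= addbK.
pose tau := SelfBij swapK swapK.
have trK (g : G) : cancel (fun p : G * bool => (g * p.1, p.2))
                          (fun p => (g^-1 * p.1, p.2)).
  by case=> h b /=; rewrite mulKg.
have trVK (g : G) : cancel (fun p : G * bool => (g^-1 * p.1, p.2))
                          (fun p => (g * p.1, p.2)).
  by case=> h b /=; rewrite mulVKg.
pose f g := SelfBij (trK g) (trVK g); pose f' g := f g ^ tau.
have fM : hom_on L f.
  by move=> g h _ _; apply: bij_ext => -[k b] /=; rewrite mulgA.
have f'M : hom_on L f' by move=> g h Lg Lh; rewrite /f' fM // conjMg.
have /(huniq _ _ _ fM f'M)/(_ x Lx) : forall a, A a -> f a = f' a.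
  move=> a Aa; apply: bij_ext => -[h b].
  rewrite /f' conjgE !bijM /= /swap /=.
  have -> : `[< A (a * h) >] = `[< A h >]; last by rewrite addbK.
  apply: asbool_equiv_eq; split=> [Aah|Ah]; last exact: (sgM sA).
  exact: (sgMl sA Aa).
move=> /(congr1 (fun h : self_bij _ => (h (1, false)).2)).
rewrite /f' conjgE !bijM /= /swap /= mulg1.
have -> : `[< A 1 >] by apply/asboolP; exact: sg1.
by case: asboolP.
Qed.

(** Generation follows from uniqueness by [hom_determined_sub]. *)
Lemma is_basisP L r (y : 'I_r -> G) : is_basis L y <-> basis L y.
Proof.
split=> [[sL Ly univ]|bL].
  split=> [|K a]; last by have [] := univ K a.
  have genL : gen (range y) `<=` L by apply: (gen_min sL) => _ [i _ <-].
  apply/seteqP; split=> //; apply: (hom_determined_sub sL (gen_subgroup _) genL).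
  move=> K f g fM gM e x Lx; have [_ uni] := univ K (f \o y).
  by apply: uni => // i /=; rewrite e //; apply: in_gen; exists i.
split; first exact: basis_subgroup bL.
- by move=> i; exact: (basis_letter bL).
- move=> K a; case: bL => eL univ; split; first exact: univ.
  move=> f g; rewrite eL => fM ef gM eg; apply: hom_gen => // _ [i _ <-].
  by rewrite ef eg.
Qed.

Lemma basis_hom_ext I L (y : I -> G) (K : groupType) (f g : G -> K) :
  basis L y -> hom_on L f -> hom_on L g -> (forall i, f (y i) = g (y i)) ->
  forall x, L x -> f x = g x.
Proof.
by case=> -> _ fM gM e; apply: hom_gen => // _ [i _ <-].
Qed.

Lemma basis_reindex I J L (y : I -> G) (s : J -> I) (t : I -> J) :
  cancel s t -> cancel t s -> basis L y -> basis L (y \o s).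
Proof.
move=> sK tK [eL univ]; split=> [|K a].
  rewrite eL; congr gen; apply/seteqP; split=> _ [i _ <-].
    by exists (t i) => //=; rewrite tK.
  by exists (s i).
have [f fM e] := univ K (a \o t); exists f => // j.
by rewrite /= e /= sK.
Qed.

(** Such a change of letters is unipotent: the new letters are solved for the old
    ones, and a homomorphism with prescribed values on the new letters is obtained
    by first fixing its values on [A] and then correcting the others. *)
Lemma basis_unip I L (y y' : I -> G) (A : set I) : basis L y ->
  (forall i, A i -> y' i = y i) ->
  (forall i, ~ A i -> exists p q,
     [/\ gen (y @` A) p, gen (y @` A) q & y' i = p * y i * q]) ->
  basis L y'.
Proof.
move=> bL yA yB; have sL := basis_subgroup bL; case: (bL) => eL univ.
have AL : gen (y @` A) `<=` L.
  by apply: (gen_min sL) => _ [i _ <-]; exact: (basis_letter bL).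
have sA := gen_subgroup (y @` A).
have gA : gen (y @` A) `<=` gen (range y').
  by apply: gen_sub => _ [i Ai <-]; exists i => //; exact: yA.
split=> [|K a].
  apply/seteqP; split.
    rewrite eL; apply: (gen_min (gen_subgroup _)) => _ [i _ <-].
    have [Ai|Ai] := pselect (A i).
      by rewrite -yA //; apply: in_gen; exists i.
    have [p [q [Ap Aq e]]] := yB i Ai.
    have -> : y i = p^-1 * y' i * q^-1 by rewrite e !mulgA mulVg mul1g mulgK.
    have sg := gen_subgroup (range y').
    apply: (sgM sg); last by apply: (sgV sg); exact: gA.
    by apply: (sgM sg); [apply: (sgV sg); exact: gA|apply: in_gen; exists i].
  apply: (gen_min sL) => _ [i _ <-].
  have [Ai|Ai] := pselect (A i); first by rewrite yA //; exact: (basis_letter bL).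
  have [p [q [/AL Lp /AL Lq ->]]] := yB i Ai.
  by do 2!apply: (sgM sL) => //; exact: (basis_letter bL).
have [f fM ef] := univ K a.
have /choice[b bP] : forall i, exists k, (A i -> k = a i) /\
    (~ A i -> forall g : G -> K, hom_on L g ->
       (forall j, A j -> g (y j) = a j) -> g (y i) = k -> g (y' i) = a i).
  move=> i; have [Ai|Ai] := pselect (A i); first by exists (a i).
  have [p [q [Ap Aq e]]] := yB i Ai.
  exists ((f p)^-1 * a i * (f q)^-1); split=> // _ g gM eg ei.
  have fg x : gen (y @` A) x -> g x = f x.
    apply: hom_gen; [by move=> ? ? /AL ? /AL ?; exact: gM|
      by move=> ? ? /AL ? /AL ?; exact: fM|].
    by move=> _ [j Aj <-]; rewrite eg // ef.
  rewrite e !gM //; try exact: AL; first by rewrite ei !fg // !mulgA mulgV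
    mul1g mulgVK.
    exact: (basis_letter bL).
  by apply: (sgM sL); [exact: AL|exact: (basis_letter bL)].
have [g gM eg] := univ K b; exists g => // i.
have eA j : A j -> g (y j) = a j by move=> Aj; rewrite eg; apply: (bP j).1.
have [Ai|Ai] := pselect (A i); first by rewrite yA // eA.
by apply: (bP i).2 => //; exact: eA.
Qed.

End Basis.

(** * Reduced words *)

Section Lcp.
Variable T : eqType.
Implicit Types u v w : seq T.

Fixpoint lcp u v := match u, v with
  | a :: u', b :: v' => if a == b then (lcp u' v').+1 else 0
  | _, _ => 0
  end.

Lemma lcpC u v : lcp u v = lcp v u.
Proof. by elim: u v => [|a u IH] [|b v] //=; rewrite eq_sym IH. Qed.

Lemma lcp_size u v : lcp u v <= size u.
Proof. by elim: u v => [|a u IH] [|b v] //=; case: ifP => // _; exact: IH. Qed.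

Lemma take_lcp u v k : k <= lcp u v -> take k u = take k v.
Proof.
elim: u v k => [|a u IH] [|b v] [|k] //=.
by case: eqP => // -> /IH ->.
Qed.

Lemma lcp_ultra u v w : minn (lcp u v) (lcp v w) <= lcp u w.
Proof.
elim: u v w => [|a u IH] [|b v] [|c w] //=; rewrite ?minn0 ?min0n //.
case: eqP => [->|_]; last by rewrite min0n.
by case: eqP => _; rewrite ?minn0 // minnSS ltnS; exact: IH.
Qed.

Lemma lcp_ultra_lt u v w : lcp u v < lcp v w -> lcp u w = lcp u v.
Proof.
move=> lt; apply/eqP; rewrite eqn_leq; apply/andP; split; last first.
  by have := lcp_ultra u v w; rewrite (minn_idPl _) // ltnW.
rewrite leqNgt; apply/negP => lt2.
have := lcp_ultra u w v; rewrite (lcpC w v) leqNgt => /negP; apply.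
by rewrite leq_min lt2.
Qed.

End Lcp.

Section ReducedWords.
Variable I : eqType.
Implicit Types (a b : I * bool) (u v : seq (I * bool)).

Definition nc a b := b != inv_letter a.

Definition reduced u := sorted nc u.

Definition push a u :=
  if u is b :: u' then if b == inv_letter a then u' else a :: u else [:: a].

Lemma reduced_push a u : reduced u -> reduced (push a u).
Proof.
case: u => // b u /= ru; case: eqP => [_|/eqP ne]; first exact: path_sorted ru.
by rewrite /= /nc ne.
Qed.

Lemma pushK a u : reduced u -> push (inv_letter a) (push a u) = u.
Proof.
case: u => [|b u] /=; first by rewrite inv_letterK eqxx.
case: eqP => [->|_ _]; last by rewrite /= inv_letterK eqxx.
by case: u => [|c u] //= /andP[/negbTE->].
Qed.

Lemma reduced_inv u : reduced u -> reduced (inv_word u).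
Proof.
rewrite /reduced /inv_word rev_sorted sorted_map.
apply: sub_sorted => a b; rewrite /nc /= inv_letterK; apply: contra => /eqP ->.
by rewrite eqxx.
Qed.

(** Once the common prefix is removed, the first letters differ, so that nothing
    cancels any more. *)
Lemma reduced_cancel u v : reduced u -> reduced v ->
  reduced (inv_word (drop (lcp u v) u) ++ drop (lcp u v) v).
Proof.
elim: u v => [|a u IH] [|b v] ru rv //=.
- by rewrite cats0; exact: reduced_inv.
- case: eqP => [_|/eqP ne] /=.
    by apply: IH; [exact: path_sorted ru|exact: path_sorted rv].
  rewrite /inv_word /= rev_cons -cats1 -catA /= /reduced.
  have := reduced_inv ru; rewrite /reduced /inv_word /= rev_cons -cats1.
  case: (rev _) => [|c w] /=; first by rewrite /nc inv_letterK eq_sym ne.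
  rewrite !cat_path /= => /and3P[-> -> _]; rewrite /= /nc inv_letterK eq_sym ne.
  exact: rv.
Qed.

Definition rword := {u : seq (I * bool) | reduced u}.

Lemma rpush_proof a (w : rword) : reduced (push a (val w)).
Proof. exact: reduced_push (valP w). Qed.

Definition rpush a (w : rword) : rword := Sub (push a (val w)) (rpush_proof a w).

Lemma rpushK a : cancel (rpush a) (rpush (inv_letter a)).
Proof. by move=> w; apply: val_inj; exact: pushK (valP w). Qed.

Lemma rpushVK a : cancel (rpush (inv_letter a)) (rpush a).
Proof. by move=> w; have := rpushK (inv_letter a) w; rewrite inv_letterK. Qed.

Definition rpush_bij a : self_bij rword := SelfBij (rpushK a) (rpushVK a).

Lemma push_reduced a u : reduced (a :: u) -> push a u = a :: u.
Proof. by case: u => [|b u] //= /andP[/negbTE ->]. Qed.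

Lemma foldr_push u : reduced u -> foldr push [::] u = u.
Proof.
elim: u => [|a u IH] //= ru; rewrite IH; first exact: push_reduced.
exact: path_sorted ru.
Qed.

End ReducedWords.

(** * Normal forms with respect to a basis *)

Section NormalForm.
Variables (G : groupType) (I : eqType).
Implicit Types (L : set G) (x : I -> G) (nf : G -> seq (I * bool)).

Definition normal_form L x nf :=
  [/\ forall g, L g -> reduced (nf g), forall g, L g -> eval x (nf g) = g &
      forall u, reduced u -> nf (eval x u) = u].

Lemma eval_push x a u : eval x (push a u) = sgn x a * eval x u.
Proof.
case: u => [|b u] //=; case: eqP => [->|_] //.
by rewrite sgnV mulVKg.
Qed.

(** Let the letters act on reduced words by prepending, with cancellation; the
    normal form of [g] is the image of the empty word under [g]. *)
Lemma basis_normal_form L x : basis L x -> exists nf, normal_form L x nf.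
Proof.
move=> bL; case: (bL) => eL univ.
have sL := basis_subgroup bL.
have [f fM ef] := univ _ (fun i => rpush_bij (i, true)).
pose nf g := val (f g (Sub [::] isT)).
have nfE u : nf (eval x u) = foldr (@push I) [::] u.
  rewrite /nf; elim: u => [|a u IH] /=; first by rewrite (hom1_on sL fM).
  have Lu := mem_eval u sL (basis_letter bL).
  rewrite fM //; last exact: mem_sgn (basis_letter bL).
  rewrite bijM -IH /sgn; case: a => i [] /=; first by rewrite ef.
  by rewrite (homV_on sL fM) ?ef //; exact: (basis_letter bL).
exists nf; split.
- by move=> g _; exact: valP.
- move=> _ /(basis_word bL)[u ->]; rewrite nfE.
  by elim: u => //= a u IH; rewrite eval_push IH.
- by move=> u ru; rewrite nfE foldr_push.
Qed.

Section Theory.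
Variables (L : set G) (x : I -> G) (nf : G -> seq (I * bool)).
Hypotheses (bL : basis L x) (nfP : normal_form L x nf).

Let sL : subgroup L := basis_subgroup bL.

Lemma nf_reduced g : L g -> reduced (nf g). Proof. by case: nfP => + _ _; apply. Qed.
Lemma nfK g : L g -> eval x (nf g) = g. Proof. by case: nfP => _ + _; apply. Qed.
Lemma nf_eval u : reduced u -> nf (eval x u) = u.
Proof. by case: nfP => _ _; apply. Qed.

Lemma nf1 : nf 1 = [::]. Proof. exact: (@nf_eval [::]). Qed.

Lemma nf_letter i b : nf (sgn x (i, b)) = [:: (i, b)].
Proof. by rewrite -(@nf_eval [:: (i, b)]) //= mulg1. Qed.

Lemma nf_inv g : L g -> nf g^-1 = inv_word (nf g).
Proof.
move=> Lg; rewrite -{1}(nfK Lg) -eval_inv nf_eval //.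
by apply: reduced_inv; exact: nf_reduced.
Qed.

Definition len g := size (nf g).

(** The Gromov product, based at the identity, of the Cayley tree of [L]. *)
Definition gp g h := lcp (nf g) (nf h).

Lemma nf_mulV g h : L g -> L h ->
  nf (g^-1 * h) = inv_word (drop (gp g h) (nf g)) ++ drop (gp g h) (nf h).
Proof.
move=> Lg Lh; rewrite /gp; set k := lcp _ _.
rewrite -[RHS]nf_eval; last by apply: reduced_cancel; exact: nf_reduced.
congr nf; rewrite eval_cat eval_inv.
have e w : eval x (drop k w) = (eval x (take k w))^-1 * eval x w.
  by rewrite -{3}(cat_take_drop k w) eval_cat mulKg.
rewrite !e !nfK // (take_lcp (leqnn _)) -/k invgM invgK -!mulgA.
by rewrite mulVKg.
Qed.

Lemma len_mulV g h : L g -> L h -> len (g^-1 * h) + (gp g h).*2 = len g + len h.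
Proof.
move=> Lg Lh; rewrite /len nf_mulV // size_cat size_rev size_map !size_drop.
rewrite -addnn addnACA subnK ?subnK //.
  by rewrite /gp lcpC lcp_size.
exact: lcp_size.
Qed.

Lemma lenV g : L g -> len g^-1 = len g.
Proof. by move=> Lg; rewrite /len nf_inv // size_rev size_map. Qed.

Lemma len_eq0 g : L g -> (len g == 0) = (g == 1).
Proof.
move=> Lg; apply/idP/eqP => [|->]; last by rewrite /len nf1.
by move=> /nilP e; rewrite -(nfK Lg) e.
Qed.

Lemma len_letter i b : len (sgn x (i, b)) = 1%N.
Proof. by rewrite /len nf_letter. Qed.

Lemma gpC g h : gp g h = gp h g. Proof. exact: lcpC. Qed.

Lemma gp_ultra_lt f g h : gp f g < gp g h -> gp f h = gp f g.
Proof. exact: lcp_ultra_lt. Qed.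

Lemma inv_word_halves (u : seq (I * bool)) h : size u = h.*2 ->
  take h (inv_word u) = inv_word (drop h u).
Proof.
move=> su; rewrite -{1}(cat_take_drop h u) /inv_word map_cat rev_cat.
rewrite take_size_cat // size_rev size_map size_drop su -addnn addnK //.
Qed.

Lemma halves_eq g h : L g -> len g = h.*2 ->
  take h (nf g) = take h (nf g^-1) -> g = 1.
Proof.
move=> Lg lg; rewrite nf_inv // inv_word_halves // => e.
by rewrite -(nfK Lg) -(cat_take_drop h (nf g)) eval_cat e eval_inv mulVg.
Qed.

(** Otherwise the word of [g] agrees with that of its inverse up to the middle: if
    its length is even then [g = 1], and if it is odd then the middle letter is its
    own inverse. *)
Lemma gp_square g : L g -> g <> 1 -> (gp g^-1 g).*2 < len g.
Proof.
move=> Lg g1; rewrite ltnNge; apply/negP => le.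
have := odd_double_half (len g); case: (boolP (odd (len g))) => [od|ev] e.
  have lt : (len g)./2 < gp g^-1 g.
    by rewrite -ltn_double (leq_trans _ le) // -{2}e.
  set h := (len g)./2 in e lt.
  have hs : h < len g by rewrite -e add1n ltnS -addnn leq_addr.
  have [a0 _] : exists a0 : I * bool, true.
    by move: hs; rewrite /len; case: (nf g) => // a0; exists a0.
  have := congr1 (fun w => nth a0 w h) (take_lcp lt).
  rewrite !nth_take // nf_inv // nth_rev ?size_map //.
  have -> : size (nf g) - h.+1 = h.
    by rewrite -[size _]/(len g) -e add1n subSS -addnn addnK.
  rewrite (nth_map a0) // /inv_letter; case: (nth _ _ _) => i b [] /eqP.
  by case: b.
apply: g1; apply: (@halves_eq _ (len g)./2) => //.
apply/esym; apply: take_lcp; rewrite -leq_double (leq_trans _ le) //.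
by rewrite -{2}e.
Qed.

End Theory.

End NormalForm.

(** * Elementary Nielsen moves *)

Section Moves.
Variables (G : groupType) (I : eqType).
Implicit Types (y z w : I -> G) (i j k : I) (b c : bool).

Definition upd y i g := fun k => if k == i then g else y k.

Lemma upd_same y i g : upd y i g i = g. Proof. by rewrite /upd eqxx. Qed.

Lemma upd_other y i g k : k != i -> upd y i g k = y k.
Proof. by rewrite /upd => /negbTE ->. Qed.

Lemma upd_upd y i g h : upd (upd y i g) i h = upd y i h.
Proof. by apply/funext => k; rewrite /upd; case: eqP. Qed.

(** The boolean is the parity of the number of inversions, which is what the
    determinant of the composite of the moves detects. *)
Inductive nie : bool -> (I -> G) -> (I -> G) -> Prop :=
| nie_refl y : nie false y y
| nie_mul b y z i j : nie b y z -> i != j -> nie b y (upd z i (z i * z j))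
| nie_flip b y z i : nie b y z -> nie (~~ b) y (upd z i (z i)^-1).

Lemma nie_div b y z i j : nie b y z -> i != j -> nie b y (upd z i (z i / z j)).
Proof.
move=> n ij; have := nie_flip j (nie_mul (nie_flip j n) ij).
rewrite negbK; congr nie; apply/funext => k; rewrite /upd !eqxx (negbTE ij).
rewrite (eq_sym j i) (negbTE ij) invgK.
by have [->|_] := eqVneq k j; rewrite 1?eq_sym ?(negbTE ij).
Qed.

Lemma nie_sgn b y z (a d : I * bool) : nie b y z -> a.1 != d.1 ->
  exists c, nie c y (upd z a.1 (sgn z a * sgn z d)).
Proof.
case: a d => i e [j f] /= n ij.
have step c w : nie c y w -> nie c y (upd w i (w i * sgn w (j, f))).
  by move=> nw; case: f; [exact: nie_mul|exact: nie_div].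
case: e; first by exists b; exact: step.
exists (~~ b); have := step _ _ (nie_flip i n).
congr nie; rewrite upd_upd upd_same; congr (upd z i (_ * _)).
by rewrite /sgn /= upd_other // eq_sym.
Qed.

Lemma nie_swap b y z i j : nie b y z ->
  exists c, nie c y (fun k => z (if k == i then j else if k == j then i else k)).
Proof.
move=> n; have [->|ij] := eqVneq i j.
  by exists b; congr (nie b y): n; apply/funext => k; case: eqP => [->|].
have ji : j != i by rewrite eq_sym.
have n1 := nie_mul (nie_flip i n) ji.
have n2 := nie_flip i (nie_mul (nie_flip j n1) ij).
exists (~~ ~~ ~~ b); congr (nie _ y): (nie_mul n2 ji).
apply/funext => k; rewrite /upd !eqxx (negbTE ji) (negbTE ij).
have [->|ki] := eqVneq k i.
  by rewrite (negbTE ij) !gnorm.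
by have [_|//] := eqVneq k j; rewrite !gnorm.
Qed.

End Moves.

Lemma nie_perm (G : groupType) (I : finType) b (y z : I -> G) (s : {perm I}) :
  nie b y z -> exists c, nie c y (z \o s).
Proof.
move=> n; have [ts -> _] := prod_tpermP s.
elim: ts => [|t ts [c IH]].
  rewrite big_nil; exists b; congr (nie b y): n.
  by apply/funext => k /=; rewrite perm1.
have [d nd] := nie_swap t.1 t.2 IH; exists d; congr (nie d y): nd.
apply/funext => k /=; rewrite big_cons permM; congr (z (_ _)).
by rewrite permE /=; do 2!case: eqP => // _.
Qed.

Lemma nie_flips (G : groupType) (I : finType) b (y z : I -> G) (e : I -> bool) :
  nie b y z -> exists c, nie c y (fun i => sgn z (i, e i)).
Proof.
move=> n; pose w (s : seq I) i := if i \in s then sgn z (i, e i) else z i.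
suff /(_ (enum I) (enum_uniq _))[c nc] : forall s, uniq s ->
    exists c, nie c y (w s).
  by exists c; congr (nie c y): nc; apply/funext => i; rewrite /w mem_enum.
elim=> [|i s IH] /=; first by exists b; congr (nie b y): n; apply/funext.
move=> /andP[iNs /IH[c nc]]; case ei : (e i).
  exists c; congr (nie c y): nc; apply/funext => k; rewrite /w inE.
  by have [->|//] := eqVneq k i; rewrite (negbTE iNs) /sgn /= ei.
exists (~~ c); congr (nie (~~ c) y): (nie_flip i nc); apply/funext => k.
rewrite /upd /w inE; have [->|//] := eqVneq k i.
by rewrite (negbTE iNs) /sgn /= ei.
Qed.

Section BasisMoves.
Variables (G : groupType) (I : eqType).
Implicit Types (L : set G) (y z : I -> G).

Lemma basis_upd L y i p q : basis L y ->
  gen (y @` [set k | k != i]) p -> gen (y @` [set k | k != i]) q ->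
  basis L (upd y i (p * y i * q)).
Proof.
move=> bL gp gq; apply: (basis_unip (A := [set k | k != i]) bL) => k /=.
  exact: upd_other.
by move=> /negP; rewrite negbK => /eqP ->; exists p, q; rewrite upd_same.
Qed.

Lemma basis_updr L y i q : basis L y ->
  gen (y @` [set k | k != i]) q -> basis L (upd y i (y i * q)).
Proof.
move=> bL gq; rewrite -[y i]mul1g; apply: basis_upd => //.
exact: (sg1 (gen_subgroup _)).
Qed.

Lemma basis_updl L y i p : basis L y ->
  gen (y @` [set k | k != i]) p -> basis L (upd y i (p * y i)).
Proof.
move=> bL gq; rewrite -[p * _]mulg1; apply: basis_upd => //.
exact: (sg1 (gen_subgroup _)).
Qed.

Lemma basis_flip L y i : basis L y -> basis L (upd y i (y i)^-1).
Proof.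
move=> bL; have sL := basis_subgroup bL; case: (bL) => eL univ.
split=> [|K a].
  apply/seteqP; split; last first.
    apply: (gen_min sL) => _ [k _ <-]; rewrite /upd; case: eqP => _.
      by apply: (sgV sL); exact: (basis_letter bL).
    exact: (basis_letter bL).
  rewrite {1}eL; have sg := gen_subgroup (range (upd y i (y i)^-1)).
  apply: (gen_min sg) => _ [k _ <-].
  have [->|ki] := eqVneq k i; last first.
    by apply: in_gen; exists k => //; rewrite upd_other.
  by apply: (sgVE sg); apply: in_gen; exists i => //; rewrite upd_same.
have [f fM ef] := univ K (upd a i (a i)^-1); exists f => // k.
have [->|ki] := eqVneq k i; last by rewrite upd_other // ef upd_other.
rewrite upd_same (homV_on sL fM) ?ef ?upd_same ?invgK //.
exact: (basis_letter bL).
Qed.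

Lemma nie_basis L b y z : basis L y -> nie b y z -> basis L z.
Proof.
move=> + n; elim: n => {b y z} // b y z i j.
  move=> _ IH ij /IH bz; apply: basis_updr => //.
  by apply: in_gen; exists j => //=; rewrite eq_sym.
by move=> IH /IH; exact: basis_flip.
Qed.

End BasisMoves.

(** * Nielsen's theorem *)

(** A Nielsen reduced tuple behaves like a basis: no product of its members is
    shorter than its number of factors. *)
Section NielsenReduced.
Variables (G : groupType) (I J : eqType) (L : set G) (x : I -> G).
Variable nf : G -> seq (I * bool).
Hypotheses (bL : basis L x) (nfP : normal_form L x nf).

Let sL : subgroup L := basis_subgroup bL.
Local Notation len := (len nf).
Local Notation gp := (gp nf).

Variable z : J -> G.
Hypothesis Lz : forall j, L (z j).
Implicit Types a b c : J * bool.

(** The number of letters cancelled in the product of two signed members. *)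
Definition canc a b := gp (sgn z a)^-1 (sgn z b).

Hypothesis N0 : forall a, 0 < len (sgn z a).
Hypothesis N1 : forall a b, nc a b ->
  (canc a b).*2 <= len (sgn z a) /\ (canc a b).*2 <= len (sgn z b).
Hypothesis N2 : forall a b c, nc a b -> nc b c ->
  canc a b + canc b c < len (sgn z b).

Let Lsgn a : L (sgn z a). Proof. exact: mem_sgn. Qed.
Let Leval w : L (eval z w). Proof. exact: mem_eval. Qed.

Lemma reduced_len w : reduced w -> size w <= len (eval z w).
Proof.
case: w => // a w rw.
(* the initial part of the first factor that survives is controlled as well *)
suff [] : [/\ size (a :: w) <= len (eval z (a :: w)) &
   forall d, nc d a -> gp (sgn z d)^-1 (eval z (a :: w)) = canc d a /\
      size (a :: w) + canc d a <= len (eval z (a :: w))] by [].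
elim: w a rw => [|b w IH] a rw.
  rewrite /= mulg1; split=> // d da; split=> //; rewrite add1n.
  by have [_ le] := N1 da; have := N0 a; lia.
have ab : nc a b by case/andP: rw.
have [_ /(_ a ab)[]] := IH b (path_sorted rw).
set h := eval z (b :: w) => gh lh.
have Lh : L h := Leval _.
have -> : eval z [:: a, b & w] = sgn z a * h by [].
set g := sgn z a * h; have Lg : L g by apply: (sgM sL).
have La := Lsgn a; have LVa := sgV sL La.
have lg : len g + (canc a b).*2 = len (sgn z a) + len h.
  by rewrite -(lenV nfP La) -(len_mulV nfP LVa Lh) invgK gh.
have ga : gp (sgn z a) g + canc a b = len (sgn z a).
  by have := len_mulV nfP La Lg; rewrite /g mulKg -/g; lia.
split=> [|d da].
  have [le1 _] := N1 ab; have := N0 a; rewrite /= in lh *; lia.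
have n2 := N2 da ab; split; last by rewrite /= in lh *; lia.
rewrite /canc; apply: (gp_ultra_lt (g := sgn z a)).
by rewrite -/(canc d a); lia.
Qed.

End NielsenReduced.

Lemma exists_min (T : Type) (P : T -> Prop) (f : T -> nat) x : P x ->
  exists2 z, P z & forall w, P w -> f z <= f w.
Proof.
move=> Px; pose Q n := `[< exists2 z, P z & f z = n >].
have exQ : exists n, Q n by exists (f x); apply/asboolP; exists x.
case: (ex_minnP exQ) => n /asboolP[z Pz <-] le; exists z => // w Pw.
by apply: le; apply/asboolP; exists w.
Qed.

Lemma exists_lex_min (T : Type) (P : T -> Prop) (f g : T -> nat) x : P x ->
  exists z, [/\ P z, forall w, P w -> f z <= f w &
                forall w, P w -> f w = f z -> g z <= g w].
Proof.
move=> Px; have [y Py yf] := exists_min f Px.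
have [z [Pz zf] zg] := exists_min (P := fun z => P z /\ f z = f y) g (conj Py erefl).
exists z; split=> // w Pw; first by rewrite zf; exact: yf.
by rewrite zf => wf; apply: zg.
Qed.

(** Words of a given length are ordered by reading them as numerals. *)
Section Code.
Variable T : finType.
Implicit Types u v : seq T.

Definition code u := foldl (fun n (a : T) => n * #|T| + enum_rank a)%N 0 u.

Lemma code_rcons u a : code (rcons u a) = (code u * #|T| + enum_rank a)%N.
Proof. by rewrite /code foldl_rcons. Qed.

Lemma code_cat u v : code (u ++ v) = (code u * #|T| ^ size v + code v)%N.
Proof.
elim/last_ind: v => [|v a IH]; first by rewrite cats0 expn0 muln1 addn0.
by rewrite -rcons_cat !code_rcons IH size_rcons expnSr mulnDl mulnA addnA.
Qed.

Lemma code_inj u v : size u = size v -> code u = code v -> u = v.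
Proof.
elim/last_ind: u v => [|u a IH] v; first by case: v.
case/lastP: v => [|v b]; rewrite !size_rcons // => -[su]; rewrite !code_rcons.
have B0 : 0 < #|T| by rewrite (cardD1 a) inE.
move=> e; have ea : enum_rank a = enum_rank b :> nat.
  have := congr1 (modn^~ #|T|) e.
  by rewrite !modnMDl !modn_small // ltn_ord.
congr rcons; last exact/enum_rank_inj/val_inj.
apply: IH => //; apply/eqP; rewrite -(eqn_pmul2r B0); apply/eqP; lia.
Qed.

End Code.

Section Nielsen.
Variables (G : groupType) (I : finType) (L : set G) (x y : I -> G).
Variable nf : G -> seq (I * bool).
Hypotheses (bx : basis L x) (nfP : normal_form L x nf) (by_ : basis L y).

Let sL : subgroup L := basis_subgroup bx.
Local Notation len := (len nf).
Local Notation gp := (gp nf).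

(** Total length is first minimised; ties are resolved by comparing the initial
    halves of the members and of their inverses. *)
Definition halves_code g :=
  (code (take (uphalf (len g)) (nf g)) +
   code (take (uphalf (len g)) (inv_word (nf g))))%N.

Let reach z := exists b, nie b y z.
Let total (z : I -> G) := (\sum_i len (z i))%N.
Let cost (z : I -> G) := (\sum_i halves_code (z i))%N.

Lemma halves_codeV g : L g -> halves_code g^-1 = halves_code g.
Proof.
move=> Lg; rewrite /halves_code (lenV nfP Lg) (nf_inv nfP Lg) inv_wordK.
exact: addnC.
Qed.

Let Lreach z i : reach z -> L (z i).
Proof. by move=> [b n]; exact: (basis_letter (nie_basis by_ n)). Qed.

Section Minimal.
Implicit Types a b c d : I * bool.
Variable z : I -> G.
Hypotheses (rz : reach z) (z_total : forall w, reach w -> total z <= total w)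
  (z_cost : forall w, reach w -> total w = total z -> cost z <= cost w).

Local Notation canc := (canc nf z).

Let Lz a : L (sgn z a). Proof. by apply: mem_sgn => // i; exact: Lreach. Qed.

Let len_sgn a : len (sgn z a) = len (z a.1).
Proof.
case: a => i [] //=; rewrite /sgn /= (lenV nfP) //; exact: (Lz (i, true)).
Qed.

Let code_sgn a : halves_code (sgn z a) = halves_code (z a.1).
Proof.
case: a => i [] //=; rewrite /sgn /= halves_codeV //; exact: (Lz (i, true)).
Qed.

Let Lreplace a b : L (sgn z a * sgn z b). Proof. exact: (sgM sL). Qed.

Let sum_upd (f : G -> nat) i g :
  (\sum_k f (upd z i g k) + f (z i) = \sum_k f (z k) + f g)%N.
Proof.
rewrite (bigD1 i) //= upd_same [in RHS](bigD1 i) //=.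
rewrite (eq_bigr (fun k => f (z k))) => [|k ki]; last by rewrite upd_other.
lia.
Qed.

Let len_replace a b : a.1 != b.1 -> len (z a.1) <= len (sgn z a * sgn z b).
Proof.
move=> ab; case: rz => c n; set g := _ * _.
have rg : reach (upd z a.1 g) := nie_sgn n ab.
by have := z_total rg; have := sum_upd len a.1 g; rewrite /total; lia.
Qed.

Let code_replace a b : a.1 != b.1 -> len (sgn z a * sgn z b) = len (z a.1) ->
  halves_code (z a.1) <= halves_code (sgn z a * sgn z b).
Proof.
set g := _ * _ => ab e; case: rz => c n.
have rg : reach (upd z a.1 g) := nie_sgn n ab.
have e' : total (upd z a.1 g) = total z.
  by have := sum_upd len a.1 g; rewrite /total; lia.
have := z_cost rg e'.
by have := sum_upd halves_code a.1 g; rewrite /cost; lia.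
Qed.

Let mul_inv a b : sgn z a * sgn z b =
  (sgn z (inv_letter b) * sgn z (inv_letter a))^-1.
Proof. by rewrite !sgnV -invgM invgK. Qed.

Let len_mul_sgn a b :
  (len (sgn z a * sgn z b) + (canc a b).*2 = len (sgn z a) + len (sgn z b))%N.
Proof.
have := len_mulV nfP (sgV sL (Lz a)) (Lz b).
by rewrite invgK (lenV nfP (Lz a)).
Qed.

Let z_neq1 a : sgn z a <> 1.
Proof.
case: a => i e ze; have {ze} zi : z i = 1.
  by case: e ze; rewrite /sgn //= => /(congr1 (fun g => g^-1)); rewrite invgK invg1.
case: rz => b n; have bz := nie_basis by_ n.
have [nf' nf'P] := basis_normal_form bz.
by have := nf_letter nf'P i true; rewrite /sgn /= zi (nf1 nf'P).
Qed.

Let N0 a : 0 < len (sgn z a).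
Proof. by rewrite lt0n (len_eq0 nfP) //; apply/eqP. Qed.

Let square a : (canc a a).*2 < len (sgn z a).
Proof. exact: (gp_square nfP). Qed.

Let nc_case a b : nc a b -> a = b \/ a.1 != b.1.
Proof.
case: a b => i e [j f]; rewrite /nc /inv_letter /= xpair_eqE eq_sym.
have [->|ij] := eqVneq i j; last by right.
by rewrite /= => H; left; case: e f H => [] [].
Qed.

Let N1 a b : nc a b ->
  (canc a b).*2 <= len (sgn z a) /\ (canc a b).*2 <= len (sgn z b).
Proof.
case/nc_case => [<-|ab]; first by have := square a; lia.
have := len_mul_sgn a b; have l1 := len_replace ab.
have ba : (inv_letter b).1 != (inv_letter a).1 by rewrite eq_sym.
have := len_replace ba; rewrite -(lenV nfP (Lreplace _ _)) -mul_inv /=.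
rewrite !len_sgn in l1 *; lia.
Qed.

(** When half of [b] cancels against [d], replacing [d] by the product does not
    change its length but substitutes one half of [b] for the other. *)
Let half_code b d : nc b d -> b.1 != d.1 -> (canc b d).*2 = len (sgn z b) ->
  code (take (canc b d) (nf (sgn z b)^-1)) <= code (take (canc b d) (nf (sgn z b))).
Proof.
move=> ncbd bd; set h := canc b d => hb.
set B := sgn z b; set D := sgn z d.
have {}hb : h.*2 = len B := hb.
have lB : L B := Lz b; have lD : L D := Lz d.
have lBD : len (B * D) = len D.
  have e : (len (B * D) + h.*2 = len B + len D)%N := len_mul_sgn b d.
  by lia.
have hD : h.*2 <= len D by have [] := N1 ncbd.
have : halves_code D <= halves_code (B * D).
  have db : (inv_letter d).1 != (inv_letter b).1 by rewrite eq_sym.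
  have := code_replace db; rewrite -(lenV nfP (Lreplace _ _)) -mul_inv /=.
  rewrite -(halves_codeV (Lreplace _ _)) -mul_inv -len_sgn -code_sgn.
  exact.
have sB : size (nf B) = h.*2 := esym hb.
have eBD : nf (B * D) = take h (nf B) ++ drop h (nf D).
  have := nf_mulV nfP (sgV sL lB) lD; rewrite invgK -/(canc b d) -/h => ->.
  congr (_ ++ _); rewrite (nf_inv nfP lB) -[in RHS](inv_wordK (nf B)).
  rewrite inv_word_halves ?inv_wordK //.
  by rewrite size_rev size_map.
have eD : nf D = take h (nf B^-1) ++ drop h (nf D).
  by rewrite -{1}(cat_take_drop h (nf D)); congr cat; rewrite -(take_lcp (leqnn _)).
set P := take h (nf B) in eBD *; set Q := take h (nf B^-1) in eD *.
set T := drop h (nf D) in eBD eD.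
have sP : size P = h by rewrite size_takel // sB; lia.
have sQ : size Q = h.
  by rewrite size_takel // -/(len B^-1) (lenV nfP lB) -hb; lia.
have sT : len D = (h + size T)%N by rewrite /len eD size_cat sQ.
rewrite /halves_code lBD; set r := uphalf (len D).
have r1 : h <= r by rewrite /r; lia.
have r2 : r <= size T by rewrite /r; lia.
have cut W : size W = h ->
    (code (take r (W ++ T)) + code (take r (inv_word (W ++ T))))%N =
    (code W * #|{: I * bool}| ^ size (take (r - h) T) + code (take (r - h) T)
      + code (take r (inv_word T)))%N.
  move=> sW; rewrite take_cat sW ltnNge r1 /= code_cat /inv_word map_cat rev_cat.
  rewrite [take r (_ ++ _)]takel_cat //.
  by rewrite size_rev size_map.
rewrite eBD {1 2}eD !cut // !leq_add2r.
rewrite leq_pmul2r // expn_gt0 (cardD1 b) inE //.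
Qed.

Let N2 a b c : nc a b -> nc b c -> canc a b + canc b c < len (sgn z b).
Proof.
move=> ab bc; rewrite ltnNge; apply/negP => le.
have [_ lab] := N1 ab; have [lbc _] := N1 bc.
have eab : (canc a b).*2 = len (sgn z b) by lia.
have ebc : (canc b c).*2 = len (sgn z b) by lia.
case/nc_case: (bc) => [ebc'|dbc].
  by have := square b; rewrite {2}ebc' ebc ltnn.
case/nc_case: (ab) => [eab'|dab].
  by have := square b; rewrite -{1}eab' eab ltnn.
have le1 := half_code bc dbc ebc.
set b' := inv_letter b; set a' := inv_letter a.
have cba : canc b' a' = canc a b by rewrite /canc !sgnV invgK; exact: gpC.
have ncba : nc b' a'.
  by move: ab; rewrite /nc /b' inv_letterK eq_sym.
have dba : b'.1 != a'.1 by rewrite eq_sym.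
have lb' : len (sgn z b') = len (sgn z b) by rewrite !len_sgn.
have := half_code ncba dba; rewrite cba lb' => /(_ eab).
have hh : canc a b = canc b c by lia.
rewrite hh sgnV invgK => le2.
have sz : len (sgn z b)^-1 = len (sgn z b) by rewrite (lenV nfP).
have := code_inj _ (anti_leq (introT andP (conj le1 le2))).
rewrite !size_take -!/(len _) sz => /(_ erefl) e.
apply: (@z_neq1 b); apply: (halves_eq nfP (Lz b) (esym ebc)); exact/esym.
Qed.

(** A tuple of minimal cost is Nielsen reduced, so that a product of length one has
    a single factor. *)
Lemma minimal_letters i : exists a, x i = sgn z a.
Proof.
case: rz => b n; have bz := nie_basis by_ n.
have [nf' nf'P] := basis_normal_form bz.
have Lx := basis_letter bx i.
have ex : eval z (nf' (x i)) = x i := nfK nf'P Lx.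
have rx := nf_reduced nf'P Lx.
have := reduced_len bx nfP (fun j => Lreach j rz) N0 N1 N2 rx; rewrite ex.
rewrite -[x i]/(sgn x (i, true)) (len_letter nfP) /sgn /=.
case: (nf' (x i)) ex => [|a [|c u]] //=; last by rewrite mulg1 => <- _; exists a.
move=> e _; have := nf_letter nfP i true.
by rewrite /sgn /= -e (nf1 nfP).
Qed.

Lemma minimal_reach : reach x.
Proof.
have /choice[s sP] := minimal_letters.
have inj : injective (fun i => (s i).1).
  move=> i j /= eij; have : x i = x j \/ x i = (x j)^-1.
    rewrite !sP /sgn eij.
    by case: (s i).2 (s j).2 => [] []; rewrite ?invgK; [left|right|right|left].
  have nfi k e := nf_letter nfP k e.
  have := nfi i true; rewrite {1}/sgn /=.
  have := nfi j true; rewrite {1}/sgn /=; have := nfi j false; rewrite {1}/sgn /=.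
  by move=> e1 e2 e3 [] e; move: e3; rewrite e ?e1 ?e2 => -[].
case: rz => b n; have [c nc] := nie_perm (perm inj) n.
have [d nd] := nie_flips (fun i => (s i).2) nc; exists d.
congr (nie d y): nd; apply/funext => i; rewrite sP /sgn /= permE.
by [].
Qed.

End Minimal.
End Nielsen.

(** Among the tuples reached from [y], one of minimal cost consists of the letters
    of [x], up to order and inversions. *)
Theorem nielsen (G : groupType) (I : finType) (L : set G) (x y : I -> G) :
  basis L x -> basis L y -> exists b, nie b y x.
Proof.
move=> bx by_; have [nf nfP] := basis_normal_form bx.
pose f (z : I -> G) := (\sum_i len nf (z i))%N.
pose g (z : I -> G) := (\sum_i halves_code nf (z i))%N.
have r0 : exists b, nie b y y by exists false; exact: nie_refl.
have [z [rz zf zg]] := exists_lex_min (P := fun z => exists b, nie b y z) f g r0.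
exact: (minimal_reach bx nfP by_ rz zf zg).
Qed.

(** * Schreier bases of kernels onto cyclic groups *)

Section Levels.
Variable G : groupType.
Implicit Types (x s h : G) (H : set G).

(** The powers of [s] are the coset representatives from which Schreier bases are
    built; [j] is called the level of the conjugate. *)
Definition lev s j x := x ^ (s ^- j).

Lemma lev0 s x : lev s 0 x = x. Proof. by rewrite /lev expg0 invg1 conjg1. Qed.

Lemma levD s i j x : lev s (i + j) x = lev s i (lev s j x).
Proof. by rewrite /lev -conjgM expgnDr invgM. Qed.

Lemma levM s j x h : lev s j (x * h) = lev s j x * lev s j h.
Proof. exact: conjMg. Qed.

Lemma levV s j x : lev s j x^-1 = (lev s j x)^-1.
Proof. exact: conjVg. Qed.

Lemma levJ s j x c : lev s j x ^ c = lev (s ^ c) j (x ^ c).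
Proof. by rewrite /lev conjJg conjVg conjXg. Qed.

Lemma levE s j x : lev s j x = s ^+ j * x * s ^- j.
Proof. by rewrite /lev conjgE invgK mulgA. Qed.

Lemma lev_s s j k : lev s j (s ^+ k) = s ^+ k.
Proof. by rewrite levE -expgnDr addnC expgnDr mulgK. Qed.

Lemma mem_lev H s j x : subgroup H -> H s -> H x -> H (lev s j x).
Proof. by move=> sH Hs Hx; apply: (sgJ sH) => //; exact: sgXV. Qed.

Lemma hom_onX (K : groupType) H (f : G -> K) x n : subgroup H -> hom_on H f ->
  H x -> f (x ^+ n) = f x ^+ n.
Proof.
move=> sH fM Hx; elim: n => [|n IH]; first by rewrite !expg0 (hom1_on sH fM).
by rewrite !expgS fM ?IH //; exact: sgX.
Qed.

End Levels.

Section Schreier.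
Variables (G : groupType) (J : Type) (n : nat).
Implicit Types (L : set G) (y : option J -> G).

Definition schreier y (o : option (J * 'I_n)) : G :=
  if o is Some (l, j) then lev (y None) j (y (Some l)) else y None ^+ n.

Definition skernel y : set G := gen (range (schreier y)).

Lemma skernel_subgroup y : subgroup (skernel y).
Proof. exact: gen_subgroup. Qed.

Lemma skernel_letter y o : skernel y (schreier y o).
Proof. by apply: in_gen; exists o. Qed.

Lemma skernel_sX y k : skernel y (y None ^+ (n * k)).
Proof.
rewrite expgnA; apply: (sgX k (skernel_subgroup y)); exact: (@skernel_letter y None).
Qed.

Hypothesis n0 : 0 < n.

Lemma skernel_lev y j l : skernel y (lev (y None) j (y (Some l))).
Proof.
have sK := skernel_subgroup y.
rewrite (divn_eq j n) mulnC levD; apply: (sgJ sK).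
  exact: (@skernel_letter y (Some (l, Ordinal (ltn_pmod j n0)))).
by apply: (sgV sK); exact: skernel_sX.
Qed.

Lemma skernel_z y l : skernel y (y (Some l)).
Proof. by have := @skernel_lev y 0 l; rewrite lev0. Qed.

Lemma skernel_sub L y : basis L y -> skernel y `<=` L.
Proof.
move=> bL; have sL := basis_subgroup bL; have Ly := basis_letter bL.
apply: (gen_min sL) => _ [[[l j]|] _ <-] /=; first exact: mem_lev.
exact: sgX.
Qed.

Lemma skernel_normal L y x h : basis L y -> L h -> skernel y x ->
  skernel y (x ^ h).
Proof.
move=> bL Lh Kx; have sK := skernel_subgroup y.
pose N := [set h | (forall x, skernel y x -> skernel y (x ^ h)) /\
                   (forall x, skernel y x -> skernel y (x ^ h^-1))].
have inN g : (forall o, skernel y (schreier y o ^ g)) ->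
             (forall o, skernel y (schreier y o ^ g^-1)) -> N g.
  by move=> h1 h2; split; apply: conj_gen_sub => // _ [o _ <-].
suff : L `<=` N by move=> /(_ h Lh)[+ _]; apply.
rewrite (proj1 bL); apply: gen_min => [|_ [[l|] _ <-]].
- split=> [|a b [a1 a2] [b1 b2]|a [a1 a2]].
  + by split=> u; rewrite ?invg1 conjg1.
  + split=> u Ku; first by rewrite conjgM; apply: b1; exact: a1.
    by rewrite invgM conjgM; apply: a2; exact: b2.
  + by split; rewrite ?invgK.
- by apply: inN => o; apply: (sgJ sK); try exact: skernel_letter;
    rewrite -/(skernel y _) //; try apply: (sgV sK); exact: skernel_z.
- have sn := @skernel_letter y None.
  apply: inN => -[[l j]|] /=; rewrite ?conjXg ?conjgE ?gnorm //.
    case: j => [[|j] lt] /=.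
      rewrite expg0 !gnorm.
      have -> : (y None)^-1 * y (Some l) * y None =
                lev (y None) n.-1 (y (Some l)) ^ (y None ^+ n).
        by rewrite /lev -conjgM -{2}(prednK n0) expgSr mulKg conjgE mulgA.
      by apply: (sgJ sK) => //; exact: skernel_lev.
    have -> : (y None)^-1 * y None ^+ j.+1 * y (Some l) / y None ^+ j.+1 *
              y None = lev (y None) j (y (Some l)).
      by rewrite levE expgS !gnorm.
    exact: skernel_lev.
  have -> : y None * y None ^+ j * y (Some l) / y None ^+ j / y None =
            lev (y None) j.+1 (y (Some l)).
    by rewrite levE expgS !gnorm.
  exact: skernel_lev.
Qed.

Lemma skernel_coset L y h : basis L y -> L h ->
  exists2 i, i < n & skernel y (h * y None ^+ i).
Proof.
move=> bL Lh; have sK := skernel_subgroup y.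
have Ls := basis_letter bL None; have sL := basis_subgroup bL.
have LK := skernel_sub bL.
suff [i Ki] : exists i, skernel y (h * y None ^+ i).
  exists (i %% n); first exact: ltn_pmod.
  apply: (sgMr sK (@skernel_sX y (i %/ n))).
  by rewrite -mulgA -expgnDr addnC mulnC -divn_eq.
suff : L `<=` [set h | L h /\ exists i, skernel y (h * y None ^+ i)].
  by move=> /(_ h Lh)[].
rewrite {1}(proj1 bL); apply: gen_min => [|_ [o _ <-]].
- split=> [|a b [La [i Ki]] [Lb [k Kk]]|a [La [i Ki]]].
  + by split; [exact: sg1|exists 0; rewrite expg0 mulg1; exact: sg1].
  + split; first exact: sgM.
    exists (k + i); rewrite expgnDr.
    have -> : a * b * (y None ^+ k * y None ^+ i) =
      a * y None ^+ i * (b * y None ^+ k) ^ (y None ^+ i).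
      by rewrite conjgE !mulgA !mulgK.
    by apply: (sgM sK) => //; apply: (skernel_normal bL) => //; exact: sgX.
  + split; first exact: sgV.
    exists (n.-1 * i)%N.
    have -> : a^-1 * y None ^+ (n.-1 * i) =
      (a * y None ^+ i)^-1 ^ (y None ^- i) * y None ^+ (n * i).
      by rewrite -{2}(prednK n0) mulSn expgnDr conjgE !gnorm.
    apply: (sgM sK); last exact: skernel_sX.
    apply: (skernel_normal bL); last exact: (sgV sK).
    exact: sgXV.
- split; first exact: (basis_letter bL).
  case: o => [l|]; first by exists 0; rewrite expg0 mulg1; exact: skernel_z.
  by exists n.-1; rewrite -expgS prednK //; exact: (@skernel_letter y None).
Qed.

Lemma iter_ordS (i : 'I_n) j : val (iter j (@ordS n) i) = (i + j) %% n.
Proof.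
elim: j => [|j IH]; first by rewrite addn0 modn_small.
by rewrite iterS /= IH -[(_ %% n).+1]addn1 modnDml addn1 addnS.
Qed.

(** The kernel acts trivially on the cycle of length [n] turned by [s]. *)
Lemma skernel_level L y j : basis L y -> skernel y (y None ^+ j) -> n %| j.
Proof.
move=> bL; have sL := basis_subgroup bL; have Ly := basis_letter bL.
pose turn := SelfBij (@ordSK n) (@ord_predK n).
have [f fM ef] := (proj2 bL) _ (fun o => if o is Some _ then 1 else turn).
have fX k : f (y None ^+ k) = turn ^+ k by rewrite (hom_onX _ sL fM) // ef.
have turnX k i : (turn ^+ k) i = iter k (@ordS n) i.
  by elim: k i => [|k IH] i; rewrite ?expg0 // expgS bijM IH.
pose i0 := Ordinal n0.
have K1 : skernel y `<=` [set h | L h /\ f h = 1].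
  apply: gen_min => [|_ [[[l i]|] _ <-]].
  - split=> [|a b [La ea] [Lb eb]|a [La ea]].
    + by split; [exact: sg1|exact: hom1_on fM].
    + by split; [exact: sgM|rewrite fM // ea eb mulg1].
    + by split; [exact: sgV|rewrite (homV_on sL fM) // ea invg1].
  - rewrite /= levE; split; first by rewrite -levE; exact: mem_lev.
    have LX := sgX i sL (Ly None).
    rewrite fM ?fM //; [|exact: sgM|exact: sgV].
    by rewrite ef mulg1 -fM ?mulgV ?(hom1_on sL fM) //; exact: sgV.
  - split; first exact: sgX.
    apply: bij_ext => i; rewrite fX turnX; apply: val_inj.
    by rewrite iter_ordS modnDr modn_small.
move=> /K1[_]; rewrite fX => /(congr1 (fun g : self_bij _ => val (g i0))).
by rewrite turnX iter_ordS add0n => /eqP.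
Qed.

(** The induced action: on [K * 'I_n], a letter [z l] multiplies by [a (Some (l, j))]
    at level [j], and [s] lowers the level, multiplying by [a None] when it leaves
    level zero. The kernel preserves level zero and acts on it through the
    homomorphism looked for. *)
Lemma schreier_basis L y : basis L y -> basis (skernel y) (schreier y).
Proof.
move=> bL; split=> // K a.
have sL := basis_subgroup bL; have Ly := basis_letter bL.
pose i0 := Ordinal n0.
pose fwd (p : K * 'I_n) :=
  (if p.2 == i0 then a None * p.1 else p.1, ord_pred p.2).
pose bwd (p : K * 'I_n) :=
  (if ordS p.2 == i0 then (a None)^-1 * p.1 else p.1, ordS p.2).
have fwdK : cancel fwd bwd.
  by case=> k j; rewrite /bwd /= ord_predK; case: eqP => //= _; rewrite mulKg.
have bwdK : cancel bwd fwd.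
  by case=> k j; rewrite /fwd /= ordSK; case: eqP => //= _; rewrite mulVKg.
pose act l (p : K * 'I_n) := (a (Some (l, p.2)) * p.1, p.2).
pose actV l (p : K * 'I_n) := ((a (Some (l, p.2)))^-1 * p.1, p.2).
have actK l : cancel (act l) (actV l).
  by case=> k j; rewrite /actV /= mulKg.
have actVK l : cancel (actV l) (act l).
  by case=> k j; rewrite /act /= mulVKg.
have [f fM ef] := (proj2 bL) _ (fun o =>
  if o is Some l then SelfBij (@actK l) (@actVK l) else SelfBij fwdK bwdK).
have fXV (j : 'I_n) k : f (y None ^- j) (k, i0) = (k, j).
  rewrite (homV_on sL fM) ?(hom_onX _ sL fM) //; last exact: sgX.
  rewrite ef; case: j => j lt; rewrite [X in _ ^+ X]/=; elim: j lt => [|j IH] lt.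
    by rewrite expg0 invg1; congr pair; exact: val_inj.
  have lt' := ltnW lt; rewrite expgSr invgM bijM IH /= /bwd /=.
  rewrite -val_eqE /= modn_small //=; congr pair; apply: val_inj.
  by rewrite /= modn_small.
have fX (j : 'I_n) k : f (y None ^+ j) (k, j) = (k, i0).
  rewrite -{1}(fXV j k) -bijM -fM ?mulgV ?(hom1_on sL fM) //; first exact: sgX.
  exact: sgXV.
pose A := [set h | L h /\ exists g, forall k, f h (k, i0) = (g * k, i0)].
have sA : subgroup A.
  split=> [|b c [Lb [g gP]] [Lc [h hP]]|b [Lb [g gP]]].
  - by split; [exact: sg1|exists 1 => k; rewrite (hom1_on sL fM) mul1g].
  - split; first exact: sgM.
    by exists (g * h) => k; rewrite fM // bijM hP gP mulgA.
  - split; first exact: sgV.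
    exists g^-1 => k; rewrite (homV_on sL fM) //.
    by rewrite -{1}(mulVKg g k) -gP -bijM mulVg.
have letters o k : f (schreier y o) (k, i0) = (a o * k, i0).
  case: o => [[l j]|] /=.
    rewrite levE !fM ?bijM ?fXV ?ef ?fX //; try exact: sgX; try exact: sgXV.
    by apply: sgM => //; exact: sgX.
  have -> : y None ^+ n = y None ^+ ord_pred i0 * y None.
    by rewrite -expgSr /= modn_small ?prednK.
  rewrite fM //; last exact: sgX.
  have e : (SelfBij fwdK bwdK) (k, i0) = (a None * k, ord_pred i0) by [].
  by rewrite bijM ef e fX.
have KA : skernel y `<=` A.
  apply: (gen_min sA) => _ [o _ <-]; split; last by exists (a o) => k.
  by apply: (skernel_sub bL); exact: skernel_letter.
have fE h k : skernel y h -> f h (k, i0) = ((f h (1, i0)).1 * k, i0).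
  by move=> /KA[_ [g gP]]; rewrite !gP /= mulg1.
exists (fun h => (f h (1, i0)).1) => [g h Kg Kh|o]; last first.
  by rewrite letters /= mulg1.
have [Lg _] := KA _ Kg; have [Lh _] := KA _ Kh.
by rewrite fM // bijM (fE h) // (fE g) // mulg1.
Qed.

End Schreier.

(** * Transvections *)

(** Compare the numbers of homomorphisms to the group of permutations of [bool]. *)
Lemma basis_card_le (G : groupType) (I J : finType) (L : set G) (y : I -> G)
  (z : J -> G) : basis L y -> basis L z -> #|I| <= #|J|.
Proof.
move=> by_ bz.
pose swap := SelfBij negbK negbK.
have /choice[f fP] : forall v : {ffun I -> bool}, exists f : G -> self_bij bool,
    hom_on L f /\ forall i, f (y i) = if v i then swap else 1.
  move=> v; have [f fM ef] := (proj2 by_) _ (fun i => if v i then swap else 1).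
  by exists f.
pose F (v : {ffun I -> bool}) := [ffun j => f v (z j) true].
suff : injective F.
  by move=> /leq_card; rewrite !card_ffun card_bool leq_exp2l.
move=> v w e; have det (b c : self_bij bool) : b true = c true -> b = c.
  move=> bc; apply: bij_ext => -[//|].
  have := @can_inj _ _ _ _ (bijK b) true false.
  have := @can_inj _ _ _ _ (bijK c) true false.
  rewrite bc; case: (b false) (c false) (c true) => [] [] [] // h1 h2;
    by [have := h1 erefl|have := h2 erefl].
have ez j : f v (z j) = f w (z j).
  by apply: det; have := congr1 (fun g : {ffun J -> bool} => g j) e; rewrite !ffunE.
have evw := basis_hom_ext bz (proj1 (fP v)) (proj1 (fP w)) ez.
apply/ffunP => i; have := evw _ (basis_letter by_ i).
rewrite !(proj2 (fP _)) => /(congr1 (fun g : self_bij _ => g true)).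
by case: (v i) (w i) => [] [].
Qed.

Lemma basis_card (G : groupType) (I J : finType) (L : set G) (y : I -> G)
  (z : J -> G) : basis L y -> basis L z -> #|I| = #|J|.
Proof.
by move=> by_ bz; apply/eqP; rewrite eqn_leq (basis_card_le by_ bz)
  (basis_card_le bz by_).
Qed.

(** Schreier bases are attached to bases with a distinguished letter, here [i0]. *)
Definition pivot (T : Type) (I : eqType) (i0 : I) (y : I -> T)
  (o : option {i : I | i != i0}) : T := y (if o is Some v then val v else i0).

Lemma basis_pivot (G : groupType) (I : eqType) (L : set G) (y : I -> G) i0 :
  basis L y -> basis L (pivot (i0 := i0) y).
Proof.
apply: (@basis_reindex _ _ _ _ _ _ (fun i => insub i)).
  move=> [v|]; first by rewrite valK.
  by rewrite insubF ?eqxx.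
by move=> i; case: insubP => //= /negPn/eqP ->.
Qed.

Section Transvections.
Variables (Gam : groupType) (I : eqType).
Implicit Types (y : I -> Gam) (c d q : Gam) (i j k : I).

(** Transvections are expressed through conjugation, since the automorphisms of
    subgroups of finite index are to be realised as conjugations. *)
Definition isR y i q c := y i ^ c = y i * q /\ forall k, k != i -> y k ^ c = y k.
Definition isL y i q c := y i ^ c = q * y i /\ forall k, k != i -> y k ^ c = y k.

Definition TV (S : set Gam) y := forall i j c, i != j ->
  isR y i (y j) c \/ isL y i (y j) c -> S c.

Lemma fixV q c : q ^ c = q -> q ^ c^-1 = q.
Proof. by move=> e; rewrite -{1}e conjgK. Qed.

Lemma isR_inv y i q c : isR y i q c -> q ^ c = q -> isR y i q^-1 c^-1.
Proof.
case=> e f eq; split=> [|k /f/fixV //].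
apply: (conjg_inj c); rewrite conjgKV conjMg conjVg eq e mulgK //.
Qed.

Lemma isL_inv y i q c : isL y i q c -> q ^ c = q -> isL y i q^-1 c^-1.
Proof.
case=> e f eq; split=> [|k /f/fixV //].
by apply: (conjg_inj c); rewrite conjgKV conjMg conjVg eq e mulKg.
Qed.

(** Steinberg's commutator relation. *)
Lemma isR_comm y i j q r t : i != j -> isR y i (y j) r -> isR y j q t ->
  q ^ r = q -> q ^ t = q -> isR y i q (t^-1 * r * t * r^-1).
Proof.
move=> ij [ri rf] [tj tf] qr qt; have ji : j != i by rewrite eq_sym.
have [yj _] := isR_inv (conj tj tf) qt.
have [rV _] := isR_inv (conj ri rf) (rf _ ji).
split=> [|l li]; rewrite !conjgM.
  rewrite (fixV (tf _ ij)) ri conjMg (tf _ ij) tj !conjMg rV.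
  by rewrite (fixV (rf _ ji)) (fixV qr) mulgA mulgVK.
have [->|lj] := eqVneq l j; last first.
  by rewrite (fixV (tf _ lj)) (rf _ li) (tf _ lj) (fixV (rf _ li)).
have er : (y j * q^-1) ^ r = y j * q^-1 by rewrite conjMg (rf _ ji) conjVg qr.
have et : (y j * q^-1) ^ t = y j by rewrite conjMg tj conjVg qt mulgK.
by rewrite yj er et (fixV (rf _ ji)).
Qed.

(** A product of three transvections maps [y i] to [y j] and [y j] to the inverse of
    [y i], as a rotation does; its square inverts both. *)
Lemma flip2_ex (S : set Gam) y i j a b c : subgroup S -> i != j ->
  isR y i (y j) a -> isR y j (y i) b -> isL y i (y j) c -> S a -> S b -> S c ->
  exists w, [/\ S w, y i ^ w = (y i)^-1, y j ^ w = (y j)^-1 &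
    forall k, k != i -> k != j -> y k ^ w = y k].
Proof.
move=> sS ij [ai af] [bj bf] [ci cf] Sa Sb Sc.
have ji : j != i by rewrite eq_sym.
pose w := c * b^-1 * a.
have Sw : S w by apply: (sgM sS) => //; apply: (sgM sS) => //; exact: sgV.
have [bV _] := isR_inv (conj bj bf) (bf _ ij).
have wi : y i ^ w = y j.
  rewrite /w !conjgM ci conjMg bV (fixV (bf _ ij)) mulgVK; exact: af.
have wj : y j ^ w = (y i)^-1.
  by rewrite /w !conjgM (cf _ ji) bV conjMg (af _ ji) conjVg ai invgM mulVKg.
exists (w * w); split; first exact: sgM.
- by rewrite conjgM wi wj.
- by rewrite conjgM wj conjVg wi.
- move=> k ki kj; have wk : y k ^ w = y k.
    by rewrite /w !conjgM (cf _ ki) (fixV (bf _ kj)) (af _ ki).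
  by rewrite conjgM !wk.
Qed.

Lemma TV_R S y i j c : TV S y -> i != j -> isR y i (y j) c -> S c.
Proof. by move=> tv ij r; apply: (tv i j) => //; left. Qed.

Lemma TV_L S y i j c : TV S y -> i != j -> isL y i (y j) c -> S c.
Proof. by move=> tv ij r; apply: (tv i j) => //; right. Qed.

Lemma TV_conj S y y' e : subgroup S -> S e -> (forall i, y i ^ e = y' i) ->
  TV S y -> TV S y'.
Proof.
move=> sS Se ye tv i j c ij h.
suff : S (e * c * e^-1).
  by move=> /(sgMr sS (sgV sS Se)) /(sgMl sS Se).
apply: (tv i j) => //; case: h => -[ci cf]; [left|right].
  split=> [|k ki]; rewrite !conjgM ye; last by rewrite cf // -ye conjgK.
  by rewrite ci conjMg -!ye !conjgK.
split=> [|k ki]; rewrite !conjgM ye; last by rewrite cf // -ye conjgK.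
by rewrite ci conjMg -!ye !conjgK.
Qed.

Lemma TV_flip S y i : subgroup S -> TV S y -> TV S (upd y i (y i)^-1).
Proof.
move=> sS tv a b c ab h.
have fixo k (Ha : forall k, k != a -> upd y i (y i)^-1 k ^ c = upd y i (y i)^-1 k) :
    k != a -> y k ^ c = y k.
  move=> ka; have := Ha k ka; rewrite /upd; case: eqP => // -> .
  by rewrite conjVg => /invg_inj.
have [ai|ai] := eqVneq a i.
  have bi : b != i by rewrite -ai eq_sym.
  have ba : b != a by rewrite eq_sym.
  case: h => -[ca cf]; apply: (sgVE sS).
    apply: (TV_L tv ab); rewrite -[y b]invgK.
    apply: isL_inv; last by rewrite conjVg fixo.
    split=> [|k ka]; last exact: fixo.
    move: ca; rewrite ai upd_same upd_other // conjVg => /(congr1 (fun g => g^-1)).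
    by rewrite invgK invgM invgK.
  apply: (TV_R tv ab); rewrite -[y b]invgK.
  apply: isR_inv; last by rewrite conjVg fixo.
  split=> [|k ka]; last exact: fixo.
  move: ca; rewrite ai upd_same upd_other // conjVg => /(congr1 (fun g => g^-1)).
  by rewrite invgK invgM invgK.
have ba : b != a by rewrite eq_sym.
have fb : y b ^ c = y b by case: h => -[_ /fixo]; apply.
have [bi|bi] := eqVneq b i; last first.
  case: h => -[ca cf]; rewrite !upd_other // in ca.
    by apply: (TV_R tv ab); split=> // k; exact: fixo.
  by apply: (TV_L tv ab); split=> // k; exact: fixo.
apply: (sgVE sS); case: h => -[ca cf]; rewrite bi upd_same upd_other // -bi in ca.
  apply: (TV_R tv ab); rewrite -[y b]invgK; apply: isR_inv.
    by split=> // k; exact: fixo.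
  by rewrite conjVg fb.
apply: (TV_L tv ab); rewrite -[y b]invgK; apply: isL_inv.
  by split=> // k; exact: fixo.
by rewrite conjVg fb.
Qed.

(** No source of a transvection is a target of another, so that they commute and
    their product has the prescribed action. *)
Lemma TV_block S y (A : seq I) (g : I -> I) c : subgroup S -> TV S y ->
  (forall i, i \in A -> exists a, isR y i (y (g i)) a) ->
  uniq A -> (forall i, i \in A -> g i \notin A) ->
  (forall i, i \in A -> y i ^ c = y i * y (g i)) ->
  (forall i, i \notin A -> y i ^ c = y i) ->
  (forall d, (forall i, y i ^ d = y i) -> d = 1) -> S c.
Proof.
move=> sS tv ex; elim: A c ex => [|a A IH] c ex /=.
  move=> _ _ _ cf det; rewrite (det c) => [|i]; first exact: (sg1 sS).
  exact: cf.
move=> /andP[aA uA] gA cA cf det.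
have aa : a \in a :: A by rewrite inE eqxx.
have [e [ea ef]] := ex a aa.
have ga : g a != a by have := gA a aa; rewrite inE negb_or => /andP[].
have Se : S e by apply: (TV_R (i := a) (j := g a) tv); rewrite 1?eq_sym.
suff : S (e^-1 * c) by apply: (sgMl sS); exact: sgV.
have [eV efV] := isR_inv (conj ea ef) (ef _ ga).
apply: IH => //.
- by move=> i iA; apply: ex; rewrite inE iA orbT.
- move=> i iA; have := gA i; rewrite !inE iA orbT => /(_ isT).
  by rewrite negb_or => /andP[].
- move=> i iA; have ia : i != a by apply: contraNneq aA => <-.
  by rewrite conjgM efV // cA // inE iA orbT.
- move=> i iA; rewrite conjgM; have [->|ia] := eqVneq i a.
    by rewrite eV conjMg conjVg cA // (cf (g a)) ?mulgK // gA.
  by rewrite efV // cf // inE negb_or ia.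
Qed.

End Transvections.

(** * Rewriting a word in a cyclic kernel *)

Section Rewriting.
Variables (G : groupType) (I : eqType) (L : set G) (y : I -> G) (p : nat).
Variables (i0 : I) (v : I -> nat).
Hypotheses (bL : basis L y) (p1 : 1 < p) (v1 : v i0 = 1%N).
Hypothesis vp : forall i, v i <= p.

Let p0 : 0 < p := ltnW p1.
Let J := {i : I | i != i0}.
Let s := y i0.

(** The kernel of the homomorphism mapping [y i] to [v i] modulo [p] is that of
    the homomorphism mapping all the letters but [s] of this basis to zero. *)
Definition adapted (o : option J) : G :=
  if o is Some x then y (val x) * s ^- v (val x) else s.

Lemma adapted_basis : basis L adapted.
Proof.
apply: (basis_unip (A := [set None]) (basis_pivot i0 bL)) => [_ -> //|].
case=> [x _|nN]; last by case: nN.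
exists 1, (s ^- v (val x)); split.
- exact: (sg1 (gen_subgroup _)).
- apply: (sgXV _ (gen_subgroup _)); apply: in_gen; exists None => //.
- by rewrite mul1g.
Qed.

(** The Schreier generators for the representatives [s ^+ j], [j < p]: reducing the
    exponent on the right modulo [p] ensures that a letter is rewritten into at most
    one letter. *)
Definition rewriting_letters (o : option (J * 'I_p)) : G :=
  if o is Some (x, j) then s ^+ j * y (val x) * s ^- ((j + v (val x)) %% p)
  else s ^+ p.
Local Notation R := rewriting_letters.

Lemma rewriting_basis : basis (skernel p adapted) R.
Proof.
apply: (basis_unip (A := [set None]) (schreier_basis p0 adapted_basis)) => [_ -> //|].
case=> [[x j] _|nN]; last by case: nN.
exists 1, ((s ^+ p) ^+ ((j + v (val x)) %/ p)); split.
- exact: (sg1 (gen_subgroup _)).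
- by apply: (sgX _ (gen_subgroup _)); apply: in_gen; exists None.
rewrite mul1g /= levE -expgnA; set a := y (val x).
have e := divn_eq (j + v (val x)) p; rewrite mulnC in e.
have -> : s ^- ((j + v (val x)) %% p) =
          s ^- (j + v (val x)) * s ^+ (p * ((j + v (val x)) %/ p)).
  by rewrite {2}e addnC expgnDr invgM mulgVK.
by rewrite expgnDr invgM !mulgA.
Qed.

(** A representative of the image of a signed letter in the integers modulo [p]. *)
Definition weight (a : I * bool) := if a.2 then v a.1 else p - v a.1.
Definition weights u := sumn (map weight u).

Lemma rewrite_letter a j : j < p -> exists u, size u <= 1 /\
  s ^+ j * sgn y a = eval R u * s ^+ ((j + weight a) %% p).
Proof.
case: a => x b jp; have [->|xi] := eqVneq x i0.
  case: b; rewrite /weight /sgn /= v1 -/s.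
    rewrite addn1; have [lt|ge] := ltnP j.+1 p.
      by exists [::]; rewrite modn_small //= mul1g expgSr.
    have -> : j.+1 = p by apply/eqP; rewrite eqn_leq jp.
    exists [:: (None, true)]; rewrite modnn /= !mulg1 -expgSr.
    by split=> //; congr (_ ^+ _); apply/eqP; rewrite eqn_leq jp.
  case: j jp => [|j] jp.
    exists [:: (None, false)]; rewrite add0n modn_small; last by lia.
    split=> //; rewrite /= mulg1 mul1g /sgn /= -{1}(prednK p0) expgSr invgM subn1.
    by rewrite mulgVK.
  exists [::]; have -> : (j.+1 + (p - 1) = j + p)%N by lia.
  by rewrite modnDr modn_small ?(ltnW jp) //= mul1g expgSr mulgK.
case: b; rewrite /weight /sgn /=.
  exists [:: (Some (Sub x xi, Ordinal jp), true)]; split=> //.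
  by rewrite /= mulg1 /sgn /= mulgVK.
set k := (j + (p - v x)) %% p; have kp : k < p by exact: ltn_pmod.
exists [:: (Some (Sub x xi, Ordinal kp), false)]; split=> //.
rewrite /= mulg1 /sgn /= {2}/k modnDml.
have -> : (j + (p - v x) + v x = j + p)%N by have := vp x; lia.
by rewrite modnDr modn_small // !invgM invgK mulgA mulgVK.
Qed.

Lemma rewrite_word u j : j < p -> exists u', size u' <= size u /\
  s ^+ j * eval y u = eval R u' * s ^+ ((j + weights u) %% p).
Proof.
elim: u j => [|a u IH] j jp.
  by exists [::]; rewrite /weights /= addn0 modn_small // mul1g mulg1.
have [e [se Ee]] := rewrite_letter a jp.
have [u' [su' Eu']] := IH _ (ltn_pmod (j + weight a) p0).
exists (e ++ u'); rewrite size_cat /=; split; first by lia.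
rewrite mulgA Ee -mulgA Eu' eval_cat mulgA /weights /=.
by rewrite modnDml addnA.
Qed.

(** The first letter is absorbed in the coset representative [s]. *)
Lemma rewrite_shorter u b : p %| weights ((i0, b) :: u) ->
  exists u' k, size u' <= size u /\ eval R u' = lev s k (eval y ((i0, b) :: u)).
Proof.
rewrite /weights /= /weight /= v1 -/(weights u) => pw.
case: b pw => pw.
  have [u' [su eu]] := rewrite_word u p1.
  exists u', 0; split=> //; rewrite lev0 /= /sgn /= -/s -[s]expg1 eu.
  by rewrite (eqP pw) mulg1.
have [u' [su eu]] := rewrite_word u p0.
exists u', 1%N; split=> //; rewrite levE expg1 /= /sgn /= -/s mulVKg.
move: eu; rewrite mul1g add0n => ->.
have -> : weights u %% p = 1%N; last by rewrite expg1 mulgK.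
have : (p - 1 + weights u).+1 = 1 %[mod p].
  by rewrite -addn1 -modnDml (eqP pw).
by rewrite -addSn subn1 prednK // modnDl => ->; rewrite modn_small.
Qed.

End Rewriting.

Section Weights.
Variables (I : eqType) (p : nat).
Implicit Types (u : seq (I * bool)) (i j : I).

Definition delta i := fun k : I => nat_of_bool (k == i).

Lemma weights_cat v u u' : weights p v (u ++ u') = (weights p v u + weights p v u')%N.
Proof. by rewrite /weights map_cat sumn_cat. Qed.

Lemma weights_combine i j c u : i != j -> c <= p ->
  weights p (fun k => if k == i then 1%N else if k == j then c else 0%N) u =
  weights p (delta i) u + c * weights p (delta j) u %[mod p].
Proof.
move=> ij cp; have ji : (j == i) = false by rewrite eq_sym; apply/negbTE.
elim: u => [|[k b] u IH]; first by rewrite /weights /= muln0.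
rewrite /weights /= -!/(weights _ _ _) mulnDr addnACA -modnDm IH modnDm.
apply/eqP; rewrite eqn_modDr /weight /delta /=; case: b.
  have [->|ki] := eqVneq k i; first by rewrite (negbTE ij) muln0 addn0.
  by have [_|_] := eqVneq k j; rewrite /= ?muln1 ?muln0.
have [->|ki] := eqVneq k i.
  by rewrite (negbTE ij) subn0 addnC modnMDl.
have [_|_] := eqVneq k j; rewrite !subn0; last by rewrite addnC modnMDl.
have -> : (p + c * (p - 1) = c * p + (p - c))%N; last by rewrite modnMDl.
by rewrite mulnBr muln1; have : c <= c * p; nia.
Qed.

End Weights.

(** * Groups acting like a commensurator *)

Section FiniteIndexIn.
Variables (Gam : groupType) (G : set Gam).
Implicit Types (L : set Gam).

(** Finite index is witnessed by a function on the whole of [Gam] separating the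
    cosets, so that no structure on [G] itself is involved. *)
Definition fi_in L := [/\ subgroup L, L `<=` G &
  exists (T : finType) (c : Gam -> T),
    forall x y, G x -> G y -> c x = c y -> L (x^-1 * y)].

Lemma fi_in_skernel (J : Type) L (y : option J -> Gam) n : 0 < n ->
  fi_in L -> basis L y -> fi_in (skernel n y).
Proof.
move=> n0 [sL LG [T [c cP]]] bL; have sK := skernel_subgroup n y.
split=> // [x /(skernel_sub bL)/LG //|].
pose r (t : T) := xget 1 [set x | G x /\ c x = t].
have rL x : G x -> L (x^-1 * r (c x)).
  move=> Gx; have [Gr cr] := @xgetI _ 1 [set z | G z /\ c z = c x] x (conj Gx erefl).
  exact: cP.
have /choice[i iP] : forall l, exists i : 'I_n,
    L l -> skernel n y (l * y None ^+ i).
  move=> l; have [Ll|] := pselect (L l); last by exists (Ordinal n0).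
  by have [i lt Ki] := skernel_coset n0 bL Ll; exists (Ordinal lt).
exists (T * 'I_n)%type, (fun x => (c x, i (x^-1 * r (c x)))).
move=> x z Gx Gz [ec ei].
have Kx := iP _ (rL x Gx); have Kz := iP _ (rL z Gz).
have -> : x^-1 * z = (x^-1 * r (c x) * y None ^+ i (x^-1 * r (c x))) *
                     (z^-1 * r (c z) * y None ^+ i (z^-1 * r (c z)))^-1.
  by rewrite ei ec !gnorm.
by apply: (sgM sK) => //; exact: (sgV sK).
Qed.

End FiniteIndexIn.

Section Ambient.
Variables (Gam : groupType) (G : set Gam).
Implicit Types (L S : set Gam).

(** Elements of [Gam] are determined by their conjugation action on subgroups of
    finite index of [G], and the automorphisms of such subgroups are
    conjugations. *)
Hypothesis faith : forall L c, fi_in G L -> (forall h, L h -> h ^ c = h) -> c = 1.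
Hypothesis real : forall (I : finType) L (y z : I -> Gam), fi_in G L ->
  basis L y -> basis L z -> exists c, forall i, y i ^ c = z i.

Lemma conj_fix_basis (I : Type) L (y : I -> Gam) c : fi_in G L -> basis L y ->
  (forall i, y i ^ c = y i) -> c = 1.
Proof.
move=> fL [eL _] yc; apply: (faith fL); rewrite eL.
suff : gen (range y) `<=` [set h | h ^ c = h] by [].
by apply: (gen_min (subgroup_centralizer c)) => _ [i _ <-]; exact: yc.
Qed.

Lemma conj_basis_inj (I : Type) L (y : I -> Gam) c d : fi_in G L ->
  basis L y -> (forall i, y i ^ c = y i ^ d) -> c = d.
Proof.
move=> fL bL e; apply: divg1_eq; apply: (conj_fix_basis fL bL) => i.
by rewrite conjgM e conjgK.
Qed.

Section Transvect.
Variables (I : finType) (L : set Gam) (y : I -> Gam).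
Hypotheses (fL : fi_in G L) (bL : basis L y).

Lemma isR_ex i q : gen (y @` [set k | k != i]) q -> exists c, isR y i q c.
Proof.
move=> gq; have [c cP] := real fL bL (basis_updr bL gq).
exists c; split=> [|k ki]; first by rewrite cP upd_same.
by rewrite cP upd_other.
Qed.

Lemma isL_ex i q : gen (y @` [set k | k != i]) q -> exists c, isL y i q c.
Proof.
move=> gq; have [c cP] := real fL bL (basis_updl bL gq).
exists c; split=> [|k ki]; first by rewrite cP upd_same.
by rewrite cP upd_other.
Qed.

Lemma gen_other i j : i != j -> gen (y @` [set k | k != i]) (y j).
Proof. by move=> ij; apply: in_gen; exists j => //=; rewrite eq_sym. Qed.

Lemma isR_exj i j : i != j -> exists c, isR y i (y j) c.
Proof. by move=> ij; apply: isR_ex; exact: gen_other. Qed.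

Lemma isL_exj i j : i != j -> exists c, isL y i (y j) c.
Proof. by move=> ij; apply: isL_ex; exact: gen_other. Qed.

Lemma isR_uniq i q c d : isR y i q c -> isR y i q d -> c = d.
Proof.
move=> [ci cf] [di df]; apply: (conj_basis_inj fL bL) => k.
by have [->|ki] := eqVneq k i; rewrite ?ci ?di // cf ?df.
Qed.

Lemma isL_uniq i q c d : isL y i q c -> isL y i q d -> c = d.
Proof.
move=> [ci cf] [di df]; apply: (conj_basis_inj fL bL) => k.
by have [->|ki] := eqVneq k i; rewrite ?ci ?di // cf ?df.
Qed.

Lemma TV_blockP S (A : {pred I}) (g : I -> I) c : subgroup S -> TV S y ->
  (forall i, i \in A -> g i \notin A) ->
  (forall i, i \in A -> y i ^ c = y i * y (g i)) ->
  (forall i, i \notin A -> y i ^ c = y i) -> S c.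
Proof.
move=> sS tv gA cA cf.
apply: (TV_block (A := enum A) (g := g) sS tv); rewrite ?enum_uniq //.
- move=> i; rewrite mem_enum => iA; apply: isR_exj.
  by apply: contraNneq (gA i iA) => <-.
- by move=> i; rewrite !mem_enum; exact: gA.
- by move=> i; rewrite mem_enum; exact: cA.
- by move=> i; rewrite mem_enum; exact: cf.
- by move=> d; exact: conj_fix_basis fL bL.
Qed.

Lemma flip2_S S i j c : subgroup S -> TV S y -> i != j ->
  y i ^ c = (y i)^-1 -> y j ^ c = (y j)^-1 ->
  (forall k, k != i -> k != j -> y k ^ c = y k) -> S c.
Proof.
move=> sS tv ij ci cj cf; have ji : j != i by rewrite eq_sym.
have [a ra] := isR_exj ij; have [b rb] := isR_exj ji.
have [d ld] := isL_exj ij.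
have [w [Sw wi wj wf]] := flip2_ex sS ij ra rb ld (TV_R tv ij ra)
  (TV_R tv ji rb) (TV_L tv ij ld).
suff -> : c = w by [].
apply: (conj_basis_inj fL bL) => k; have [->|ki] := eqVneq k i; first by rewrite ci.
have [->|kj] := eqVneq k j; first by rewrite cj.
by rewrite cf // wf.
Qed.

End Transvect.

Lemma nie_TV S (I : finType) L (y z : I -> Gam) b : subgroup S -> fi_in G L ->
  basis L y -> nie b y z -> TV S y -> TV S z.
Proof.
move=> sS fL + n; elim: n => {b y z} // b y z.
  move=> i j n IH ij bL tv; have bz := nie_basis bL n.
  have [c rc] := isR_exj fL bz ij; have tvz := IH bL tv.
  apply: (TV_conj sS (TV_R tvz ij rc) _ tvz) => k.
  case: rc => ci cf; have [->|ki] := eqVneq k i; first by rewrite upd_same.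
  by rewrite upd_other // cf.
by move=> i n IH bL tv; apply: TV_flip => //; exact: IH.
Qed.

(** A multiplication move is a transvection. Inversions are pushed to the letter
    [y i0], where they cancel in pairs: inverting two letters at once is a product
    of transvections. *)
Lemma nie_S S (I : finType) L (y z : I -> Gam) b i0 c : subgroup S ->
  fi_in G L -> basis L y -> TV S y -> nie b y z ->
  (forall i, (if b then upd y i0 (y i0)^-1 else y) i ^ c = z i) -> S c.
Proof.
move=> sS fL + + n; elim: n c => {b y z}.
- move=> y c bL _ yc; rewrite (conj_fix_basis fL bL yc); exact: sg1.
- move=> b y z i j n IH ij c bL tv yc; have bz := nie_basis bL n.
  have tvz := nie_TV sS fL bL n tv.
  set yb := (if b then _ else _) in yc.
  have byb : basis L yb by rewrite /yb; case: (b) => //; exact: basis_flip.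
  have [d dP] := real fL byb bz.
  suff : S (d^-1 * c) by apply: (sgMl sS); apply: (sgV sS); exact: (IH d bL tv).
  apply: (TV_R tvz ij); split=> [|k ki]; rewrite conjgM -dP conjgK yc dP.
    by rewrite upd_same -dP.
  by rewrite upd_other.
- move=> b y z i n IH c bL tv yc; have bz := nie_basis bL n.
  have bf := basis_flip i0 bL.
  have byb : basis L (if b then upd y i0 (y i0)^-1 else y) by case: (b).
  have [d dP] := real fL byb bz.
  have Sd : S d by exact: (IH d bL tv).
  suff : S (c * d^-1) by apply: (sgMr sS); exact: sgV.
  have dV k : z k ^ d^-1 = (if b then upd y i0 (y i0)^-1 else y) k.
    by rewrite -dP conjgK.
  have e1 k : (if ~~ b then upd y i0 (y i0)^-1 else y) k ^ (c * d^-1) =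
      upd z i (z i)^-1 k ^ d^-1 by rewrite conjgM yc.
  have {}e1 k : (if ~~ b then upd y i0 (y i0)^-1 else y) k ^ (c * d^-1) =
      (if k == i then ((if b then upd y i0 (y i0)^-1 else y) i)^-1
       else (if b then upd y i0 (y i0)^-1 else y) k).
    by rewrite e1 /upd; case: eqP => _; rewrite ?conjVg dV.
  set w := c * d^-1 in e1 *.
  have e2 k : y k ^ w = if (k == i) (+) (k == i0) then (y k)^-1 else y k.
    have := e1 k; case: (b) => /=; rewrite /upd.
      by have [->|ki] := eqVneq k i; have [->|k0] := eqVneq _ i0; rewrite ?invgK.
    have [->|k0] := eqVneq k i0.
      by rewrite conjVg => /(congr1 (fun g => g^-1)); case: eqP => [<-|_]; rewrite !invgK.
    by have [->|ki] := eqVneq k i.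
  have [ii|ii] := eqVneq i i0.
    have -> : w = 1; last exact: (sg1 sS).
    by apply: (conj_fix_basis fL bL) => k; rewrite e2 ii addbb.
  apply: (flip2_S fL bL sS tv ii).
  - by rewrite e2 eqxx (negbTE ii).
  - by rewrite e2 eqxx eq_sym (negbTE ii).
  - by move=> k /negbTE ki /negbTE kj; rewrite e2 ki kj.
Qed.

(** By Nielsen's theorem the two bases are related by elementary moves, each of
    which carries transvections to products of transvections. *)
Lemma TV_basis S (I J : finType) L (y : I -> Gam) (z : J -> Gam) : subgroup S ->
  fi_in G L -> basis L y -> basis L z -> TV S y -> TV S z.
Proof.
move=> sS fL by_ bz tv.
have eJI : #|J| = #|I| := basis_card bz by_.
pose s (j : J) : I := enum_val (cast_ord eJI (enum_rank j)).
pose t (i : I) : J := enum_val (cast_ord (esym eJI) (enum_rank i)).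
have sK : cancel s t by move=> j; rewrite /s /t enum_valK cast_ordK enum_rankK.
have tK : cancel t s by move=> i; rewrite /s /t enum_valK cast_ordKV enum_rankK.
have bys := basis_reindex sK tK by_.
have tvs : TV S (y \o s).
  move=> i j c ij h; apply: (tv (s i) (s j)); first by rewrite (can_eq sK).
  have other k : k != s i -> t k != i by apply: contra => /eqP <-; rewrite tK.
  by case: h => -[ci cf]; [left|right]; split=> // k /other /cf; rewrite /= tK.
have [b n] := nielsen bz bys.
exact: nie_TV sS fL bys n tvs.
Qed.

End Ambient.

(** * Transvections of Schreier bases *)

Section LevelAction.
Variables (Gam : groupType).
Implicit Types (s x c : Gam).

Lemma lev_conj_fix s j x c : s ^ c = s -> lev s j x ^ c = lev s j (x ^ c).
Proof. by move=> e; rewrite levJ e. Qed.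

Lemma lev_modE n s j x : lev s j x = lev (s ^+ n) (j %/ n) (lev s (j %% n) x).
Proof. by rewrite {1}(divn_eq j n) mulnC levD /lev -expgnA. Qed.

(** Only the residues of the levels matter for an element commuting with the
    power of [s] lying in the kernel. *)
Lemma lev_mod_fix n s j x c : (s ^+ n) ^ c = s ^+ n ->
  lev s (j %% n) x ^ c = lev s (j %% n) x -> lev s j x ^ c = lev s j x.
Proof. by move=> es ex; rewrite (lev_modE n) lev_conj_fix // ex. Qed.

End LevelAction.

Lemma pick_other (T : finType) (A : seq T) : size A < #|T| ->
  exists x, x \notin A.
Proof.
move=> lt; apply/existsP; rewrite -negb_forall; apply/negP => /forallP h.
have e : #|A| = #|T| by apply: eq_card => x; rewrite !inE h.
by have := card_size A; rewrite e leqNgt lt.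
Qed.

Section Star.
Variables (Gam : groupType) (G : set Gam).
Hypothesis faith : forall L c, fi_in G L -> (forall h, L h -> h ^ c = h) -> c = 1.
Hypothesis real : forall (I : finType) L (y z : I -> Gam), fi_in G L ->
  basis L y -> basis L z -> exists c, forall i, y i ^ c = z i.

Variables (S L : set Gam) (J : finType) (n : nat).
Hypotheses (n0 : 0 < n) (sS : subgroup S) (fL : fi_in G L) (J3 : 2 < #|J|).

Let i0 : 'I_n := Ordinal n0.
Let mod_ord j : 'I_n := Ordinal (ltn_pmod j n0).

Hypothesis level0 : forall (y : option J -> Gam) l k c, basis L y -> l != k ->
  isR (schreier (n := n) y) (Some (l, i0)) (y (Some k)) c -> S c.

Local Notation B := (schreier (n := n)).
Implicit Types (y : option J -> Gam) (l k : J) (i j : 'I_n).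

Let fK y : basis L y -> fi_in G (skernel n y).
Proof. exact: fi_in_skernel. Qed.

Let bK y : basis L y -> basis (skernel n y) (B y).
Proof. exact: schreier_basis. Qed.

Let B0 y l : B y (Some (l, i0)) = y (Some l).
Proof. by rewrite /= lev0. Qed.

Let setl y l a := upd y (Some l) (lev (y None) a (y (Some l))).

Let setl_basis y l a : basis L y -> basis L (setl y l a).
Proof.
move=> bL; rewrite /setl levE; have sg := gen_subgroup (y @` [set k | k != Some l]).
have gs : gen (y @` [set k | k != Some l]) (y None).
  by apply: in_gen; exists None.
by apply: basis_upd => //; [exact: (sgX a sg)|exact: (sgXV a sg)].
Qed.

(** Other levels of the target and of the source are reached by changing the
    basis of [L]. *)
Lemma star_levels y l k (a j : nat) c : basis L y -> l != k ->
  (y None ^+ n) ^ c = y None ^+ n ->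
  lev (y None) a (y (Some l)) ^ c = lev (y None) a (y (Some l)) * lev (y None) j (y (Some k)) ->
  (forall l' (b : 'I_n), (l', b) != (l, mod_ord a) ->
     lev (y None) b (y (Some l')) ^ c = lev (y None) b (y (Some l'))) -> S c.
Proof.
move=> bL lk sc lc oc; have kl : k != l by rewrite eq_sym.
pose y' := setl (setl y l a) k j.
have sE : y' None = y None by [].
have lE : y' (Some l) = lev (y None) a (y (Some l)).
  by rewrite /y' /setl upd_other // upd_same.
have kE : y' (Some k) = lev (y None) j (y (Some k)).
  by rewrite /y' /setl upd_same upd_other // upd_other.
have oE m : m != l -> m != k -> y' (Some m) = y (Some m).
  by move=> ml mk; rewrite /y' /setl !upd_other.
have fixk b : lev (y None) b (y (Some k)) ^ c = lev (y None) b (y (Some k)).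
  apply: (lev_mod_fix sc); apply: (oc k (mod_ord b)).
  by apply: contraNneq kl => -[->].
apply: (level0 (y := y') (l := l) (k := k)) => //; first by do 2!apply: setl_basis.
split; first by rewrite B0 lE kE.
move=> [[m b]|] ne; last exact: sc.
rewrite /= sE; have [ml|ml] := eqVneq m l.
  rewrite ml lE -levD; apply: (lev_mod_fix sc).
  apply: (oc l (mod_ord (b + a))); apply: contra ne => /eqP[e].
  rewrite ml; apply/eqP; do 2!congr (_ _); apply: val_inj => /=.
  move: e; rewrite -{2}[a]add0n => /eqP; rewrite eqn_modDr mod0n modn_small //.
  by move/eqP.
have [->|mk] := eqVneq m k; first by rewrite kE -levD.
rewrite oE //; apply: oc; apply: contraNneq ml => -[->] //.
Qed.

Let star_some_other y l i k j c : basis L y -> l != k ->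
  isR (B y) (Some (l, i)) (B y (Some (k, j))) c -> S c.
Proof.
move=> bL lk [lc oc]; apply: (star_levels (a := i) (j := j) bL lk) => //.
  exact: (oc None).
move=> l' b ne; apply: (oc (Some (l', b))); apply: contra ne => /eqP[-> ->].
by apply/eqP; congr pair; apply: val_inj; rewrite /= modn_small.
Qed.

Let third (l k : J) : exists m : J, m != l /\ m != k.
Proof.
have [m] := @pick_other _ [:: l; k] J3.
by rewrite !inE negb_or => /andP[]; exists m.
Qed.

(** A transvection by the product of [y k] and of the power of [s] is one between
    letters of level zero after a change of basis; that by [y k] is then removed. *)
Let star_some_pow y l i c : basis L y ->
  isR (B y) (Some (l, i)) (B y None) c -> S c.
Proof.
move=> bL rc; have [k [kl _]] := third l l; have lk : l != k by rewrite eq_sym.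
have ne : Some (l, i) != Some (k, i0) by apply: contraNneq lk => -[->].
have [e re] := isR_exj real (fK bL) (bK bL) ne.
have Se : S e by exact: star_some_other re.
suff : S (c * e) by exact: (sgMr sS).
case: rc re => lc oc [le oe].
pose y' := upd y (Some k) (y (Some k) * y None ^+ n).
have by' : basis L y'.
  apply: basis_updr => //; apply: (sgX n (gen_subgroup _)).
  by apply: in_gen; exists None.
have sE : y' None = y None by [].
have lE : y' (Some l) = y (Some l) by rewrite /y' upd_other.
have oE o : o != (Some (l, i)) -> B y o ^ (c * e) = B y o.
  by move=> oo; rewrite conjgM oc // oe.
apply: (star_levels (a := i) (j := 0) by' lk).
- by rewrite sE; exact: (oE None).
- rewrite sE lE lev0 /y' upd_same; move: lc; rewrite conjgM => ->.
  by rewrite conjMg le (oe None) // -mulgA B0.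
move=> l' b ne'; rewrite sE; have ne2 : Some (l', b) != Some (l, i).
  apply: contra ne' => /eqP[-> ->]; apply/eqP; congr pair; apply: val_inj.
  by rewrite /= modn_small.
have [e'|nk] := eqVneq l' k; last by rewrite /y' upd_other //; exact: (oE (Some (l', b))).
rewrite e' /y' upd_same levM lev_s conjMg (oE None) //.
by rewrite e' in ne2; rewrite (oE (Some (k, b))).
Qed.

Let star_some_same y l i j c : basis L y -> j != i ->
  isR (B y) (Some (l, i)) (B y (Some (l, j))) c -> S c.
Proof.
move=> bL ji rc; have [k [kl _]] := third l l; have lk : l != k by rewrite eq_sym.
have ne : Some (l, i) != Some (k, i0) by apply: contraNneq lk => -[->].
have ne2 : Some (k, i0) != Some (l, j) by apply: contraNneq kl => -[->].
have [r rr] := isR_exj real (fK bL) (bK bL) ne.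
have [t rt] := isR_exj real (fK bL) (bK bL) ne2.
have Sr : S r by exact: star_some_other rr.
have St : S t by exact: star_some_other rt.
have nji : Some (l, j) != Some (l, i) by apply: contraNneq ji => -[->].
have := isR_comm ne rr rt (proj2 rr _ nji) (proj2 rt _ _).
rewrite eq_sym => /(_ ne2) /(isR_uniq faith (fK bL) (bK bL) rc) ->.
apply: (sgM sS); last exact: (sgV sS).
by apply: (sgM sS) => //; apply: (sgM sS) => //; exact: (sgV sS).
Qed.

Let star_some y l i o c : basis L y -> o != Some (l, i) ->
  isR (B y) (Some (l, i)) (B y o) c -> S c.
Proof.
case: o => [[k j]|] bL ne; last exact: star_some_pow.
have [kl|kl] := eqVneq k l; last by apply: star_some_other => //; rewrite eq_sym.
rewrite kl; apply: star_some_same => //; apply: contraNneq ne => ->.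
by rewrite kl.
Qed.

(** Inverting a letter exchanges right and left transvections. *)
Let star_left y l i o c : basis L y -> o != Some (l, i) ->
  isL (B y) (Some (l, i)) (B y o) c -> S c.
Proof.
move=> bL ne [lc oc].
pose y' := upd y (Some l) (y (Some l))^-1; have by' := basis_flip (Some l) bL.
have sE : y' None = y None by [].
have lE j : B y' (Some (l, j)) = (B y (Some (l, j)))^-1.
  by rewrite /= /y' upd_same levV.
have oE k j : k != l -> B y' (Some (k, j)) = B y (Some (k, j)).
  by move=> kl; rewrite /= /y' !upd_other.
have fixo p : p != Some (l, i) -> B y' p ^ c = B y' p.
  case: p => [[k j]|] ne'; last exact: (oc None).
  have [e|kl] := eqVneq k l; last by rewrite oE // oc.
  by rewrite e in ne' *; rewrite lE conjVg oc.
have ll : B y' (Some (l, i)) ^ c = B y' (Some (l, i)) * (B y o)^-1.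
  by rewrite lE conjVg lc invgM.
case: o ne ll {lc} => [[k j]|] ne ll; last first.
  apply: (sgVE sS); apply: (star_some (o := None) (l := l) (i := i) by') => //.
  rewrite -[B y' None]invgK; apply: isR_inv; last by rewrite conjVg (oc None).
  by split.
have [kl|kl] := eqVneq k l.
  rewrite kl in ne ll *.
  by apply: (star_some (o := Some (l, j)) (l := l) (i := i) by') => //; rewrite lE.
apply: (sgVE sS); apply: (star_some (o := Some (k, j)) (l := l) (i := i) by') => //.
rewrite oE // -[B y (Some (k, j))]invgK; apply: isR_inv; last by rewrite conjVg oc.
by split.
Qed.

(** In terms of [s' = s * x], where [x] is a letter, the powers of [s] of small
    exponent do not involve [x] itself, but [s ^+ n] does. *)
Let power_pivot y (j : J) (e : Gam) : basis L y ->
  (forall b : 'I_n, (0 < b)%N ->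
     lev (y None * y (Some j)) b (y (Some j)) ^ e = lev (y None * y (Some j)) b (y (Some j))) ->
  forall a, a < n -> exists2 P, P ^ e = P & y None ^+ a = P * (y None * y (Some j)) ^+ a.
Proof.
move=> bL fe; elim=> [|a IH] lt; first by exists 1; rewrite ?conj1g // !expg0 mulg1.
have [P eP sP] := IH (ltnW lt); set s' := y None * y (Some j) in fe sP *.
exists (P * (lev s' a.+1 (y (Some j)))^-1).
  by rewrite conjMg eP conjVg (fe (Ordinal lt)).
have -> : y None = s' / y (Some j) by rewrite /s' mulgK.
by rewrite expgSr -/s' /s' mulgK sP levE expgSr /s' !gnorm.
Qed.

(** In the basis with [s' = s * x] in place of [s], the left transvection of [x] by
    the inverse of [h] fixes [s' ^+ n] and hence maps [s ^+ n] to [s ^+ n * h]; its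
    effect on [x] is undone in the original basis. *)
Let star_pivot0 y k c : basis L y -> isR (B y) None (y (Some k)) c -> S c.
Proof.
move=> bL rc; have [j [jk _]] := third k k; set h := y (Some k) in rc *.
have hE : h = B y (Some (k, i0)) by rewrite B0.
have ne : Some (j, i0) != Some (k, i0) by apply: contraNneq jk => -[->].
have [e le] := isL_exj real (fK bL) (bK bL) ne; rewrite -hE in le.
have Se : S e.
  by apply: (star_left (l := j) (i := i0) (o := Some (k, i0)) bL);
    [rewrite eq_sym|rewrite -hE].
pose y' := upd y None (y None * y (Some j)).
have by' : basis L y'.
  by apply: basis_updr => //; apply: in_gen; exists (Some j).
have hE' : h = B y' (Some (k, i0)) by rewrite /= lev0.
have [e' le'] := isL_exj real (fK by') (bK by') ne; rewrite -hE' in le'.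
have Se' : S e'.
  by apply: (star_left (l := j) (i := i0) (o := Some (k, i0)) by');
    [rewrite eq_sym|rewrite -hE'].
have he' : h ^ e' = h by rewrite hE'; apply: (proj2 le'); rewrite eq_sym.
have he : h ^ e = h by rewrite hE; apply: (proj2 le); rewrite eq_sym.
have [lV oV] := isL_inv le' he'.
have pw := @power_pivot y j e'^-1 bL.
have {}pw a : a < n -> exists2 P, P ^ e'^-1 = P & y None ^+ a = P * y' None ^+ a.
  apply: pw => b b0; apply: (oV (Some (j, b))).
  by apply: contraTneq b0 => -[->].
have xe : y (Some j) ^ e'^-1 = h^-1 * y (Some j) by move: lV; rewrite /= !lev0.
suff -> : c = e'^-1 * e by apply: (sgM sS) => //; exact: (sgV sS).
apply: (isR_uniq faith (fK bL) (bK bL) rc); split=> [|[[l a]|] // na]; last first.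
  have [P eP sP] := pw a (ltn_ord a).
  have lE : B y (Some (l, a)) = lev (y' None) a (y (Some l)) ^ P^-1.
    by rewrite /= /lev sP invgM conjgM.
  have [e1|ne1] := eqVneq (l, a) (j, i0).
    have [_ [_ o]] := (le, le); rewrite e1 B0 conjgM xe.
    have [lj _] := le; rewrite B0 in lj.
    by rewrite conjMg conjVg he lj mulKg.
  have ne2 : Some (l, a) != Some (j, i0) by apply: contraNneq ne1 => -[-> ->].
  rewrite conjgM (_ : B y (Some (l, a)) ^ e'^-1 = B y (Some (l, a))).
    exact: (proj2 le).
  rewrite lE conjJg conjVg eP; congr (_ ^ _).
  exact: (oV (Some (l, a)) ne2).
have ln : n.-1 < n by rewrite prednK.
have [P eP sP] := pw _ ln.
have sn : y None ^+ n = P * y' None ^+ n / y (Some j).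
  have X (x : Gam) : x ^+ n = x ^+ n.-1 * x by rewrite -expgSr prednK.
  by rewrite !X sP -!mulgA; congr (_ * (_ * _)); rewrite mulgV mulg1.
have s'n : (y' None ^+ n) ^ e'^-1 = y' None ^+ n by exact: (oV None).
have es : (y None ^+ n) ^ e'^-1 = y None ^+ n * h.
  by rewrite sn !conjMg eP s'n conjVg xe invgM invgK !mulgA.
rewrite /= conjgM es conjMg he; congr (_ * _).
exact: (proj2 le None).
Qed.

Let star_pivot y o c : basis L y -> o != None ->
  isR (B y) None (B y o) c -> S c.
Proof.
case: o => [[k j]|] // bL _ rc; have [k' [kk _]] := third k k.
have ne : None != Some (k', i0) :> option (J * 'I_n) by [].
have ne2 : Some (k', i0) != Some (k, j) by apply: contraNneq kk => -[->].
have [r rr] := isR_exj real (fK bL) (bK bL) ne.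
have [t rt] := isR_exj real (fK bL) (bK bL) ne2.
have Sr : S r by apply: (star_pivot0 bL); rewrite -B0; exact: rr.
have St : S t by apply: (star_some (o := Some (k, j)) bL _ rt); rewrite eq_sym.
have nji : Some (k, j) != None by [].
have := isR_comm ne rr rt (proj2 rr _ nji) (proj2 rt _ _).
rewrite eq_sym => /(_ ne2) /(isR_uniq faith (fK bL) (bK bL) rc) ->.
apply: (sgM sS); last exact: (sgV sS).
by apply: (sgM sS) => //; apply: (sgM sS) => //; exact: (sgV sS).
Qed.

(** Here the left side is reached by inverting simultaneously [s ^+ n] and another
    letter of the Schreier basis. *)
Let star_pivot_left y o c : basis L y -> o != None ->
  isL (B y) None (B y o) c -> S c.
Proof.
case: o => [[k j]|] // bL _ [cn co]; have [k' [kk _]] := third k k.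
have ne : Some (k', i0) != None by [].
have ne' : None != Some (k', i0) :> option (J * 'I_n) by [].
have [a ra] := isR_exj real (fK bL) (bK bL) ne.
have [b rb] := isR_exj real (fK bL) (bK bL) ne'.
have [d ld] := isL_exj real (fK bL) (bK bL) ne.
have Sa : S a by exact: (star_some (o := None) bL _ ra).
have Sb : S b by exact: (star_pivot (o := Some (k', i0)) bL _ rb).
have Sd : S d by exact: (star_left (o := None) bL _ ld).
have [w [Sw wi wj wf]] := flip2_ex sS ne ra rb ld Sa Sb Sd.
have kne : Some (k, j) != Some (k', i0).
  by apply: contraNneq kk => -[->].
have wN : B y None ^ w^-1 = (B y None)^-1.
  by apply: (conjg_inj w); rewrite conjgKV conjVg wj invgK.
have wk' : B y (Some (k', i0)) ^ w^-1 = (B y (Some (k', i0)))^-1.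
  by apply: (conjg_inj w); rewrite conjgKV conjVg wi invgK.
have wo p : p != Some (k', i0) -> p != None -> B y p ^ w^-1 = B y p.
  by move=> p1 p2; apply: fixV; exact: wf.
suff : S (w * c * w^-1).
  by move=> /(sgMr sS (sgV sS Sw)) /(sgMl sS Sw).
apply: (sgVE sS); apply: (star_pivot (o := Some (k, j)) bL) => //.
rewrite -[B y (Some (k, j))]invgK; apply: isR_inv; last first.
  by rewrite conjVg !conjgM wf // co // wo.
split=> [|p pn]; rewrite !conjgM.
  by rewrite wj conjVg cn invgM conjMg !conjVg wN invgK wo.
have [->|pk] := eqVneq p (Some (k', i0)).
  by rewrite wi conjVg co // conjVg wk' invgK.
by rewrite wf // co // wo.
Qed.

(** The cases are those of a source [s ^+ n] or a conjugate of a letter, and of a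
    right or left multiplication. *)
Theorem TV_schreier y : basis L y -> TV S (B y).
Proof.
move=> bL [[l i]|] o c ne h; case: h => h.
- by apply: star_some h => //; rewrite eq_sym.
- by apply: star_left h => //; rewrite eq_sym.
- by apply: star_pivot h => //; rewrite eq_sym.
- by apply: star_pivot_left h => //; rewrite eq_sym.
Qed.

End Star.

(** * Isolating a single transvection two levels down *)

Section Grid.
Variables (Gam : groupType) (G : set Gam).
Hypothesis faith : forall L c, fi_in G L -> (forall h, L h -> h ^ c = h) -> c = 1.
Hypothesis real : forall (I : finType) L (y z : I -> Gam), fi_in G L ->
  basis L y -> basis L z -> exists c, forall i, y i ^ c = z i.

Variables (S L : set Gam) (J : finType) (p : nat) (y : option J -> Gam).
Hypotheses (p1 : 1 < p) (sS : subgroup S) (fL : fi_in G L) (bL : basis L y).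
Hypothesis tvL : forall z : option J -> Gam, basis L z -> TV S (schreier (n := p) z).

Let p0 : 0 < p := ltnW p1.
Let z0 : 'I_p := Ordinal p0.
Local Notation B := (schreier (n := p)).

Variables (e i j k : J).
Hypothesis dist : uniq [:: e; i; j; k].

Let t1 := y None.
Let t2 := y (Some e).
Let x l := y (Some l).
Let o0 : option (J * 'I_p) := Some (e, z0).

(** A basis of the kernel of [t1] in which [t2] is the only letter mapped to a
    generator by the homomorphism whose kernel is the intersection of the
    kernels of [t1] and of [t2]. *)
Let w (o : option (J * 'I_p)) : Gam :=
  if o is Some (l, a) then
    if (l == e) && (a != z0) then lev t1 a t2 * t2^-1 else lev t1 a (x l)
  else t1 ^+ p.

Definition grid_basis : option {o | o != o0} -> Gam := pivot (i0 := o0) w.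

Lemma grid_basisP : basis (skernel p y) grid_basis.
Proof.
apply: basis_pivot.
pose A := [set o : option (J * 'I_p) |
  if o is Some (l, a) then ~~ ((l == e) && (a != z0)) else true].
apply: (basis_unip (A := A) (schreier_basis p0 bL)).
  by case=> [[l a]|] //= /negbTE ->.
case=> [[l a]|] //= /negP; rewrite negbK => la; have := la => /andP[/eqP le _].
rewrite la; exists 1, (t2^-1); split.
- exact: (sg1 (gen_subgroup _)).
- apply: (sgV (gen_subgroup _)); apply: in_gen; exists o0 => /=.
    by rewrite /A /= eqxx andbF.
  by rewrite lev0.
- by rewrite mul1g le.
Qed.

Let K := skernel p grid_basis.
Let fL1 : fi_in G (skernel p y) := fi_in_skernel p0 fL bL.
Let fK : fi_in G K := fi_in_skernel p0 fL1 grid_basisP.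
Let bK : basis K (B grid_basis) := schreier_basis p0 grid_basisP.

Let swap (o : option J) : option J :=
  if o is Some l then if l == e then None else Some l else Some e.

Let swapK : involutive swap.
Proof. by case=> [l|] /=; rewrite ?eqxx //; case: eqP => /= [->|/eqP/negbTE ->]. Qed.

Let y2 := y \o swap.
Let b2 : basis L y2. Proof. exact: basis_reindex swapK swapK bL. Qed.

Let ie : i != e. Proof. by move: dist; rewrite /= !inE !negb_or eq_sym -!andbA => /and3P[]. Qed.
Let je : j != e.
Proof. by move: dist; rewrite /= !inE !negb_or [e == j]eq_sym -!andbA => /and4P[]. Qed.
Let ke : k != e.
Proof. by move: dist; rewrite /= !inE !negb_or [e == k]eq_sym -!andbA => /and4P[]. Qed.
Let ij : i != j.
Proof. by move: dist; rewrite /= !inE !negb_or -!andbA => /and5P[]. Qed.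
Let jk : j != k.
Proof. by move: dist; rewrite /= !inE !negb_or -!andbA => /and5P[_ _ _ _ /and3P[]]. Qed.
Let ik : i != k.
Proof. by move: dist; rewrite /= !inE !negb_or -!andbA => /and5P[_ _ _ _ /and3P[]]. Qed.

Let ne_o0 l : l != e -> Some (l, z0) != o0.
Proof. by apply: contraNneq => -[->]. Qed.

Let sub (l : J) (le : l != e) : {o | o != o0} := exist _ (Some (l, z0)) (ne_o0 le).

Let subi := sub ie.
Let subk := sub ke.

Let y2s l : l != e -> y2 (Some l) = x l.
Proof. by move=> le; rewrite /y2 /= (negbTE le). Qed.

Section Commutator.
Variables (rho kap : Gam).
Hypotheses (rhoP : isR (B y2) (Some (i, z0)) (B y2 (Some (j, z0))) rho)
           (kapP : isR (B y) (Some (j, z0)) (B y (Some (k, z0))) kap).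

Let kap_p : (t1 ^+ p) ^ kap = t1 ^+ p. Proof. exact: (proj2 kapP None). Qed.
Let kap_lev l (a : 'I_p) : (l, a) != (j, z0) -> lev t1 a (x l) ^ kap = lev t1 a (x l).
Proof. by move=> ne; apply: (proj2 kapP (Some (l, a))). Qed.
Let kap_j : x j ^ kap = x j * x k.
Proof. by have := proj1 kapP; rewrite /= !lev0. Qed.
Let kap_x l : l != j -> x l ^ kap = x l.
Proof.
by move=> lj; have := @kap_lev l z0; rewrite lev0; apply; apply: contraNneq lj => -[->].
Qed.
Let kap_t2 : t2 ^ kap = t2. Proof. by apply: kap_x; rewrite eq_sym. Qed.

Let rho_p : (t2 ^+ p) ^ rho = t2 ^+ p. Proof. exact: (proj2 rhoP None). Qed.
Let rho_t1 b : lev t2 b t1 ^ rho = lev t2 b t1.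
Proof.
apply: (lev_mod_fix rho_p).
have := proj2 rhoP (Some (e, Ordinal (ltn_pmod b p0))).
rewrite /= /y2 /= eqxx; apply; apply: contraNneq ie => -[->] //.
Qed.
Let rho_lev l (b : 'I_p) : l != e -> (l, b) != (i, z0) ->
  lev t2 b (x l) ^ rho = lev t2 b (x l).
Proof.
move=> le ne; have := proj2 rhoP (Some (l, b)); rewrite /= -/(y2 _) y2s //.
by apply.
Qed.
Let rho_i : x i ^ rho = x i * x j.
Proof. by have := proj1 rhoP; rewrite /= !lev0 -!/(y2 _) !y2s. Qed.
Let rho_x l : l != e -> l != i -> x l ^ rho = x l.
Proof.
move=> le li; have := @rho_lev l z0 le; rewrite lev0; apply.
by apply: contraNneq li => -[->].
Qed.
Let rho_t10 : t1 ^ rho = t1. Proof. by have := rho_t1 0; rewrite lev0. Qed.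

Let com := kap^-1 * rho * kap * rho^-1.

Let com_fix g : g ^ kap = g -> g ^ rho = g -> g ^ com = g.
Proof.
by move=> gk gr; rewrite /com !conjgM (fixV gk) gr gk (fixV gr).
Qed.

Let levXV s a (g c : Gam) : (lev s a g) ^ c = lev s a g ->
  forall n, (lev s a (g ^+ n)) ^ c = lev s a (g ^+ n).
Proof. by move=> eg n; rewrite /lev conjXg -/(lev s a g) conjXg eg. Qed.

(** The letters moved by [kap] form a row and those moved by [rho] a column of a
    grid; only the letter at the crossing is moved by the commutator. *)
Lemma grid_commutator : isR (B grid_basis) (Some (subi, z0))
  (grid_basis (Some subk)) com.
Proof.
have wk : grid_basis (Some subk) = x k.
  by rewrite /grid_basis /pivot /= (negbTE ke) /= lev0.
have wi : grid_basis (Some subi) = x i.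
  by rewrite /grid_basis /pivot /= (negbTE ie) /= lev0.
have s2 : grid_basis None = t2 by rewrite /grid_basis /pivot /= eqxx /= lev0.
have ki : k != i by rewrite eq_sym.
have ji : j != i by rewrite eq_sym.
have kj : k != j by rewrite eq_sym.
have xkV : x k ^ kap^-1 = x k by apply: fixV; exact: kap_x.
have jV : x j ^ kap^-1 = x j * (x k)^-1.
  by apply: (conjg_inj kap); rewrite conjgKV conjMg kap_j conjVg kap_x // mulgK.
have iV : x i ^ rho^-1 = x i * (x j)^-1.
  by apply: (conjg_inj rho); rewrite conjgKV conjMg rho_i conjVg rho_x // mulgK.
have kapV2 : t2 ^ kap^-1 = t2 by exact: fixV.
have rhoV1 : t1 ^ rho^-1 = t1 by exact: fixV.
split=> [|o ne].
  rewrite /= s2 wi wk !lev0 /com !conjgM (fixV (kap_x ij)) rho_i conjMg (kap_x ij).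
  by rewrite kap_j !conjMg iV !(fixV (rho_x _ _)) // mulgA mulgVK.
case: o ne => [[[o oo] b]|] ne; last first.
  by rewrite /= s2; apply: com_fix; rewrite ?conjXg ?kap_t2 // -conjXg.
rewrite /= s2 /grid_basis /pivot /=; case: o oo ne => [[l a]|] oo ne /=; last first.
  apply: com_fix; first by rewrite lev_conj_fix ?kap_p.
  by apply: levXV.
case: ifP => [/andP[le az]|lea].
  apply: com_fix.
    rewrite lev_conj_fix // conjMg conjVg kap_t2; congr (lev _ _ (_ * _)).
    have := @kap_lev e a; apply; apply: contraNneq je => -[->] //.
  have -> : lev t1 a t2 * t2^-1 = t1 ^+ a * lev t2 1 (t1 ^+ a)^-1.
    by rewrite !levE expg1 !mulgA.
  rewrite levM -levD levV conjMg conjVg !levXV //.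
have xl : lev t2 b (lev t1 a (x l)) = lev t2 b (x l) ^ (lev t2 b (t1 ^+ a))^-1.
  by rewrite -levV -conjJg.
have [el|le] := eqVneq l e.
  exfalso; move: lea; rewrite el eqxx /= => /negbFE/eqP az.
  by have := oo; rewrite el az eqxx.
have [lj|lj] := eqVneq l j.
  have [az|az] := eqVneq a z0; last first.
    apply: com_fix.
      rewrite lev_conj_fix //; congr lev; apply: kap_lev.
      by apply: contraNneq az => -[_ ->].
    rewrite xl conjJg conjVg levXV // rho_lev //.
    by apply: contraNneq ji => -[<-]; rewrite lj.
  rewrite az /= lev0 lj.
  have rj : lev t2 b (x j) ^ rho = lev t2 b (x j).
    by apply: rho_lev => //; apply: contraNneq ji => -[->].
  have rk : lev t2 b (x k) ^ rho = lev t2 b (x k).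
    by apply: rho_lev => //; apply: contraNneq ki => -[->].
  have e1 : lev t2 b (x j) ^ kap^-1 = lev t2 b (x j) / lev t2 b (x k).
    by rewrite lev_conj_fix // jV levM levV.
  have e2 : (lev t2 b (x j) / lev t2 b (x k)) ^ rho = lev t2 b (x j) / lev t2 b (x k).
    by rewrite conjMg conjVg rj rk.
  have e3 : (lev t2 b (x j) / lev t2 b (x k)) ^ kap = lev t2 b (x j).
    rewrite -levV -levM lev_conj_fix //; congr lev.
    by rewrite conjMg conjVg kap_j kap_x // mulgK.
  by rewrite /com !conjgM e1 e2 e3 (fixV rj).
have kl : lev t2 b (lev t1 a (x l)) ^ kap = lev t2 b (lev t1 a (x l)).
  rewrite lev_conj_fix //; congr lev; apply: kap_lev.
  by apply: contraNneq lj => -[->].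
have [lb|lb] := eqVneq (l, b) (i, z0); last first.
  by apply: com_fix => //; rewrite xl conjJg conjVg levXV // rho_lev.
case: lb => li bz; subst l b; rewrite /= !lev0 in kl *.
have az : a != z0.
  apply: contraNneq ne => az; apply/eqP; congr (Some (_, _)).
  by apply: val_inj; rewrite /= az.
have kja : lev t1 a (x j) ^ kap = lev t1 a (x j).
  by apply: kap_lev; apply: contraNneq az => -[->].
have e1 : lev t1 a (x i) ^ rho = lev t1 a (x i) * lev t1 a (x j).
  by rewrite lev_conj_fix // rho_i levM.
have e2 : (lev t1 a (x i) * lev t1 a (x j)) ^ rho^-1 = lev t1 a (x i).
  rewrite -levM lev_conj_fix //; congr lev.
  by rewrite conjMg iV (fixV (rho_x _ _)) // mulgVK.
have e3 : (lev t1 a (x i) * lev t1 a (x j)) ^ kap = lev t1 a (x i) * lev t1 a (x j).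
  by rewrite conjMg kl kja.
by rewrite /com !conjgM (fixV kl) e1 e3 e2.
Qed.

End Commutator.

(** One member of the commutator comes from the kernel of [t1] and the other from
    that of [t2]; both belong to [S]. *)
Lemma grid_single : exists (l m : {o | o != o0}) c, [/\ l != m,
  isR (B grid_basis) (Some (l, z0)) (grid_basis (Some m)) c & S c].
Proof.
have n1 : Some (i, z0) != Some (j, z0) by apply: contraNneq ij => -[->].
have n2 : Some (j, z0) != Some (k, z0) by apply: contraNneq jk => -[->].
have [rho rhoP] := isR_exj real (fi_in_skernel p0 fL b2) (schreier_basis p0 b2) n1.
have [kap kapP] := isR_exj real fL1 (schreier_basis p0 bL) n2.
exists subi, subk, (kap^-1 * rho * kap * rho^-1); split.
- by apply: contraNneq ik => -[->].
- exact: grid_commutator.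
have Sr : S rho := TV_R (tvL b2) n1 rhoP.
have Sk : S kap := TV_R (tvL bL) n2 kapP.
apply: (sgM sS); last exact: (sgV sS).
by apply: (sgM sS) => //; apply: (sgM sS) => //; exact: (sgV sS).
Qed.

(** Any two bases of the kernel of [t1] are related by transvections of that
    kernel, up to the inversion of a letter not involved; conjugating the single
    transvection above provides those between letters of level zero, for all
    bases. *)
Lemma grid_TV (J' : finType) (z : option J' -> Gam) : 2 < #|J'| ->
  basis (skernel p y) z -> TV S (schreier (n := p) z).
Proof.
move=> J3; move: z; have [li [ki [c0 [lk c0P Sc0]]]] := grid_single.
move=> z0' bz0; refine (@TV_schreier _ _ faith real _ _ _ _ p0 sS fL1 J3 _ _ bz0).
move=> z l k' c bz lk' cP.
have bg := grid_basisP.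
have eJ : #|{: option J'}| = #|{: option {o : option (J * 'I_p) | o != o0}}|.
  exact: basis_card bz bg.
have {}eJ : #|J'| = #|{: {o : option (J * 'I_p) | o != o0}}|.
  by move: eJ; rewrite !card_option => -[].
pose f (a : J') : {o | o != o0} := enum_val (cast_ord eJ (enum_rank a)).
pose f' (o : {o | o != o0}) : J' := enum_val (cast_ord (esym eJ) (enum_rank o)).
have ffK : cancel f f' by move=> a; rewrite /f /f' enum_valK cast_ordK enum_rankK.
have f'K : cancel f' f by move=> a; rewrite /f /f' enum_valK cast_ordKV enum_rankK.
pose s1 := tperm (f l) li; pose s2 := tperm (s1 (f k')) ki.
pose g a := s2 (s1 (f a)); pose g' o := f' (s1^-1%g (s2^-1%g o)).
have gK : cancel g g' by move=> a; rewrite /g /g' !permK ffK.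
have g'K : cancel g' g by move=> a; rewrite /g /g' f'K !permKV.
have gl : g l = li.
  have sl : s1 (f l) = li by rewrite /s1 tpermL.
  rewrite /g sl /s2 tpermD // 1?eq_sym // -sl.
  by rewrite (inj_eq perm_inj) (can_eq ffK).
have gk : g k' = ki by rewrite /g /s2 tpermL.
pose u := grid_basis \o omap g.
have bu : basis (skernel p y) u.
  by apply: (basis_reindex (t := omap g')) bg => -[a|] //=; rewrite ?gK ?g'K.
have cu : isR (schreier (n := p) u) (Some (l, z0)) (u (Some k')) c0.
  rewrite /u /= gk; split=> [|[[a b]|] ne].
  - by have := proj1 c0P; rewrite /= /u /= gl.
  - rewrite /= /u /=; apply: (proj2 c0P (Some (g a, b))).
    by apply: contraNneq ne => -[/eqP]; rewrite -gl (can_eq gK) => /eqP -> ->.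
  - exact: (proj2 c0P None).
have tvu : TV S u.
  refine (TV_basis real sS fL1 (schreier_basis p0 bL) bu _); exact: tvL.
have [q] := @pick_other _ [:: l; k'] J3.
rewrite !inE negb_or => /andP[ql qk].
have [b nb] := nielsen bz bu.
pose ub := if b then upd u (Some q) (u (Some q))^-1 else u.
have bub : basis (skernel p y) ub by rewrite /ub; case: (b) => //; exact: basis_flip.
have [d dP] := real fL1 bub bz.
have Sd : S d := nie_S faith real sS fL1 bu tvu nb dP.
have cub : isR (schreier (n := p) ub) (Some (l, z0)) (ub (Some k')) c0.
  rewrite /ub; case: (b) => //; have ukE : upd u (Some q) (u (Some q))^-1 (Some k') = u (Some k').
    by rewrite upd_other // eq_sym.
  rewrite ukE; split=> [|[[a a']|] ne].
  - have := proj1 cu; rewrite /= [upd _ _ _ None]upd_other //.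
    by rewrite upd_other // eq_sym.
  - have := proj2 cu _ ne; rewrite /= [upd _ _ _ None]upd_other //.
    have [->|aq] := eqVneq a q; last by rewrite upd_other.
    by rewrite upd_same levV conjVg => ->.
  - exact: (proj2 cu None).
suff <- : c0 ^ d = c by apply: (sgJ sS).
have schd o : schreier (n := p) z o = schreier (n := p) ub o ^ d.
  by case: o => [[a a']|] /=; rewrite ?levJ ?conjXg !dP.
apply: (isR_uniq faith (fi_in_skernel p0 fL1 bz) (schreier_basis p0 bz) _ cP).
split=> [|o ne]; rewrite !schd -?dP -!conjJg.
  by rewrite (proj1 cub) conjMg.
by rewrite (proj2 cub).
Qed.

End Grid.

(** * Iterated cyclic kernels *)

Section Core.
Variables (Gam : groupType) (G : set Gam).
Hypothesis faith : forall L c, fi_in G L -> (forall h, L h -> h ^ c = h) -> c = 1.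
Hypothesis real : forall (I : finType) L (y z : I -> Gam), fi_in G L ->
  basis L y -> basis L z -> exists c, forall i, y i ^ c = z i.

Variables (S : set Gam) (m p : nat).
Hypotheses (sS : subgroup S) (fG : fi_in G G) (GS : G `<=` S).
Hypotheses (m1 : 1 < m) (p_pr : prime p) (pm : p %| m).
Hypothesis G_basis : exists (I : finType) (x : I -> Gam), basis G x /\ 4 < #|I|.
Hypothesis tvG : forall (J : finType) (y : option J -> Gam), basis G y ->
  TV S (schreier (n := m) y).

Let m0 : 0 < m := ltnW m1.
Let p1 : 1 < p := prime_gt1 p_pr.
Let p0 : 0 < p := prime_gt0 p_pr.
Implicit Types L : set Gam.

(** This property of [L] passes to its kernels modulo [p]; the bound on the rank
    leaves enough letters for the commutators. *)
Definition good L := [/\ fi_in G L,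
  exists (I : finType) (x : I -> Gam), basis L x /\ 4 < #|I| &
  forall (J : finType) (y : option J -> Gam), basis L y ->
    TV S y /\ TV S (schreier (n := p) y)].

Lemma good_card L (J : finType) (y : option J -> Gam) : good L -> basis L y ->
  3 < #|J|.
Proof.
by case=> _ [I [x [bx lt]]] _ bL; have := basis_card bx bL; rewrite card_option; lia.
Qed.

Lemma good_TV L (I : finType) (y : I -> Gam) : good L -> basis L y -> TV S y.
Proof.
move=> gL bL; have [fL [I' [x [bx lt]]] tv] := gL.
have eI := basis_card bx bL.
have /card_gt0P[i0 _] : 0 < #|I| by rewrite -eI; lia.
have [tvp _] := tv _ _ (basis_pivot i0 bL).
exact (TV_basis real sS fL (basis_pivot i0 bL) bL tvp).
Qed.

Lemma good_skernel L (J : finType) (y : option J -> Gam) : good L -> basis L y ->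
  good (skernel p y).
Proof.
move=> gL bL; have [fL _ tv] := gL; have J4 := good_card gL bL.
have bK := schreier_basis p0 bL; have fK := fi_in_skernel p0 fL bL.
split=> //.
  exists (option (J * 'I_p)), (schreier (n := p) y); split=> //.
  by rewrite card_option card_prod card_ord ltnS (leq_trans _ (leq_mul J4 p1)).
move=> J' z bz; split.
  exact (TV_basis real sS fK bK bz (proj2 (tv _ _ bL))).
have /card_gt0P[e _] : 0 < #|J| := ltnW (ltnW (ltnW J4)).
have [i ni] := @pick_other _ [:: e] (ltnW (ltnW J4)).
have [j nj] := @pick_other _ [:: e; i] (ltnW J4).
have [k nk] := @pick_other _ [:: e; i; j] J4.
have dist : uniq [:: e; i; j; k].
  move: ni nj nk; rewrite /= !inE !negb_or [e == i]eq_sym [e == j]eq_sym.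
  by rewrite [e == k]eq_sym [i == j]eq_sym [i == k]eq_sym [j == k]eq_sym
     => -> /andP[-> ->] /and3P[-> -> ->].
apply: (grid_TV faith real p1 sS fL bL _ dist) => //.
  by move=> z' bz'; exact: (proj2 (tv _ _ bz')).
have := basis_card bK bz; rewrite !card_option card_prod card_ord => -[<-].
by rewrite (leq_trans _ (leq_mul J4 p1)).
Qed.

(** Transvections of [G] act on the kernels as products of commuting
    transvections. *)
Lemma good_G : good G.
Proof.
split=> // J y bL; have [I [x [bx I5]]] := G_basis.
have bB (K : finType) (z : option K -> Gam) (bz : basis G z) := schreier_basis m0 bz.
have fB (K : finType) (z : option K -> Gam) (bz : basis G z) := fi_in_skernel m0 fG bz.
have Rpivot (K : finType) (z : option K -> Gam) l k c : basis G z -> l != k ->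
    isR z (Some l) (z (Some k)) c -> S c.
  move=> bz lk [lc oc].
  (* all the conjugates of the letter in the kernel modulo m are moved at once *)
  apply: (TV_blockP faith real (fB _ _ bz) (bB _ _ bz)
    (A := [pred o | if o is Some (l', _) then l' == l else false])
    (g := fun o => if o is Some (_, a) then Some (k, a) else None) sS (tvG bz)).
  - by case=> [[l' a]|] //= _; rewrite inE /= eq_sym.
  - case=> [[l' a]|] //; rewrite inE /= => /eqP ->.
    by rewrite lev_conj_fix ?lc ?levM // oc.
  - case=> [[l' a]|]; rewrite inE /= => ll; last by rewrite conjXg oc.
    by rewrite lev_conj_fix ?oc //; apply: contraNneq ll => -[->].
have eJ : #|I| = #|J|.+1 by have := basis_card bx bL; rewrite card_option.
have TR (K : finType) (z : K -> Gam) i j c : basis G z -> i != j ->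
    isR z i (z j) c -> S c.
  move=> bz ij [ic oc]; have K5 : 4 < #|K| by rewrite -(basis_card bx bz).
  have [e] := @pick_other _ [:: i; j] (ltnW (ltnW K5)).
  rewrite !inE !negb_or [e == i]eq_sym [e == j]eq_sym => /andP[ie je].
  apply: (Rpivot _ _ (Sub i ie) (Sub j je) c (basis_pivot e bz)).
    by apply: contraNneq ij => /(congr1 val) /= ->.
  split=> [|o ne]; first by rewrite /pivot /= ic.
  rewrite /pivot oc //; case: o ne => [v|] ne; last by rewrite eq_sym.
  apply: contraNneq ne => vi; apply/eqP; congr Some; apply: val_inj.
  by rewrite /= -vi.
split.
  move=> i j c ij [|[ic oc]]; first exact: TR.
  have bf := basis_flip i bL; apply: (sgVE sS).
  have ji : j != i by rewrite eq_sym.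
  apply: (TR _ _ i j _ bf ij); rewrite [upd _ _ _ j]upd_other // -[y j]invgK.
  apply: isR_inv; last by rewrite conjVg oc.
  split=> [|k ki]; last by rewrite !upd_other // oc.
  by rewrite upd_same conjVg ic invgM.
refine (@TV_schreier _ _ faith real _ _ _ _ p0 sS fG _ _ _ bL); first by lia.
move=> z l k c bz lk [lc oc]; rewrite /= lev0 in lc.
have sp : (z None ^+ p) ^ c = z None ^+ p by exact: (oc None).
have klev b : lev (z None) b (z (Some k)) ^ c = lev (z None) b (z (Some k)).
  apply: (lev_mod_fix sp); apply: (oc (Some (k, Ordinal (ltn_pmod b p0)))).
  by apply: contraNneq lk => -[->].
(* level zero modulo p splits into the levels divisible by p modulo m *)
apply: (TV_blockP faith real (fB _ _ bz) (bB _ _ bz)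
  (A := [pred o | if o is Some (l', a) then (l' == l) && (p %| val a) else false])
  (g := fun o => if o is Some (_, a) then Some (k, a) else None) sS (tvG bz)).
- by case=> [[l' a]|] //= _; rewrite inE /= eq_sym (negbTE lk).
- case=> [[l' a]|] //; rewrite inE /= => /andP[/eqP -> /dvdnP[q ->]].
  have e h : lev (z None) (q * p) h = lev (z None ^+ p) q h.
    by rewrite /lev mulnC expgnA.
  by rewrite !e lev_conj_fix // lc levM.
- case=> [[l' a]|]; rewrite inE /= => ll.
    apply: (lev_mod_fix sp).
    apply: (oc (Some (l', Ordinal (ltn_pmod a p0)))).
    apply: contraNN ll => /eqP[->] /eqP; rewrite eqxx /= => am.
    by rewrite /dvdn.
  by case/dvdnP: pm => q ->; rewrite mulnC expgnA conjXg sp.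
Qed.

(** * Normal subgroups *)

Section NormalSubgroup.
Variable N : set Gam.
Hypotheses (sN : subgroup N) (nN : forall n s, N n -> S s -> N (n ^ s)).

(** The commutator of a letter with a transvection of it is another letter. *)
Lemma letter_all L (I : finType) (y : I -> Gam) i : good L -> basis L y ->
  N (y i) -> L `<=` N.
Proof.
move=> gL bL Ni; have [fL _ _] := gL.
rewrite (proj1 bL); apply: (gen_min sN) => _ [j _ <-].
have [->//|ji] := eqVneq j i; rewrite eq_sym in ji.
have [c rc] := isR_exj real fL bL ji.
have Sc := TV_R (good_TV gL bL) ji rc.
by have := nN Ni Sc; rewrite (proj1 rc); exact: (sgMl sN Ni).
Qed.

(** A member of a basis of [L] is enough for [N] to contain [G]. *)
Definition climb L := forall (I : finType) (y : I -> Gam) i,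
  basis L y -> N (y i) -> G `<=` N.

Lemma climb_G : climb G.
Proof. by move=> I y i bL; exact: letter_all good_G bL. Qed.

(** The letters [z l] of [L] belong to the kernel. *)
Lemma climb_skernel L (J : finType) (y : option J -> Gam) : good L ->
  basis L y -> climb L -> climb (skernel p y).
Proof.
move=> gL bL cL I z i bz Ni; have gK := good_skernel gL bL.
have KN := letter_all gK bz Ni; have J4 := good_card gL bL.
have /card_gt0P[l _] : 0 < #|J| := ltnW (ltnW (ltnW J4)).
by apply: (cL _ y (Some l) bL); apply: KN; exact: skernel_z.
Qed.

Lemma solve_mod a b : ~~ (p %| b) -> exists2 c, c <= p & p %| a + c * b.
Proof.
move=> pb; have cop : coprime b p by rewrite coprime_sym prime_coprime.
pose r := (p - a %% p)%N; pose x := chinese b p 0 r.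
have /dvdnP[q xq] : b %| x by rewrite /dvdn (chinese_modl cop) mod0n.
exists (q %% p); first by rewrite ltnW // ltn_pmod.
rewrite /dvdn -modnDmr -modnMml modn_mod modnMml -xq (chinese_modr cop) modnDmr.
by rewrite -modnDml /r subnKC ?modnn // ltnW // ltn_pmod.
Qed.

(** The commutator of a power of [s] prime to [p] with a letter [z l] is the
    quotient of two Schreier letters at different levels, up to conjugation by a
    power of [s ^+ p]. It is therefore a member of a basis of the kernel. *)
Lemma descent_power L (I : finType) (y : I -> Gam) i0 u : good L -> climb L ->
  basis L y -> N (eval y u) -> all (fun a => a.1 == i0) u ->
  ~~ (p %| weights p (delta i0) u) -> G `<=` N.
Proof.
move=> gL cL bL Nu ui pu; pose s := y i0.
have {ui} [q uq] : exists q, eval y u * s ^+ (p * q) = s ^+ weights p (delta i0) u.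
  elim: u ui {Nu pu} => [|[k b] u IH] /=; first by exists 0; rewrite muln0 mulg1.
  move=> /andP[/eqP -> /IH[q uq]]; rewrite /weights /= /weight /delta /= eqxx.
  rewrite -/(weights p _ u) /sgn; case: b => /=; rewrite -/s.
    by exists q; rewrite -mulgA uq -expgS.
  exists q.+1; rewrite mulnSr expgnDr mulgA -[_ * eval y u * _]mulgA uq -mulgA.
  by rewrite -expgnDr addnC -{1}(subnK p0) addnAC addn1 expgS mulKg.
set w := eval y u in Nu uq; set W := weights p _ u in pu uq.
have Gs : G s by have [[_ LG _] _ _] := gL; exact/LG/(basis_letter bL).
have bz := basis_pivot i0 bL; set z := pivot _ in bz.
have J4 := good_card gL bz.
have /card_gt0P[l _] := ltnW (ltnW (ltnW J4)).
have bK := schreier_basis p0 bz; set B := schreier z in bK.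
pose r : 'I_p := Ordinal (ltn_pmod W p0); pose o0 : 'I_p := Ordinal p0.
pose h := s ^+ (p * q) * s ^- (p * (W %/ p)).
have lev_w : B (Some (l, r)) ^ h = z (Some l) ^ w^-1.
  rewrite /B /= /lev -conjgM; congr (_ ^ _).
  have -> : w^-1 = s ^+ (p * q) * s ^- W by rewrite -uq invgM mulgA mulgV mul1g.
  rewrite {2}(divn_eq W p) [(_ %/ p * p)%N]mulnC expgnDr invgM /h.
  have sC a b : s ^+ a * s ^- b = s ^- b * s ^+ a.
    by apply: commuteV; apply: commuteX; apply: commute_sym; exact: commuteX.
  by rewrite [RHS]mulgA [in RHS]sC -!mulgA.
have r0 : Some (l, r) != Some (l, o0) by apply: contraNneq pu => -[e]; rewrite /dvdn e.
have bK' := basis_flip (Some (l, o0)) bK.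
have gB : gen (upd B (Some (l, o0)) (B (Some (l, o0)))^-1 @` [set k | k != Some (l, o0)])
    (B (Some (l, r)) ^ h).
  have gk k : k != Some (l, o0) -> gen (upd B (Some (l, o0)) (B (Some (l, o0)))^-1 @`
      [set k | k != Some (l, o0)]) (B k).
    by move=> kl; apply: in_gen; exists k => //; rewrite upd_other.
  apply: (sgJ (gen_subgroup _)); first exact: gk.
  apply: (sgM (gen_subgroup _)); last apply: (sgV (gen_subgroup _));
    rewrite expgnA; apply: (sgX _ (gen_subgroup _)); exact: (gk None).
apply: (climb_skernel gL bz cL (i := Some (l, o0)) (basis_updl bK' gB)).
rewrite !upd_same lev_w /B /= lev0.
have -> : z (Some l) ^ w^-1 * (z (Some l))^-1 = w * w^-1 ^ (z (Some l))^-1.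
  by rewrite !conjgE !invgK !mulgA.
apply: (sgM sN) => //; apply: nN; first exact: sgV.
have [[_ LG _] _ _] := gL.
by apply/(sgV sS)/GS/LG/(basis_letter bz).
Qed.

(** By induction on the length of a word in [N]. If the exponent sum of some letter
    of the word is divisible by [p], then conjugate the word to start with that
    letter, and rewrite it in the kernel of the exponent sum. Otherwise combine the
    exponent sums of two letters into a homomorphism vanishing on the word. *)
Lemma descent n L (I : finType) (y : I -> Gam) u : good L -> climb L ->
  basis L y -> size u <= n -> N (eval y u) -> eval y u <> 1 -> G `<=` N.
Proof.
elim: n L I y u => [|n IH] L I y u gL cL bL; first by case: u.
move=> su Nu u1; have [fL _ _] := gL; have [sL LG _] := fL.
have step i0 b u' v : v i0 = 1%N -> (forall i, v i <= p) -> size u' <= n ->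
    p %| weights p v ((i0, b) :: u') -> N (eval y ((i0, b) :: u')) ->
    eval y ((i0, b) :: u') <> 1 -> G `<=` N.
  move=> v1 vp su' pw Nw w1; have ba := adapted_basis i0 v bL.
  have [u'' [k [su'' eu]]] := rewrite_shorter y p1 v1 vp pw.
  apply: (IH _ _ _ u'' (good_skernel gL ba) (climb_skernel gL ba cL)
    (rewriting_basis i0 v bL p1)).
  - exact: leq_trans su'' su'.
  - rewrite eu; apply: nN => //; apply: (sgXV _ sS); apply: GS.
    by apply: LG; exact: (basis_letter bL).
  - by rewrite eu /lev => /eqP; rewrite conjg_eq1 => /eqP.
have [/allP all_u|] := boolP (all (fun a => ~~ (p %| weights p (delta a.1) u)) u).
  case: u su Nu u1 all_u => [|[i0 b] u] // su Nu u1 all_u.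
  have [all_i0|] := boolP (all (fun a => a.1 == i0) ((i0, b) :: u)).
    apply: (descent_power gL cL bL Nu all_i0).
    by apply: (all_u (i0, b)); rewrite inE eqxx.
  move=> /allPn[[j c] jc /= ji]; have pj := all_u _ jc; rewrite /= in pj.
  have [d dp pd] := solve_mod (weights p (delta i0) ((i0, b) :: u)) pj.
  apply: (step i0 b u (fun k => if k == i0 then 1%N else if k == j then d else 0%N)) => //.
  - by rewrite eqxx.
  - by move=> k; case: ifP => // _; case: ifP.
  by rewrite /dvdn weights_combine // eq_sym.
move=> /allPn[[i0 b] iu]; rewrite negbK /= => pi.
case/splitPr: iu su Nu u1 pi => u1 u2 su Nu uN1 pi.
have rot : eval y ((i0, b) :: u2 ++ u1) = eval y (u1 ++ (i0, b) :: u2) ^ eval y u1.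
  rewrite !eval_cat conjgE -cat_cons !eval_cat !mulgA mulVg mul1g //.
apply: (step i0 b (u2 ++ u1) (delta i0)).
- by rewrite /delta eqxx.
- by move=> k; rewrite /delta; case: eqP => //= _; exact: p0.
- by move: su; rewrite !size_cat /= addnS ltnS addnC.
- by move: pi; rewrite -cat_cons !weights_cat addnC.
- rewrite rot; apply: nN => //; apply/GS/LG; apply: mem_eval => //.
  exact: (basis_letter bL).
- by rewrite rot => /eqP; rewrite conjg_eq1 => /eqP.
Qed.

(** A non-trivial element does not centralise the subgroups of finite index, so
    some commutator with it is a non-trivial element of [G]. *)
Theorem normal_contains_G : (exists2 n, N n & n <> 1) -> N `<=` S ->
  (forall c, exists2 U, fi_in G U & forall u, U u -> G (u ^ c)) -> G `<=` N.
Proof.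
move=> [n Nn n1] NS germ; have [U fU UG] := germ n; have [sU UG' _] := fU.
have [u [Uu nu]] : exists u, U u /\ u ^ n <> u.
  apply: contrapT => h; apply: n1; apply: (faith fU) => u Uu.
  by apply: contrapT => nu; apply: h; exists u.
have [I [x [bx _]]] := G_basis; have sG := basis_subgroup bx.
have Gw : G (u ^ n * u^-1).
  by apply: (sgM sG); [exact: UG|apply: (sgV sG); exact: UG'].
have Nw : N (u ^ n * u^-1).
  have -> : u ^ n * u^-1 = n^-1 * n ^ u^-1 by rewrite !conjgE invgK !mulgA.
  by apply: (sgM sN); [exact: sgV|apply: nN => //; apply/(sgV sS)/GS/UG'].
have [v ve] := basis_word bx Gw.
apply: (descent (n := size v) (u := v) good_G climb_G bx) => //; rewrite -?ve //.
by move=> /divg1_eq.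
Qed.

(** If [al] is a transvection from [(l, 0)] to [(i, 0)] and [al'] is its shift to
    level one, then [al * al'^-1] is a commutator with [s], hence belongs to [N]. A
    transvection [ka] from [(i, 0)] to [(k, 0)] commutes with [al'] but not with
    [al]: the commutator of [ka] with [al * al'^-1] is the transvection from
    [(l, 0)] to [(k, 0)]. *)
Theorem normal_contains_TV (J : finType) (y : option J -> Gam) : G `<=` N ->
  2 < #|J| -> basis G y -> TV N (schreier (n := m) y).
Proof.
move=> GN J3; refine (@TV_schreier _ _ faith real _ _ _ _ m0 sN fG J3 _ y).
move=> {}y l k c bL lk rc; pose z0 : 'I_m := Ordinal m0; pose z1 : 'I_m := Ordinal m1.
have [i] := @pick_other _ [:: l; k] J3.
rewrite !inE negb_or => /andP[il ik].
have bB := schreier_basis m0 bL; have fK := fi_in_skernel m0 fG bL.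
set B := schreier (n := m) y in rc bB.
have li : Some (l, z0) != Some (i, z0) by apply: contraNneq il => -[->].
have ki : Some (i, z0) != Some (k, z0) by apply: contraNneq ik => -[->].
have [al alP] := isR_exj real fK bB li.
have [ka kaP] := isR_exj real fK bB ki.
have Sal := TV_R (tvG bL) li alP; have Ska := TV_R (tvG bL) ki kaP.
have B0 a : B (Some (a, z0)) = y (Some a) by rewrite /B /= lev0.
have kl : Some (k, z0) != Some (l, z0) by apply: contraNneq lk => -[->].
have := isR_comm li alP kaP (proj2 alP _ kl) (proj2 kaP _ _).
rewrite eq_sym => /(_ ki); rewrite B0 => /(isR_uniq faith fK bB rc) ->.
set s := y None; pose al' := al ^ s^-1.
have sn : (s ^+ m) ^ al = s ^+ m by exact: (proj2 alP None).
have al'E h : h ^ al' = ((h ^ s) ^ al) ^ s^-1.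
  by rewrite -!conjgM; congr (_ ^ _); rewrite /al' conjgE invgK.
have levS j x : lev s j.+1 x = lev s j x ^ s^-1.
  by rewrite /lev expgS invgM conjgM.
have levSs j x : lev s j.+1 x ^ s = lev s j x by rewrite levS conjgKV.
have al'l : B (Some (l, z1)) ^ al' = B (Some (l, z1)) * B (Some (i, z1)).
  rewrite al'E [B (Some (l, z1)) ^ s]levSs.
  have [al0 _] := alP; rewrite -/s in al0.
  have -> : lev s 0 (y (Some l)) ^ al = lev s 0 (y (Some l)) * lev s 0 (y (Some i)).
    exact: al0.
  by rewrite conjMg -!levS.
have al'fix o : o != Some (l, z1) -> B o ^ al' = B o.
  move=> ne; rewrite al'E; suff -> : (B o ^ s) ^ al = B o ^ s by rewrite conjgK.
  case: o ne => [[a [[|b] bm]]|] ne; last first.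
  - have sm : (s ^+ m) ^ s = s ^+ m by rewrite conjgE -expgSr expgS mulKg.
    by rewrite [B None ^ s]sm.
  - have -> : B (Some (a, Ordinal bm)) ^ s = B (Some (a, Ordinal (ltnW bm))).
      exact: levSs.
    apply: (proj2 alP); apply: contraNneq ne => -[-> b0].
    by apply/eqP; congr (Some (_, _)); apply: val_inj; rewrite /= b0.
  (* level 0 is lowered to level m - 1, conjugated by the power of s in B *)
  have -> : B (Some (a, Ordinal bm)) ^ s = B (Some (a, rev_ord z0)) ^ (s ^+ m).
    change (lev s 0 (y (Some a)) ^ s = lev s (m - 1) (y (Some a)) ^ (s ^+ m)).
    rewrite lev0 /lev -conjgM subn1; congr (_ ^ _).
    by rewrite -{2}(prednK m0) expgS -/s; apply/esym; rewrite -expgS expgSr mulKg.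
  rewrite conjJg sn; congr (_ ^ _); apply: (proj2 alP).
  apply: contraTneq m1 => -[_ /eqP]; rewrite subn1 => /eqP e.
  by rewrite -(prednK m0) e.
have al'V : al' = al ^ s^-1 by [].
clearbody al'.
have comm : ka * al' = al' * ka.
  apply: (conj_basis_inj faith fK bB) => o; rewrite !conjgM.
  have [kai kaf] := kaP.
  have ne a b : Some (a, z0) != Some (b, z1) :> option (J * 'I_m).
    by apply/eqP => -[].
  have ne' a b : Some (b, z1) != Some (a, z0) :> option (J * 'I_m) by rewrite eq_sym.
  have [->|ol] := eqVneq o (Some (l, z1)).
    by rewrite kaf // al'l conjMg !kaf.
  have [->|oi] := eqVneq o (Some (i, z0)); last by rewrite kaf // al'fix // kaf.
  by rewrite kai conjMg !al'fix // kai.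
have Nnu : N (al * al'^-1).
  have -> : al * al'^-1 = (s ^ al^-1) * s^-1.
    by rewrite al'V !conjgE !gnorm.
  apply: (sgM sN); last by apply: (sgV sN); apply: GN; exact: (basis_letter bL).
  by apply: nN; [apply: GN; exact: (basis_letter bL)|exact: sgV].
have -> : ka^-1 * al * ka * al^-1 = (al * al'^-1) ^ ka * (al * al'^-1)^-1.
  rewrite conjgE invgM invgK -!mulgA [ka * (al' * _)]mulgA comm.
  by rewrite -[al' * ka * _]mulgA mulKg.
by apply: (sgM sN); [exact: nN|exact: (sgV sN)].
Qed.

End NormalSubgroup.

End Core.

(** * Transfer along an injective homomorphism *)

Section Embedding.
Variables (F Gam : groupType) (e : F -> Gam).
Hypotheses (eM : forall x y, e (x * y) = e x * e y) (e_inj : injective e).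
Implicit Types (H : set F) (L : set Gam).

Lemma emb1 : e 1 = 1.
Proof. by apply: (@mulgI _ (e 1)); rewrite -eM !mulg1. Qed.

Lemma embV x : e x^-1 = (e x)^-1.
Proof. by apply: (@mulgI _ (e x)); rewrite -eM !mulgV emb1. Qed.

Lemma embJ x y : e (x ^ y) = e x ^ e y.
Proof. by rewrite !conjgE !eM embV. Qed.

Lemma embX x n : e (x ^+ n) = e x ^+ n.
Proof. by elim: n => [|n IH]; rewrite ?expg0 ?emb1 // !expgS eM IH. Qed.

Lemma emb_eval I (y : I -> F) u : e (eval y u) = eval (e \o y) u.
Proof.
elim: u => [|[i b] u IH] /=; first exact: emb1.
by rewrite eM IH; congr (_ * _); rewrite /sgn /=; case: b; rewrite ?embV.
Qed.

Lemma emb_schreier (J : Type) n (y : option J -> F) :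
  e \o schreier (n := n) y = schreier (n := n) (e \o y).
Proof.
apply/funext => -[[l j]|] /=; last exact: embX.
by rewrite /lev embJ embV embX.
Qed.

Lemma emb_subgroup H : subgroup H -> subgroup (e @` H).
Proof.
move=> sH; split; first by exists 1; [exact: sg1|exact: emb1].
  by move=> _ _ [x Hx <-] [y Hy <-]; exists (x * y); [exact: (sgM sH)|exact: eM].
by move=> _ [x Hx <-]; exists x^-1; [exact: (sgV sH)|exact: embV].
Qed.

Lemma emb_image H x : (e @` H) (e x) <-> H x.
Proof. by split=> [[y Hy /e_inj <-] //|Hx]; exists x. Qed.

Lemma emb_gen I (y : I -> F) : e @` gen (range y) = gen (range (e \o y)).
Proof.
apply/seteqP; split=> [_ [x /gen_wordP[u ->] <-]|_ /gen_wordP[u ->]].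
  by apply/gen_wordP; exists u; exact: emb_eval.
by exists (eval y u); [apply/gen_wordP; exists u|exact: emb_eval].
Qed.

Lemma emb_basis I H (y : I -> F) : basis H y <-> basis (e @` H) (e \o y).
Proof.
split=> [[eH uH]|[eH uH]]; split.
- by rewrite eH emb_gen.
- move=> K a; have [f fM fy] := uH K a.
  pose d g := xget 1 [set x | e x = g].
  have dK x : d (e x) = x.
    by apply: e_inj; exact: (@xgetI _ 1 [set z | e z = e x] x erefl).
  exists (f \o d); last by move=> i /=; rewrite dK.
  by move=> _ _ [x Hx <-] [y' Hy <-] /=; rewrite -eM !dK fM.
- move: eH; rewrite -emb_gen => eH.
  apply/seteqP; split=> x Hx; first by apply/emb_image; rewrite -eH; exists x.
  by apply/emb_image; rewrite eH; exists x.
- move=> K a; have [f fM fy] := uH K a.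
  exists (f \o e) => // x y' Hx Hy /=; rewrite eM fM //; exact/emb_image.
Qed.

Lemma emb_nie (I : eqType) b (y z : I -> F) : nie b y z ->
  nie b (e \o y) (e \o z).
Proof.
have eupd w (i : I) g : e \o upd w i g = upd (e \o w) i (e g).
  by apply/funext => k; rewrite /= /upd; case: eqP.
elim=> {b y z} [y|b y z i j _ IH ij|b y z i _ IH]; first exact: nie_refl.
- by rewrite eupd eM; exact: nie_mul.
- by rewrite eupd embV; exact: nie_flip.
Qed.

Lemma fi_in_emb H : fi_subgroup H -> fi_in (range e) (e @` H).
Proof.
move=> [sH /(finite_indexP sH)[T [c cP]]]; split; first exact: emb_subgroup.
  by move=> _ [x _ <-]; exists x.
pose d g := xget 1 [set x | e x = g].
have dK x : d (e x) = x.
  by apply: e_inj; exact: (@xgetI _ 1 [set z | e z = e x] x erefl).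
exists T, (c \o d) => _ _ [x _ <-] [y _ <-] /=; rewrite !dK -embV -eM => /cP h.
exact/emb_image.
Qed.

Lemma fi_subgroup_emb L : fi_in (range e) L -> fi_subgroup (e @^-1` L).
Proof.
move=> [sL LG [T [c cP]]]; have sH : subgroup (e @^-1` L).
  split=> [|x y Lx Ly|x Lx] /=; rewrite ?emb1 ?eM ?embV;
    [exact: sg1|exact: (sgM sL)|exact: (sgV sL)].
split=> //; apply/(finite_indexP sH); exists T, (c \o e) => x y /= exy.
by rewrite eM embV; apply: cP.
Qed.

Lemma emb_preimage L : L `<=` range e -> e @` (e @^-1` L) = L.
Proof.
move=> LG; apply/seteqP; split=> [_ [x Lx <-] //|g Lg].
by have [x _ eg] := LG g Lg; exists x; rewrite //= eg.
Qed.

Lemma emb_lift I (y : I -> Gam) : (forall i, range e (y i)) ->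
  exists y', y = e \o y'.
Proof.
move=> yG; have /boolp.choice[y' y'P] i : exists x, e x = y i.
  by have [x _ <-] := yG i; exists x.
by exists y'; apply/funext => i /=; rewrite y'P.
Qed.

End Embedding.

(** * The commensurator of a free group *)

Section Commensurator.
Variable F : groupType.
Implicit Types (H : set F) (f : virtual_iso F) (x g : F).

Lemma subgroupT (G : groupType) : subgroup [set: G]. Proof. by []. Qed.

Lemma inner_bij H g : subgroup H -> (forall x h, H x -> H (x ^ h)) ->
  set_bij H H (conjg^~ g).
Proof.
move=> sH nH; split=> [x|x y _ _|x Hx]; [exact: nH|exact: conjg_inj|].
by exists (x ^ g^-1); [exact: nH|rewrite conjgKV].
Qed.

Definition inner H (fH : fi_subgroup H) (nH : forall x h, H x -> H (x ^ h)) g :=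
  VirtualIso fH fH (fun x y _ _ => conjMg x y g) (inner_bij g (proj1 fH) nH).

Definition ad g : Comm F :=
  Comm_class (inner (fi_subgroupT F) (fun x h _ => I) g^-1).

Lemma adM g h : ad (g * h) = ad g * ad h.
Proof.
rewrite [RHS]Comm_mulE; apply/Comm_classP; exists setT.
split=> [|//|x _ /=]; first exact: fi_subgroupT.
by rewrite invgM conjgM.
Qed.

Lemma inner_ad H (fH : fi_subgroup H) nH g :
  Comm_class (inner fH nH g) = ad g^-1.
Proof. by apply/Comm_classP; exists H; split=> // x _ /=; rewrite invgK. Qed.

(** Conjugation in the commensurator realises the given isomorphism. *)
Lemma ad_conj f x : vdom f x -> ad x ^ (Comm_class f)^-1 = ad (f x).
Proof.
move=> fx; suff e : Comm_class f * ad x = ad (f x) * Comm_class f.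
  by rewrite conjgE invgK mulgA e mulgK.
rewrite [LHS]Comm_mulE [RHS]Comm_mulE; apply/Comm_classP.
have [sU _] := vdomP f.
exists (vdom f); split=> [|y fy|y fy /=]; first exact: vdomP.
  by split; split=> //=; apply: (sgJ sU) => //; exact: sgV.
rewrite !conjgE !invgK !(@vfunM _ f) ?(hom_onV sU (@vfunM _ f)) //.
- exact: (sgV sU).
- by apply: (sgM sU) => //; exact: (sgV sU).
Qed.

Lemma comm_germ (c : Comm F) : exists2 f, c = (Comm_class f)^-1 &
  forall x, vdom f x -> ad x ^ c = ad (f x).
Proof.
have := Comm_classK c^-1; set f := generic_quotient.repr _ => ef.
have e : c = (Comm_class f)^-1 by rewrite ef invgK.
by exists f => // x fx; rewrite e ad_conj.
Qed.

Lemma fi_power H x : fi_subgroup H -> exists2 k, 0 < k & H (x ^+ k).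
Proof.
move=> [sH /(finite_indexP sH)[T [c cP]]].
have : ~~ injectiveb (fun k : 'I_#|T|.+1 => c (x ^+ k)).
  by apply/negP => /injectiveP /leq_card; rewrite card_ord ltnn.
case/injectivePn => i [j ij eij].
wlog lt : i j ij eij / i < j => [hw|].
  have [lt|lt|/ord_inj e] := ltngtP i j; [exact: (hw i j)| |].
    by apply: (hw j i) => //; rewrite eq_sym.
  by rewrite e eqxx in ij.
exists (j - i); first by rewrite subn_gt0.
have := cP _ _ eij; rewrite -{1}(subnKC (ltnW lt)) expgnDr mulKg //.
Qed.

Section Free.
Variables (I : finType) (x : I -> F) (i0 i1 : I).
Hypotheses (bF : basis [set: F] x) (i01 : i0 != i1).

(** An element whose reduced word ends with a letter other than [x i] does not
    commute with the powers of [x i]. *)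
Lemma fi_centralizer H c : fi_subgroup H -> (forall h, H h -> h ^ c = h) -> c = 1.
Proof.
move=> fH Hc; have [sH _] := fH; have [nf nfP] := basis_normal_form bF.
have ru := nf_reduced nfP (Logic.I : [set: F] c); have eu := nfK nfP (Logic.I : [set: F] c).
set u := nf c in ru eu; case eu' : u ru eu => [|a0 u'] ru eu; first by [].
pose a := last a0 u'; exfalso.
have [i ia] : exists i, i != a.1.
  by have [e|] := eqVneq a.1 i0; [exists i1; rewrite e eq_sym|exists i0; rewrite eq_sym].
pose b := a0 != (i, false); pose g := sgn x (i, b).
have [k k0 Hk] := fi_power (x i) fH; rewrite -(prednK k0) in Hk.
set w := nseq k.-1.+1 (i, b).
have ew : eval x w = g ^+ k.-1.+1.
  rewrite /w; elim: _.+1 => [|n IH] /=; first by rewrite expg0.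
  by rewrite IH expgS.
have Hg : H (g ^+ k.-1.+1).
  by rewrite /g /sgn; case: (b) => //=; rewrite expVgn; exact: (sgV sH).
have nn n : path (@nc I) (i, b) (nseq n (i, b)).
  by elim: n => //= n ->; rewrite /nc /inv_letter /= xpair_eqE eqxx; case: (b).
have ii : last (i, b) (nseq k.-1 (i, b)) = (i, b) by elim: (k.-1).
have pu : path (@nc I) a0 u' := ru.
have rwu : reduced (w ++ a0 :: u').
  rewrite /reduced /w /= cat_path nn ii /= pu andbT /nc /inv_letter /= /b.
  by case: (eqVneq a0 (i, false)) => [->|ne]; rewrite ?xpair_eqE ?eqxx.
have ruw : reduced ((a0 :: u') ++ w).
  rewrite /reduced /= cat_path pu /= nn andbT -/a /nc /inv_letter.
  by apply: contraNneq ia => -[->].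
have /(congr1 nf) : eval x (w ++ a0 :: u') = eval x ((a0 :: u') ++ w).
  by rewrite !eval_cat eu ew -{2}(Hc _ Hg) conjgE mulVKg.
rewrite !(nf_eval nfP) // => /(congr1 (last (i, b))).
rewrite !last_cat /= -/a ii => e.
by move: ia; rewrite e eqxx.
Qed.

Lemma ad_inj : injective ad.
Proof.
move=> g h e; apply: divg1_eq.
have /Comm_classP[W [fW _ eW]] : ad (g / h) = Comm_class (vid F).
  by rewrite adM e -adM mulgV; apply/Comm_classP; exists setT; split=> //;
    [exact: fi_subgroupT|move=> y _ /=; rewrite invg1 conjg1].
apply: invg_inj; rewrite invg1; apply: (fi_centralizer fW) => y Wy.
exact: (eW y Wy).
Qed.

Lemma ad_faith L (c : Comm F) : fi_in (range ad) L ->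
  (forall h, L h -> h ^ c = h) -> c = 1.
Proof.
move=> fL Lc; have [f ec fc] := comm_germ c; apply: invg_inj; rewrite ec.
rewrite invgK invg1; apply/Comm_classP.
have fH := fi_subgroup_emb adM fL.
exists (vdom f `&` ad @^-1` L); split=> [|y [] //|y [fy Ly] /=].
  by apply: fi_subgroupI => //; exact: vdomP.
by apply: ad_inj; rewrite -(fc _ fy); exact: Lc.
Qed.

Lemma basis_auto (K : Type) H (y z : K -> F) : fi_subgroup H -> basis H y ->
  basis H z -> exists f, [/\ vdom f = H, vcod f = H & forall i, f (y i) = z i].
Proof.
move=> fH bHy bHz; have [sH _] := fH.
have ext y' z' : basis H y' -> basis H z' ->
    exists f : F -> F, [/\ hom_on H f, forall i : K, f (y' i) = z' i &
      forall h, H h -> H (f h)].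
  move=> b1 b2; have [f fM fy] := proj2 b1 F z'; exists f; split=> // h Hh.
  have Hs (y0 : K -> F) a : basis H y0 -> H (sgn y0 a).
    by move=> b0; apply: (mem_sgn _ sH); exact: (basis_letter b0).
  have [u ->] := basis_word b1 Hh.
  elim: u => [|[i b] u IH] /=; first by rewrite (hom1_on sH fM); exact: sg1.
  rewrite fM; [|exact: Hs|by apply: (mem_eval _ sH); exact: (basis_letter b1)].
  apply: (sgM sH) => //.
  suff -> : f (sgn y' (i, b)) = sgn z' (i, b) by exact: Hs.
  rewrite /sgn /=; case: b => //; rewrite (homV_on sH fM) ?fy //.
  exact: (basis_letter b1).
have [f [fM fy fH']] := ext _ _ bHy bHz; have [g [gM gz gH]] := ext _ _ bHz bHy.
have comp (y1 z1 : K -> F) (f1 g1 : F -> F) : basis H y1 -> basis H z1 ->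
    hom_on H f1 -> hom_on H g1 ->
    (forall i, f1 (y1 i) = z1 i) -> (forall i, g1 (z1 i) = y1 i) ->
    (forall h, H h -> H (f1 h)) -> forall h, H h -> g1 (f1 h) = h.
  move=> b1 b2 f1M g1M f1y g1z f1H h Hh.
  apply: (basis_hom_ext b1 (f := g1 \o f1) (g := id)) => // [a b Ha Hb|i] /=.
    by rewrite f1M // g1M //; exact: f1H.
  by rewrite f1y g1z.
have fgK := comp _ _ _ _ bHz bHy gM fM gz fy gH.
have gfK := comp _ _ _ _ bHy bHz fM gM fy gz fH'.
have fbij : set_bij H H f.
  split=> [h /fH' //|a b /set_mem Ha /set_mem Hb e|h Hh].
    by rewrite -(gfK _ Ha) e gfK.
  by exists (g h); [exact: gH|exact: fgK].
by exists (VirtualIso fH fH fM fbij).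
Qed.

Lemma ad_real (K : finType) L (y z : K -> Comm F) : fi_in (range ad) L ->
  basis L y -> basis L z -> exists c, forall i, y i ^ c = z i.
Proof.
move=> fL; have fH := fi_subgroup_emb adM fL; have [_ LG _] := fL.
rewrite -(emb_preimage LG) => bLy bLz.
have lift w : basis (ad @` (ad @^-1` L)) w -> exists w' : K -> F, w = ad \o w'.
  move=> bw; apply: emb_lift => i; apply: (LG).
  by rewrite -(emb_preimage LG); exact: (basis_letter bw).
have [y' ey] := lift _ bLy; have [z' ez] := lift _ bLz; subst y z.
move: bLy bLz => /(emb_basis adM ad_inj) b1 /(emb_basis adM ad_inj) b2.
have [f [fd _ fy]] := basis_auto fH b1 b2.
exists (Comm_class f)^-1 => i /=; rewrite ad_conj ?fy // fd.
exact: basis_letter b1 i.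
Qed.

Lemma ad_germ (c : Comm F) : exists2 U, fi_in (range ad) U &
  forall u, U u -> range ad (u ^ c).
Proof.
have [f _ fc] := comm_germ c; exists (ad @` vdom f).
  by apply: (fi_in_emb adM ad_inj); exact: vdomP.
by move=> _ [y fy <-]; rewrite fc //; exists (f y).
Qed.

End Free.

End Commensurator.

(** * Special automorphisms *)

Section Derived.
Variables (G : groupType) (H : set G).
Hypothesis sH : subgroup H.
Implicit Types (x y d h : G).

(** Congruence modulo the derived subgroup. *)
Definition eqD x y := derived H (x^-1 * y).

Let sD : subgroup (derived H) := gen_subgroup _.

Lemma derived_comm x y : H x -> H y -> derived H [~ x, y].
Proof. by move=> Hx Hy; apply: in_gen; exists x, y. Qed.

Lemma derived_sub : derived H `<=` H.
Proof.
apply: (gen_min sH) => _ [x [y [Hx Hy ->]]].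
by rewrite commgEl; apply: (sgM sH); [exact: (sgV sH)|exact: (sgJ sH)].
Qed.

Lemma derivedJ d h : derived H d -> H h -> derived H (d ^ h).
Proof.
move=> Dd Hh; have -> : d ^ h = d * [~ d, h] by rewrite commgEl mulVKg.
by apply: (sgM sD) => //; apply: derived_comm => //; exact: derived_sub.
Qed.

Lemma eqD_refl x : eqD x x. Proof. by rewrite /eqD mulVg; exact: (sg1 sD). Qed.

Lemma eqD_sym x y : eqD x y -> eqD y x.
Proof. by move=> h; have := sgV sD h; rewrite invgM invgK. Qed.

Lemma eqD_trans x y z : eqD x y -> eqD y z -> eqD x z.
Proof. by move=> h1 h2; have := sgM sD h1 h2; rewrite -mulgA mulVKg. Qed.

Lemma eqD_mul x x' y y' : H y -> eqD x x' -> eqD y y' -> eqD (x * y) (x' * y').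
Proof.
move=> Hy h1 h2; have := sgM sD (derivedJ h1 Hy) h2.
by rewrite /eqD conjgE invgM !mulgA mulgK.
Qed.

Lemma eqD_comm x y : H x -> H y -> eqD (x * y) (y * x).
Proof.
move=> Hx Hy; have := derived_comm Hy Hx.
by rewrite /eqD commgEl conjgE invgM !mulgA.
Qed.

Lemma eqD_prod (r : nat) (a b : 'I_r -> G) :
  (forall i, H (a i)) -> (forall i, H (b i)) ->
  eqD (\prod_(i < r) (a i * b i)) ((\prod_(i < r) a i) * \prod_(i < r) b i).
Proof.
move=> Ha Hb.
suff [] : eqD (\prod_(i < r) (a i * b i)) ((\prod_(i < r) a i) * \prod_(i < r) b i) /\
  H (\prod_(i < r) a i) /\ H (\prod_(i < r) b i) by [].
apply: (big_ind3 (fun p u v => eqD p (u * v) /\ H u /\ H v)).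
- by rewrite mulg1; split; [exact: eqD_refl|split; exact: sg1].
- move=> p u v p' u' v' [e [Hu Hv]] [e' [Hu' Hv']]; split; last first.
    by split; exact: (sgM sH).
  have Hp' : H p'.
    exact: (sgMl sH (sgV sH (sgM sH Hu' Hv')) (derived_sub (eqD_sym e'))).
  apply: (eqD_trans (eqD_mul Hp' e e')).
  rewrite -!mulgA [v * (u' * v')]mulgA [u' * (v * v')]mulgA.
  apply: eqD_mul; [|exact: eqD_refl|].
    by apply: (sgM sH) => //; apply: (sgM sH).
  by apply: eqD_mul => //; [exact: eqD_comm|exact: eqD_refl].
- by move=> i _; split; [exact: eqD_refl|split].
Qed.

Lemma expgz_bool x (b c : bool) : expgz x (b%:R + c%:R)%R = x ^+ b * x ^+ c.
Proof. by case: b; case: c; rewrite ?mul1g ?mulg1. Qed.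

Lemma prod_delta (r : nat) (x : 'I_r -> G) k :
  \prod_(l < r) x l ^+ (l == k) = x k.
Proof.
rewrite -[RHS](big_pred1_eq mul k x) big_mkcond /=.
by apply: eq_bigr => l _; case: eqP.
Qed.

(** As each coefficient is a sum of two booleans, the row [k] of the matrix splits
    modulo the derived subgroup as the product of [x k] and of the letters selected
    by [c k]. *)
Lemma special_unip (r : nat) (x : 'I_r -> G) f (c : 'I_r -> 'I_r -> bool) :
  basis H x -> (\det (\matrix_(k, l) ((k == l)%:R + (c k l)%:R : int)) = 1)%R ->
  (forall k, eqD (f (x k)) (x k * \prod_(l < r) x l ^+ c k l)) -> special H f.
Proof.
move=> bH d1 fx; have Hx := basis_letter bH.
exists r, x, (\matrix_(k, l) ((k == l)%:R + (c k l)%:R : int))%R.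
split; [exact/is_basisP| |exact: d1].
move=> k; apply/(lcosetP _ _ sD); apply: (eqD_trans (fx k)).
rewrite -{1}(prod_delta x k); apply: eqD_sym.
have -> : \prod_(j < r) expgz (x j) ((\matrix_(k, l) ((k == l)%:R + (c k l)%:R : int))%R k j)
        = \prod_(j < r) (x j ^+ (j == k) * x j ^+ c k j).
  by apply: eq_bigr => j _; rewrite mxE expgz_bool eq_sym.
by apply: eqD_prod => i; apply: (sgX _ sH).
Qed.

Lemma special_id (I : finType) (x : I -> G) f : basis H x ->
  (forall i, eqD (f (x i)) (x i)) -> special H f.
Proof.
move=> bH fx.
have bH' : basis H (x \o enum_val) :=
  basis_reindex (@enum_valK _) (@enum_rankK _) bH.
apply: (special_unip (c := fun _ _ => false) bH').
  rewrite -[RHS](det1 _ #|I|); congr (\det _)%R.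
  by apply/matrixP => k l; rewrite !mxE GRing.addr0.
move=> k; rewrite big1 ?mulg1 // /comp; exact: fx.
Qed.

Lemma special_transvection (I : finType) (x : I -> G) f i j : basis H x ->
  i != j -> eqD (f (x i)) (x i * x j) -> (forall k, k != i -> f (x k) = x k) ->
  special H f.
Proof.
move=> bH ij fi fk.
have bH' : basis H (x \o enum_val) :=
  basis_reindex (@enum_valK _) (@enum_rankK _) bH.
pose i' := enum_rank i; pose j' := enum_rank j.
have ij' : i' != j' by apply: contraNneq ij => /enum_rank_inj ->.
apply: (special_unip (c := fun k l => (k == i') && (l == j')) bH').
  set A := (\matrix_(k, l) _)%R.
  have Add k : A k k = 1%R.
    rewrite mxE eqxx; have [->|] := eqVneq k i'; last by rewrite /= GRing.addr0.
    by rewrite (negbTE ij') GRing.addr0.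
  have [lt|lt|/val_inj e] := ltngtP j' i'; last by rewrite e eqxx in ij'.
    rewrite det_trig; first by rewrite big1.
    apply/is_trig_mxP => k l kl; rewrite mxE.
    have -> : k == l = false by apply/eqP => e; rewrite e ltnn in kl.
    case: eqP kl => //= -> kl; case: eqP kl => // -> kl.
    by rewrite ltnNge ltnW in kl.
  rewrite -det_tr det_trig; first by rewrite big1 // => k _; rewrite mxE.
  apply/is_trig_mxP => k l kl; rewrite 2!mxE.
  have -> : l == k = false by apply/eqP => e; rewrite e ltnn in kl.
  case: eqP kl => //= -> kl; case: eqP kl => // -> kl.
  by rewrite ltnNge ltnW in kl.
move=> k; have [->|ki] := eqVneq k i'; last first.
  rewrite big1 => [|l _]; last exact: expg0.
  rewrite mulg1 /= fk; first exact: eqD_refl.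
  by apply: contraNneq ki => e; rewrite /i' -e enum_valK.
rewrite (prod_delta (x \o enum_val)) /= !enum_rankK; exact: fi.
Qed.

End Derived.

Section Exponents.
Import GRing.Theory.
Local Open Scope ring_scope.
Variables (G : groupType) (H : set G) (r : nat) (x : 'I_r -> G).
Hypothesis bH : basis H x.

Let sH : subgroup H := basis_subgroup bH.

Definition translation (v : 'rV[int]_r) : self_bij 'rV[int]_r :=
  SelfBij (fun w => addKr v w) (fun w => addNKr v w).

(** The exponent sums are read off an action of [H] on the lattice by translations. *)
Lemma exponents : exists D : G -> 'rV[int]_r,
  [/\ forall a b, H a -> H b -> D (a * b)%g = D a + D b,
      forall i, D (x i) = delta_mx 0 i &
      forall a b, eqD H a b -> H a -> H b -> D a = D b].
Proof.
have [f fM fx] := proj2 bH _ (fun i => translation (delta_mx 0 i)).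
have sT : subgroup [set a | H a /\ forall w, f a w = f a 0 + w].
  split=> [|a b [Ha fa] [Hb fb]|a [Ha fa]].
  - by split=> [|w]; [exact: sg1|rewrite (hom1_on sH fM) !bij1 add0r].
  - split=> [|w]; first exact: (sgM sH).
    by rewrite fM // !bijM fb fa [f a (f b 0)]fa addrA.
  - split=> [|w]; first exact: (sgV sH).
    rewrite (homV_on sH fM) //; apply: (can_inj (bijK (f a))).
    by rewrite -[LHS]bijM mulgV bij1 [RHS]fa addrA -fa -bijM mulgV bij1 add0r.
have fT a w : H a -> f a w = f a 0 + w.
  rewrite (proj1 bH) => Ha; apply: (proj2 ((gen_min sT) _ a Ha)).
  by move=> _ [i _ <-]; split; [exact: (basis_letter bH)|move=> w'; rewrite fx /= addr0].
have DM a b : H a -> H b -> f (a * b)%g 0 = f a 0 + f b 0.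
  by move=> Ha Hb; rewrite fM // bijM fT.
have D1 : f 1%g 0 = 0 by rewrite (hom1_on sH fM) bij1.
have DV a : H a -> f a^-1%g 0 = - f a 0.
  move=> Ha; apply/eqP; rewrite -addr_eq0 -DM ?mulVg ?D1 //; exact: (sgV sH).
exists (fun a => f a 0); split=> // [i|a b dab Ha Hb].
  by rewrite fx /= addr0.
have sK : subgroup [set d | H d /\ f d 0 = 0].
  split=> [|c d [Hc c0] [Hd d0]|c [Hc c0]] /=.
  - by split; [exact: sg1|].
  - by split; [exact: (sgM sH)|rewrite DM // c0 d0 addr0].
  - by split; [exact: (sgV sH)|rewrite DV // c0 oppr0].
have [] : H (a^-1 * b)%g /\ f (a^-1 * b)%g 0 = 0.
  apply: (gen_min sK) dab => _ [c [d [Hc Hd ->]]]; split.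
    by rewrite commgEl; apply: (sgM sH); [exact: (sgV sH)|exact: (sgJ sH)].
  have HV := sgV sH; have HM := sgM sH.
  rewrite commgEl conjgE !(DM, DV) //; try by auto.
  by rewrite [f c 0 + _]addrC addKr addNr.
move=> _; rewrite DM // ?DV //; last exact: (sgV sH).
by move=> /eqP; rewrite addrC subr_eq0 => /eqP.
Qed.

Lemma exponents_prod D (c : 'I_r -> int) :
  (forall a b, H a -> H b -> D (a * b)%g = D a + D b :> 'rV[int]_r) ->
  H (\prod_(j < r) expgz (x j) (c j))%g /\
  D (\prod_(j < r) expgz (x j) (c j))%g = \sum_(j < r) c j *: D (x j).
Proof.
move=> DM; have Hx := basis_letter bH.
have D1 : D 1%g = 0 by apply: (addrI (D 1%g)); rewrite -DM ?mulg1 ?addr0 //; exact: sg1.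
have DX a n : H a -> D (a ^+ n)%g = D a *+ n.
  move=> Ha; elim: n => [|n IH]; first by rewrite expg0 D1.
  by rewrite expgS DM ?IH ?mulrS //; exact: (sgX _ sH).
apply: (big_ind2 (fun g v => H g /\ D g = v)) => [|g v h w [Hg <-] [Hh <-]|j _].
- by split; [exact: sg1|].
- by split; [exact: (sgM sH)|exact: DM].
- rewrite -[c j in RHS]intz scaler_int; case: (c j) => n /=.
    by split; [exact: (sgX _ sH)|exact: DX].
  have Hn := sgX n.+1 sH (Hx j); split; first exact: (sgV sH).
  apply/eqP; rewrite NegzE mulrNz -addr_eq0 -pmulrn -DX // -DM ?mulVg ?D1 //.
  exact: (sgV sH).
Qed.

(** A multiplication adds a row to another one; an inversion changes the sign of a row. *)
Lemma det_nie D b (y z : 'I_r -> G) :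
  (forall a b, H a -> H b -> D (a * b)%g = D a + D b :> 'rV[int]_r) ->
  nie b y z -> (forall i, H (y i)) ->
  (forall i, H (z i)) /\
  \det (\matrix_(i < r) D (z i)) = (-1) ^+ b * \det (\matrix_(i < r) D (y i)).
Proof.
move=> DM n Hy.
have D1 : D 1%g = 0 by apply: (addrI (D 1%g)); rewrite -DM ?mulg1 ?addr0 //; exact: sg1.
have DV a : H a -> D a^-1%g = - D a.
  move=> Ha; apply/eqP; rewrite -addr_eq0 -DM ?mulVg ?D1 //; exact: (sgV sH).
have Hupd (w : 'I_r -> G) i g : (forall k, H (w k)) -> H g -> forall k, H (upd w i g k).
  by move=> Hw Hg k; rewrite /upd; case: eqP.
have row'E (w : 'I_r -> G) i g :
    row' i (\matrix_(k < r) D (upd w i g k)) = row' i (\matrix_(k < r) D (w k)).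
  by apply/matrixP => k l; rewrite !mxE upd_other // eq_sym neq_lift.
have rowE' (w : 'I_r -> G) i : row i (\matrix_(k < r) D (w k)) = D (w i) by rewrite rowK.
elim: n Hy => {b y z} [y|b y z i j _ IH ij|b y z i _ IH] Hy.
- by split=> //; rewrite mul1r.
- have {IH} [Hz IH] := IH Hy; split; first by apply: Hupd => //; exact: (sgM sH).
  rewrite (@determinant_multilinear _ _ _ (\matrix_(k < r) D (z k))
    (\matrix_(k < r) D (upd z i (z j) k)) i 1 1) ?row'E //; last first.
    by rewrite !rowE' !upd_same DM // !scale1r.
  rewrite [X in _ + 1 * X](determinant_alternate ij) => [|k]; last first.
    by rewrite !mxE upd_same upd_other // eq_sym.
  by rewrite mulr0 addr0 mul1r.
- have {IH} [Hz IH] := IH Hy; split; first by apply: Hupd => //; exact: (sgV sH).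
  rewrite (@determinant_multilinear _ _ _ (\matrix_(k < r) D (z k))
    (\matrix_(k < r) D (z k)) i (-1) 0) ?row'E //; last first.
    by rewrite !rowE' upd_same DV // scaleN1r scale0r addr0.
  by rewrite mul0r addr0 IH; case: (b); rewrite /= ?expr0 ?expr1 ?mulrNN ?mulN1r ?mul1r ?opprK.
Qed.

End Exponents.

Section Special.
Import GRing.Theory.
Local Open Scope ring_scope.

(** By Nielsen's theorem a special automorphism is a product of elementary Nielsen
    moves; the determinant of the exponent sums counts the inversions among them
    modulo 2. *)
Lemma special_nie (F : groupType) (f : virtual_iso F) : vdom f = vcod f ->
  special (vdom f) f -> exists (r : nat) (x : 'I_r -> F),
    basis (vdom f) x /\ nie false x (f \o x).
Proof.
move=> dc [r [x [A [/is_basisP bH fA dA]]]]; exists r, x; split=> //.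
have sH := basis_subgroup bH; have Hx := basis_letter bH.
have Hfx i : vdom f (f (x i)) by rewrite {1}dc; exact: vcodf.
have bf : basis (vdom f) (f \o x).
  split.
    apply/seteqP; split=> [h|]; last by apply: (gen_min sH) => _ [i _ <-] /=.
    rewrite {1}dc => /vinv_funP[]; set g := vinv_fun f h => Hg <-.
    have [u eu] := basis_word bH Hg; rewrite eu; apply/gen_wordP; exists u.
    elim: u {eu} => [|[i b] u IH] /=; first exact: (hom1_on sH (@vfunM _ f)).
    rewrite vfunM; [|exact: mem_sgn|exact: mem_eval].
    congr (_ * _)%g => //; rewrite /sgn /=; case: b => //.
    exact: (homV_on sH (@vfunM _ f)).
  move=> K a; have [g gM gx] := proj2 bH K a.
  exists (g \o vinv_fun f) => [h k Hh Hk|i] /=; last by rewrite vfunK // gx.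
  rewrite dc in Hh Hk; rewrite vinv_funM // gM //.
    by have [] := vinv_funP Hh.
  by have [] := vinv_funP Hk.
have [b n] := nielsen bf bH.
have [D [DM Dx DD]] := exponents bH.
have [_] := det_nie bH DM n Hx.
have -> : \matrix_(i < r) D (x i) = 1%:M.
  by apply/row_matrixP => i; rewrite rowK row1 Dx.
have -> : \matrix_(i < r) D ((f \o x) i) = A.
  apply/row_matrixP => i; rewrite rowK.
  have [Hprod Dprod] := exponents_prod bH (A i) DM.
  have /lcosetP h := fA i.
  rewrite (DD _ _ (h (gen_subgroup _)) (Hfx i) Hprod) Dprod.
  by rewrite [RHS]row_sum_delta; apply: eq_bigr => j _; rewrite mxE Dx.
rewrite dA det1 mulr1 => /eqP; case: b n => // _.
Qed.

End Special.

(** * Normal subgroups with cyclic quotient *)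

Section Family.

Variable F : groupType.
Implicit Types (H : set F) (s g h : F).

Lemma lcosets_card H s n : subgroup H -> (forall g h, H g -> H (g ^ h)) ->
  (forall g, exists2 i, i < n & H (g * s ^+ i)) ->
  (forall j, H (s ^+ j) -> n %| j) ->
  lcosets H = (fun i => lcoset (s ^- i) H) @` `I_n /\ lcosets H #= `I_n.
Proof.
move=> sH nH cover lev.
have e : lcosets H = (fun i => lcoset (s ^- i) H) @` `I_n.
  apply/seteqP; split=> [_ [g _ <-]|_ [i lt <-]]; last by exists (s ^- i).
  have [i lt Hi] := cover g; exists i => //; apply/(lcosetP _ _ sH).
  by have := nH _ g Hi; rewrite invgK conjgE mulgA mulKg.
split=> //; rewrite e; apply: inj_card_eq => i j /set_mem /= li /set_mem /= lj.
move=> /(lcosetP _ _ sH); rewrite invgK => h.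
wlog ij : i j li lj h / i <= j => [hw|].
  have [/hw|/ltnW ji] := leqP i j; first exact.
  apply/esym; apply: (hw j i) => //.
  by have := sgV sH h; rewrite invgM invgK.
have : H (s ^+ (j - i)).
  have := sgV sH h; rewrite invgM invgK -{1}(subnK ij) expgnDr.
  by rewrite mulgK.
move=> /lev /dvdnP[[|q] e0]; first lia.
by move: e0; rewrite mulSn; lia.
Qed.

Lemma skernel_family (J : Type) m (y : option J -> F) : 0 < m ->
  basis [set: F] y ->
  [/\ fi_subgroup (skernel m y), normal_in (skernel m y) [set: F] &
      cyclic_quotient (skernel m y) m].
Proof.
move=> m0 bF; have sK := skernel_subgroup m y.
have nK g h : skernel m y g -> skernel m y (g ^ h).
  by move=> Kg; exact: (skernel_normal m0 bF).
have [e c] := lcosets_card sK nK (fun g => skernel_coset m0 bF (Logic.I : [set: F] g))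
  (fun j => @skernel_level _ _ _ m0 _ _ j bF).
split.
- by split=> //; rewrite /finite_index e; apply/finite_image/finite_II.
- by split=> // g h Kg _; exact: nK.
- split=> //; exists (y None)^-1 => g.
  have : lcosets (skernel m y) (lcoset g (skernel m y)) by exists g.
  by rewrite e => -[i _ <-]; exists (Posz i); rewrite /= expVgn.
Qed.

(** Euclid's algorithm on the images of the letters in the cyclic quotient
    yields a basis all but one letter of which belong to [H]. *)
Lemma family_skernel d (i1 : 'I_d) (x : 'I_d -> F) H m : 0 < m -> basis [set: F] x ->
  normal_in H [set: F] -> cyclic_quotient H m ->
  exists (J : finType) (y : option J -> F), basis [set: F] y /\ H = skernel m y.
Proof.
move=> m0 bF [sH _ nH'] [[t tP] cH].
have nH g h : H g -> H (g ^ h) by move=> Hg; exact: nH'.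
have fH : fi_subgroup H.
  by split=> //; exists m.
have [n n0 tn] := fi_power t fH.
have nat_exp g : exists k, H (g^-1 * t ^+ k).
  have [[k|k] /(lcosetP _ _ sH) /= h] := tP g; first by exists k.
  exists (k.+1 * n.-1)%N; have -> : t ^+ (k.+1 * n.-1) = t ^- k.+1 * (t ^+ n) ^+ k.+1.
    rewrite -expgnA mulnC -{2}(prednK n0) mulSn expgnDr mulKg //.
  by rewrite mulgA; apply: (sgM sH) => //; exact: (sgX _ sH).
pose Q N := exists (y : 'I_d -> F) k, [/\ basis [set: F] y,
  forall i, H ((y i)^-1 * t ^+ k i) & \sum_(i < d) k i = N].
have exQ : exists N, `[< Q N >].
  have /boolp.choice[k kP] i : exists k, H ((x i)^-1 * t ^+ k) := nat_exp (x i).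
  by exists (\sum_(i < d) k i); apply/asboolP; exists x, k.
have [N /asboolP[y [k [by_ ky eN]]] minN] := find_ex_minn exQ.
have one i j : i != j -> 0 < k j -> k i < k j.
  move=> ij kj; rewrite ltnNge; apply/negP => le.
  pose k' l := if l == i then k i - k j else k l.
  have : N <= \sum_(l < d) k' l.
    apply: minN; apply/asboolP; exists (upd y i (y i * (y j)^-1)), k'; split=> //.
      apply: (basis_updr by_); apply: (sgV (gen_subgroup _)).
      by apply: in_gen; exists j => //=; rewrite eq_sym.
    move=> l; rewrite /k' /upd; case: eqP => // _.
    have -> : (y i * (y j)^-1)^-1 * t ^+ (k i - k j) =
      ((y i)^-1 * t ^+ k i) ^ (y j)^-1 * ((y j)^-1 * t ^+ k j)^-1 ^ t ^- k j.
      rewrite -{2}(subnK le) expgnDr !conjgE !invgM !invgK !mulgA.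
      by rewrite !gnorm.
    by apply: (sgM sH); apply: nH => //; exact: (sgV sH).
  rewrite -eN (bigD1 i) //= [leqRHS](bigD1 i) //= {1}/k' eqxx.
  rewrite [X in _ <= _ + X](eq_bigr k) => [|l /negbTE li]; last by rewrite /k' li.
  by rewrite leq_add2r; lia.
have [i0 zero] : exists i0, forall j, j != i0 -> k j = 0.
  have [/existsP[i0 ki]|/existsPn all0] := boolP [exists i, 0 < k i]; last first.
    by exists i1 => j _; have := all0 j; lia.
  exists i0 => j ji; have := one _ _ ji ki; rewrite eq_sym in ji.
  by have := one _ _ ji; lia.
have bz := basis_pivot i0 by_; set z := pivot _ in bz; set s := y i0.
have Hz l : H (z (Some l)).
  have := ky (val l); rewrite zero ?(valP l) // expg0 mulg1.
  by move/(sgV sH); rewrite invgK.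
have [q q0 sq] : exists2 q, 0 < q & H (s ^+ q) /\ forall j, H (s ^+ j) -> q %| j.
  have exq : exists q, (0 < q) && `[< H (s ^+ q) >].
    by have [q q0 Hq] := fi_power s fH; exists q; rewrite q0; apply/asboolP.
  have [q /andP[q0 /asboolP Hq] qmin] := find_ex_minn exq.
  exists q => //; split=> // j Hj.
  have Hm : H (s ^+ (j %% q)).
    apply: (sgMl sH (sgX (j %/ q) sH Hq)).
    by rewrite -expgnA -expgnDr mulnC -divn_eq.
  rewrite /dvdn; apply: contraT => jq.
  have := qmin (j %% q); rewrite lt0n jq leqNgt ltn_pmod // => h.
  by apply: h; apply/asboolP.
have [Hq qdiv] := sq.
have KH : skernel q z `<=` H.
  apply: (gen_min sH) => _ [[[l j]|] _ <-] //=; exact: nH.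
have cover g : exists2 i, i < q & H (g * s ^+ i).
  have [i lt Ki] := skernel_coset q0 bz (Logic.I : [set: F] g).
  by exists i => //; exact: KH.
have [_ cq] := lcosets_card sH nH cover qdiv.
have qm : q = m by apply/card_eq_II; rewrite -(card_eql cq).
exists {i : 'I_d | i != i0}, z; split=> //; apply/seteqP; split; last by rewrite -qm.
move=> h Hh; have [i lt Ki] := skernel_coset q0 bz (Logic.I : [set: F] h).
have /qdiv : H (s ^+ i) := sgMl sH Hh (KH _ Ki).
case: i lt Ki => [|i] lt; first by rewrite expg0 mulg1 qm.
by move=> _ /(dvdn_leq (ltn0Sn i)); rewrite leqNgt lt.
Qed.

(** Modulo [H], the subgroup of a basis [(s, z)], the letters of any other basis
    are powers of [s]: the exponents modulo [m] determine [H]. *)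
Lemma finite_family (I : finType) (x : I -> F) m : 1 < m -> basis [set: F] x ->
  exists K : {ffun I -> 'I_m} -> set F,
    forall (J : Type) (y : option J -> F), basis [set: F] y ->
      exists v, skernel m y = K v.
Proof.
move=> m1 bF; have m0 := ltnW m1.
exists (fun v : {ffun I -> 'I_m} =>
  [set g | exists2 u, g = eval x u & m %| weights m (fun i => v i) u]).
move=> J y by_; set H := skernel m y; set s := y None.
have sH : subgroup H := skernel_subgroup m y.
have nH g h : H g -> H (g ^ h).
  by move=> Hg; exact: (skernel_normal m0 by_).
have sm : H (s ^+ m) := @skernel_letter _ _ _ y None.
have /boolp.choice[v vP] i : exists k : 'I_m, H (x i * s ^+ k).
  have [k lt Hk] := skernel_coset m0 by_ (Logic.I : [set: F] (x i)).
  by exists (Ordinal lt).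
exists (finfun v); set w := weights m _.
have Hw u : H (eval x u * s ^+ w u).
  elim: u => [|[i b] u IH]; first by rewrite /w /weights /= expg0 mulg1; exact: sg1.
  have -> : w ((i, b) :: u) = (w u + weight m (fun i => finfun v i) (i, b))%N.
    by rewrite /w /weights /= addnC.
  have HiV : H (sgn x (i, b) * s ^+ weight m (fun i => finfun v i) (i, b)).
    rewrite /sgn /weight /= ffunE; case: b => //.
    have -> : (x i)^-1 * s ^+ (m - v i) =
        (x i * s ^+ v i)^-1 ^ s ^- v i * s ^+ m.
      have -> : s ^+ m = s ^+ v i * s ^+ (m - v i).
        by rewrite -expgnDr subnKC // ltnW.
      rewrite conjgE invgM invgK.
      by rewrite !mulgA !gnorm.
    by apply: (sgM sH) => //; apply: nH; exact: (sgV sH).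
  rewrite /= expgnDr.
  set a := sgn x (i, b) in HiV *; set k := s ^+ weight _ _ _ in HiV *.
  have -> : a * eval x u * (s ^+ w u * k) = (a * k) * (eval x u * s ^+ w u) ^ k.
    by rewrite conjgE !mulgA !gnorm.
  by apply: (sgM sH) => //; exact: nH.
have Hev u : H (eval x u) <-> m %| w u.
  split=> [Hu|/dvdnP[q wq]].
    by apply: (skernel_level m0 by_); exact: (sgMl sH Hu (Hw u)).
  apply: (sgMr sH _ (Hw u)); rewrite wq mulnC expgnA; exact: (sgX q sH sm).
apply/seteqP; split=> [g Hg|g [u -> mu]]; last exact/Hev.
have [u eu] := basis_word bF (Logic.I : [set: F] g).
by exists u => //; apply/Hev; rewrite -eu.
Qed.

End Family.

(** * The group generated by the special automorphisms *)

Section Main.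
Variables (F : groupType) (d m : nat) (x : 'I_d -> F).
Hypotheses (bF : basis [set: F] x) (d5 : 4 < d) (m1 : 1 < m).

Let m0 : 0 < m := ltnW m1.
Let d0 : 0 < d := leq_trans (isT : 0 < 5) d5.
Let d1 : 1 < d := leq_trans (isT : 1 < 5) d5.
Let i0 : 'I_d := Ordinal d0.
Let i1 : 'I_d := Ordinal d1.
Let i01 : i0 != i1 := isT.

Local Notation ad := (@ad F).
Local Notation S := (S_ m F).
Local Notation G := (range ad).

Let iM : forall g h : F, ad (g * h) = ad g * ad h := @adM F.
Let iI : injective ad := ad_inj bF i01.
Let faith := @ad_faith F _ x i0 i1 bF i01.
Let real := @ad_real F _ x i0 i1 bF i01.
Let sS : subgroup S := gen_subgroup _.

Lemma basis_range (I : Type) (y : I -> Comm F) : basis G y ->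
  exists2 y', y = ad \o y' & basis [set: F] y'.
Proof.
move=> bG; have [y' ey] := emb_lift (basis_letter bG); exists y' => //.
by apply/(emb_basis iM iI); rewrite -ey.
Qed.

Lemma class_in_S (J : Type) (y : option J -> F) (f : virtual_iso F) :
  basis [set: F] y -> vdom f = skernel m y -> vcod f = skernel m y ->
  special (skernel m y) f -> S (Comm_class f).
Proof.
move=> by_ fd fc sf; have [_ nH cH] := skernel_family m0 by_.
by apply: in_gen; exists (skernel m y) => //; exists f.
Qed.

(** The transvections of a Schreier basis are special automorphisms of the kernel. *)
Lemma S_TV (J : finType) (y : option J -> Comm F) : basis G y ->
  TV S (schreier (n := m) y).
Proof.
move=> /basis_range[y' -> by_]; rewrite -emb_schreier //; set z := schreier y'.
have [fH _ _] := skernel_family m0 by_; have [sH _] := fH.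
have bz : basis (skernel m y') z := schreier_basis m0 by_.
have fK := fi_in_emb iM iI fH.
have bK := proj1 (emb_basis iM iI _ _) bz.
have Hz := basis_letter bz.
have main (f : virtual_iso F) c : vdom f = skernel m y' -> vcod f = skernel m y' ->
    special (skernel m y') f -> (forall k, ad (z k) ^ c = ad (f (z k))) -> S c.
  move=> fd fc sf fz; have -> : c = (Comm_class f)^-1.
    apply: (conj_basis_inj faith fK bK) => k; rewrite /= fz ad_conj // fd.
    exact: Hz.
  by apply: (sgV sS); exact: (class_in_S by_).
have gj i j : i != j -> gen (z @` [set k | k != i]) (z j).
  by move=> ij; apply: in_gen; exists j => //=; rewrite eq_sym.
move=> i j c ij [|] [ci cf].
- have [f [fd fc fz]] := basis_auto fH bz (basis_updr bz (gj i j ij)).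
  apply: (main f c fd fc) => [|k].
    apply: (special_transvection sH bz ij) => [|k ki]; rewrite fz.
      by rewrite upd_same; exact: eqD_refl.
    by rewrite upd_other.
  rewrite fz; have [->|ki] := eqVneq k i; first by rewrite upd_same iM.
  by rewrite upd_other //; exact: cf.
- have [f [fd fc fz]] := basis_auto fH bz (basis_updl bz (gj i j ij)).
  apply: (main f c fd fc) => [|k].
    apply: (special_transvection sH bz ij) => [|k ki]; rewrite fz.
      by rewrite upd_same; exact: eqD_comm.
    by rewrite upd_other.
  rewrite fz; have [->|ki] := eqVneq k i; first by rewrite upd_same iM.
  by rewrite upd_other //; exact: cf.
Qed.

(** An inner automorphism acts trivially on the abelianization of any normal
    subgroup containing the conjugating element. *)
Lemma G_sub_S : G `<=` S.
Proof.
have eG : G = gen (range (ad \o x)) by rewrite -emb_gen // -(proj1 bF).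
rewrite eG; apply: (gen_min sS) => _ [i _ <-] /=.
have [j ji] : exists j : 'I_d, i != j.
  by have [->|] := eqVneq i i0; [exists i1|exists i0].
have by_ := basis_pivot j bF; set y := pivot _ in by_.
have [fH nH _] := skernel_family m0 by_; have [sH _ nH'] := nH.
have nHJ g h : skernel m y g -> skernel m y (g ^ h) by move=> Hg; exact: nH'.
have Hx : skernel m y (x i) := @skernel_z _ _ _ m0 y (Sub i ji).
have -> : ad (x i) = Comm_class (inner fH nHJ (x i)^-1).
  by rewrite inner_ad invgK.
apply: (class_in_S by_) => //.
apply: (special_id sH (schreier_basis m0 by_)) => o /=.
apply: eqD_sym; rewrite /eqD -commgEl.
apply: derived_comm; last exact: (sgV sH).
exact: (@skernel_letter _ _ m y o).
Qed.

(** By Nielsen's theorem a special automorphism is a product of transvections of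
    any basis of the kernel, in particular of a Schreier basis. *)
Lemma SAut_sub N (J : finType) (y : option J -> F) : subgroup N ->
  basis [set: F] y -> TV N (schreier (n := m) (ad \o y)) ->
  SAut (skernel m y) `<=` N.
Proof.
move=> sN by_ tv _ [f [fd fc sf ->]].
have [fH _ _] := skernel_family m0 by_.
have fK := fi_in_emb iM iI fH.
have [r [z [bz nz]]] := @special_nie _ f (etrans fd (esym fc)) ltac:(by rewrite fd).
have bz' := bz; rewrite fd in bz'.
have bK := proj1 (emb_basis iM iI _ _) bz'.
have bS := proj1 (emb_basis iM iI _ _) (schreier_basis m0 by_).
have bS' : basis (ad @` skernel m y) (schreier (n := m) (ad \o y)).
  by rewrite -emb_schreier.
have tvz := TV_basis real sN fK bS' bK tv.
have [k0] : exists k0 : 'I_r, True.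
  have := basis_card bK bS'; rewrite card_ord card_option.
  by case: r {z bz nz bz' bK tvz} => // r _; exists ord0.
move=> _; apply: (sgVE sN).
apply: (nie_S faith real sN fK bK tvz (emb_nie iM nz) (i0 := k0)) => i /=.
by rewrite ad_conj //; exact: (basis_letter bz).
Qed.

Lemma S_sub N : subgroup N ->
  (forall (J : finType) (y : option J -> F), basis [set: F] y ->
     TV N (schreier (n := m) (ad \o y))) -> S `<=` N.
Proof.
move=> sN tv; apply: (gen_min sN) => c [H [nH cH]].
have [J [y [by_ ->]]] := family_skernel i0 m0 bF nH cH.
by apply: (SAut_sub sN by_); exact: tv.
Qed.

Lemma basis_ad (I : Type) (y : I -> F) : basis [set: F] y -> basis G (ad \o y).
Proof. by move=> by_; apply/(emb_basis iM iI). Qed.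

Lemma S_simple : simple S.
Proof.
have fG : fi_in G G.
  have := fi_in_emb iM iI (fi_subgroupT F); exact.
have bG := basis_ad bF.
have Gb : exists (I : finType) (y : I -> Comm F), basis G y /\ 4 < #|I|.
  by exists 'I_d, (ad \o x); rewrite card_ord.
split=> // [S1|N [sN NS nN]].
  have [h [_ [e1 e2]]] : exists f, hom_on [set: F] f /\ (f (x i0) = SelfBij negbK negbK) /\ f 1 = 1.
    have [f fM fx] := proj2 bF _ (fun=> SelfBij negbK negbK).
    by exists f; split=> //; split; [exact: fx|exact: (hom1_on (subgroupT F) fM)].
  have : S (ad (x i0)) by apply: G_sub_S; exists (x i0).
  rewrite S1 => /= e; have x1 : x i0 = 1 by apply: iI; rewrite e emb1.
  rewrite x1 e2 in e1; have := congr1 (fun h : self_bij bool => h true) e1.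
  by [].
have [triv|[n [Nn n1]]] : (forall n, N n -> n = 1) \/ exists n, N n /\ n <> 1.
  have [h|h] := pselect (exists n, N n /\ n <> 1); [by right|left=> n Nn].
  by apply: contrapT => n1; apply: h; exists n.
  left; apply/seteqP; split=> [n /triv //|_ ->]; exact: sg1.
right; apply/seteqP; split=> //.
have p_pr : prime (pdiv m) := pdiv_prime m1.
have GN : G `<=` N.
  apply: (normal_contains_G faith real sS fG G_sub_S m1 p_pr (pdiv_dvd m) Gb S_TV sN nN) => //.
    by exists n.
  exact: (ad_germ bF i01).
apply: (S_sub sN) => J y by_; have bGy := basis_ad by_.
apply: (normal_contains_TV faith real sS fG m1 S_TV sN nN GN _ bGy).
have := basis_card bG bGy; rewrite card_ord card_option; lia.
Qed.

Lemma S_finitely_generated : finitely_generated S.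
Proof.
have [K famK] := finite_family m1 bF.
have /boolp.choice[A AP] v : exists A, [/\ finite_set A, A `<=` S &
    forall (J : finType) (y : option J -> F), basis [set: F] y ->
      skernel m y = K v -> SAut (K v) `<=` gen A].
  have [[J [y [by_ yv]]]|h] := pselect (exists (J : finType) (y : option J -> F),
    basis [set: F] y /\ skernel m y = K v); last first.
    by exists set0; split=> // J y by_ yv; exfalso; apply: h; exists J, y.
  set B := schreier (n := m) (ad \o y).
  have [fH _ _] := skernel_family m0 by_.
  have fK := fi_in_emb iM iI fH.
  have bS := proj1 (emb_basis iM iI _ _) (schreier_basis m0 by_).
  have bB : basis (ad @` skernel m y) B by rewrite /B -emb_schreier.
  pose A := [set c | exists i j, i != j /\ (isR B i (B j) c \/ isL B i (B j) c)].
  have tvA : TV (gen A) B by move=> i j c ij h; apply: in_gen; exists i, j.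
  exists A; split.
  - pose T := option (J * 'I_m).
    pose g (t : T * T * bool) := xget 1 [set c |
      if t.2 then isR B t.1.1 (B t.1.2) c else isL B t.1.1 (B t.1.2) c].
    apply: (@sub_finite_set _ _ (g @` setT)); last exact/finite_image/finite_finset.
    move=> c [i [j [_ [rc|lc]]]]; [exists (i, j, true)|exists (i, j, false)] => //.
      by apply: (isR_uniq faith fK bB _ rc); exact: (@xgetI _ 1 [set c | isR B i (B j) c] c rc).
    by apply: (isL_uniq faith fK bB _ lc); exact: (@xgetI _ 1 [set c | isL B i (B j) c] c lc).
  - by move=> c [i [j [ij h]]]; exact: (S_TV (basis_ad by_) ij h).
  - by move=> _ _ _ _; rewrite -yv; apply: (SAut_sub (gen_subgroup _) by_).
exists (\bigcup_(v in setT) A v).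
  by apply: bigcup_finite => [|v _]; [exact: finite_finset|have [] := AP v].
apply/seteqP; split; last first.
  by apply: (gen_min sS) => c [v _ Ac]; have [_ + _] := AP v; apply.
apply: (gen_min (gen_subgroup _)) => c [H [nH cH]].
have [J [y [by_ eH]]] := family_skernel i0 m0 bF nH cH.
have [v ev] := famK J y by_; have [_ _ /(_ J y by_ ev) h] := AP v.
rewrite eH ev => /h; apply: gen_sub => a Aa; by exists v.
Qed.

End Main.

Theorem theoremB (m : nat) (hm : 2 <= m) (F : nat -> groupType)
    (hF : forall d, 2 <= d -> free_of_rank (F d) d) :
  infinite_set [set d | [/\ 2 <= d, finitely_generated (S_ m (F d))
                          & simple (S_ m (F d))]].
Proof.
have : infinite_set ([set: nat] `\` `I_5) := infinite_setD infinite_nat (finite_II 5).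
apply: sub_infinite_set => d [_ /negP]; rewrite -leqNgt => d5.
have d2 : 2 <= d := leq_trans (isT : 2 <= 5) d5.
have [x /is_basisP bF] := hF d d2.
by split=> //; [exact: (S_finitely_generated bF)|exact: (S_simple bF)].
Qed.
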